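(* Let $A\in\mathrm{GL}_n(\mathbb{Z})$ be hyperbolic and semisimple, with characteristic polynomial $\chi(A)=\mu_1^{n_1}\cdots\mu_m^{n_m}$, where $\mu_1,\ldots,\mu_m$ are the distinct irreducible factors over $\mathbb{Q}$ and $n_i\ge 1$. For each $i$ choose a root $\lambda_i$ of $\mu_i$. View $\lambda=(\lambda_1,\ldots,\lambda_m)$ as an element of $T(\mathbb{Z})$, where $T$ is the algebraic torus $\prod_{i=1}^m R_{\mathbb{Q}(\lambda_i)/\mathbb{Q}}(G_m)$. Let $S\subset T$ be the Zariski closure of the subgroup generated by $\lambda$. The following are equivalent. (i) The group $\mathbb{Z}^n\rtimes_A\mathbb{Z}$ is arithmetic. (ii) The rank of $S(\mathbb{Z})$ as an abelian group is $1$.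
   Context: A matrix $A\in\mathrm{GL}_n(\mathbb{Z})$ is hyperbolic if it has no (complex) eigenvalues on the unit circle, and semisimple if it is diagonalizable over $\mathbb{C}$. The group $\mathbb{Z}^n\rtimes_A\mathbb{Z}$ is the set $\mathbb{Z}^n\times\mathbb{Z}$ with multiplication $(x,i)(y,j)=(x+A^iy,\,i+j)$. A group $\Gamma$ is arithmetic if it embeds in a (linear) algebraic group $G$ defined over $\mathbb{Q}$ with image commensurable to $G(\mathbb{Z})$ (image in $G(\mathbb{Q})$ whose intersection with $G(\mathbb{Z})$ has finite index in both). $G_m$ denotes the multiplicative group and $R_{K/\mathbb{Q}}(\cdot)$ denotes restriction of scalars. For $T$ as in the claim, $T(\mathbb{Q})=\prod_i \mathbb{Q}(\lambda_i)^\times$ and $T(\mathbb{Z})=\prod_i\mathcal{O}_i^\times$, where $\mathcal{O}_i$ is the ring of integers of $\mathbb{Q}(\lambda_i)$; since $A\in\mathrm{GL}_n(\mathbb{Z})$, each $\lambda_i$ lies in $\mathcal{O}_i^\times$. $S(\mathbb{Z})=S(\mathbb{Q})\cap T(\mathbb{Z})$. *)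

(* Defs.v *)
From HB Require Import structures.
From mathcomp Require Import all_boot all_order all_fingroup all_algebra all_field.
From mathcomp Require Import mpoly.

Set Implicit Arguments.
Unset Strict Implicit.
Unset Printing Implicit Defensive.

Import Order.TTheory GRing.Theory Num.Theory.
Local Open Scope ring_scope.

Definition hyperbolic n (A : 'M[int]_n) : Prop :=
  forall z : algC, eigenvalue (map_mx intr A) z -> `|z| != 1.

Definition semisimple n (A : 'M[int]_n) : Prop :=
  diagonalizable (map_mx intr A : 'M[algC]_n).

Section SemidirectProduct.
Variables (n : nat) (A : 'M[int]_n.+1) (hA : A \in unitmx).

Definition sdprodZ of A \in unitmx : Type := ('cV[int]_n.+1 * int)%type.
Local Notation G := (sdprodZ hA).

HB.instance Definition _ := Choice.on G.

Definition sdprodZ_mul (u v : G) : G := (u.1 + A ^ u.2 *m v.1, u.2 + v.2).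
Definition sdprodZ_one : G := (0, 0).
Definition sdprodZ_inv (u : G) : G := (- (A ^ (- u.2) *m u.1), - u.2).

Fact sdprodZ_mulA : associative sdprodZ_mul.
Proof.
move=> [x i] [y j] [z k]; rewrite /sdprodZ_mul /= mulmxDr !addrA mulmxA.
by rewrite (exprzDr hA).
Qed.

Fact sdprodZ_mul1 : left_id sdprodZ_one sdprodZ_mul.
Proof. by move=> [x i]; rewrite /sdprodZ_mul /= expr0z mul1mx !add0r. Qed.

Fact sdprodZ_mulr1 : right_id sdprodZ_one sdprodZ_mul.
Proof. by move=> [x i]; rewrite /sdprodZ_mul /= mulmx0 !addr0. Qed.

Fact sdprodZ_mulV : left_inverse sdprodZ_one sdprodZ_inv sdprodZ_mul.
Proof. by move=> [x i]; rewrite /sdprodZ_mul /= !addNr. Qed.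

Fact sdprodZ_mulrV : right_inverse sdprodZ_one sdprodZ_inv sdprodZ_mul.
Proof.
move=> [x i]; rewrite /sdprodZ_mul /= mulmxN mulmxA.
by rewrite -[A ^ i *m _](exprzDr hA) !subrr expr0z mul1mx subrr.
Qed.

HB.instance Definition _ := isGroup.Build G sdprodZ_mulA sdprodZ_mul1
  sdprodZ_mulr1 sdprodZ_mulV sdprodZ_mulrV.

End SemidirectProduct.

Definition mpoly_eval_mx N (F : numFieldType) (q : {mpoly rat[N * N]})
    (g : 'M[F]_N) : F :=
  (map_mpoly ratr q).@[fun k => mxvec g 0 k].

(* The F-points of the Zariski closed subset of GL_N cut out by the equations
   q = 0, q \in I. *)
Definition zariski_closed_pts N (I : {mpoly rat[N * N]} -> Prop)
    (F : numFieldType) (g : 'M[F]_N) : Prop :=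
  g \in unitmx /\ forall q, I q -> mpoly_eval_mx q g = 0.

(* I defines a linear algebraic group over Q: in characteristic 0 this is a
   subgroup of GL_N over an algebraically closed field which is the zero locus
   of polynomials with rational coefficients. *)
Definition algebraic_group N (I : {mpoly rat[N * N]} -> Prop) : Prop :=
  let G := @zariski_closed_pts N I algC in
  [/\ G 1%:M, forall g h, G g -> G h -> G (g *m h)
    & forall g, G g -> G (invmx g)].

Definition integral_pts N (I : {mpoly rat[N * N]} -> Prop)
    (g : 'M[rat]_N) : Prop :=
  [/\ zariski_closed_pts I g, g \is a mxOver Num.int
    & invmx g \is a mxOver Num.int].

Definition finite_index N (K H : 'M[rat]_N -> Prop) : Prop :=
  (forall g, H g -> K g) /\
  exists s : seq 'M[rat]_N, (forall r, r \in s -> K r) /\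
    forall g, K g -> exists2 r, r \in s & H (invmx r *m g).

Definition commensurable N (H K : 'M[rat]_N -> Prop) : Prop :=
  let HK := fun g => H g /\ K g in finite_index H HK /\ finite_index K HK.

Definition arithmetic (gT : groupType) : Prop :=
  exists (N : nat) (I : {mpoly rat[N * N]} -> Prop) (phi : gT -> 'M[rat]_N),
    [/\ algebraic_group I,
        forall x, zariski_closed_pts I (phi x),
        {morph phi : x y / (x * y)%g >-> x *m y},
        injective phi
      & commensurable (fun g => exists x, phi x = g) (integral_pts I)].

(* The matrix, acting on row vectors, of multiplication by p on F[X]/(h) in the
   basis 1, X, ..., X^(d-1), where d is the degree of h. *)
Definition mulmodp_mx (F : fieldType) d (h p : {poly F}) : 'M[F]_d :=
  \matrix_(j < d) poly_rV ((p * 'X^j) %% h).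

Section Torus.
Variables (m : nat) (mu : 'I_m -> {poly rat}) (lambda : 'I_m -> algC).

Definition torus_dim : nat := \sum_(i < m) (size (mu i)).-1.

Definition torus_mx (F : numFieldType) (p : 'I_m -> {poly F}) :
    'M[F]_torus_dim :=
  \mxdiag_(i < m) mulmodp_mx (size (mu i)).-1 (map_poly ratr (mu i)) (p i).

(* The F-points of T = \prod_i R_{Q(lambda_i)/Q}(G_m), that is, the units of
   \prod_i F \otimes Q(lambda_i) = \prod_i F[X]/(mu_i), embedded in GL as block
   diagonal matrices by the regular representation. *)
Definition torus (F : numFieldType) (g : 'M[F]_torus_dim) : Prop :=
  g \in unitmx /\ exists p : 'I_m -> {poly F}, g = torus_mx p.

(* g is the rational point of T corresponding to x \in \prod_i Q(lambda_i). *)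
Definition torus_point (x : 'I_m -> algC) (g : 'M[rat]_torus_dim) : Prop :=
  exists p : 'I_m -> {poly rat},
    (forall i, x i = (map_poly ratr (p i)).[lambda i]) /\ g = torus_mx p.

Definition cyclic_lambda (g : 'M[rat]_torus_dim) : Prop :=
  exists k : int, torus_point (fun i => lambda i ^ k) g.

(* The F-points of S. As the subgroup generated by lambda consists of rational
   points, its Zariski closure is defined by equations over Q. *)
Definition zariski_closure_lambda (F : numFieldType)
    (g : 'M[F]_torus_dim) : Prop :=
  torus g /\
  zariski_closed_pts
    (fun q => forall h, cyclic_lambda h -> mpoly_eval_mx q h = 0) g.

(* T(Z) = \prod_i O_i^*, where O_i is the ring of algebraic integers in
   Q(lambda_i). *)
Definition torus_integral (x : 'I_m -> algC) : Prop :=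
  forall i, [/\ exists p : {poly rat}, x i = (map_poly ratr p).[lambda i],
                x i != 0, x i \in Aint & (x i)^-1 \in Aint].

Definition S_integral (x : 'I_m -> algC) : Prop :=
  torus_integral x /\
  exists2 g : 'M[rat]_torus_dim, torus_point x g & zariski_closure_lambda g.

End Torus.

Definition mult_independent m r (x : 'I_r -> 'I_m -> algC) : Prop :=
  forall e : 'I_r -> int,
    (forall i, \prod_(j < r) x j i ^ e j = 1) -> forall j, e j = 0.

(* The rank, i.e., the maximal number of Z-linearly independent elements, of a
   subgroup H of the multiplicative group (algC^* )^m is r. *)
Definition has_rank m (H : ('I_m -> algC) -> Prop) (r : nat) : Prop :=
  (exists x : 'I_r -> 'I_m -> algC,
      (forall j, H (x j)) /\ mult_independent x) /\
  forall s (x : 'I_s -> 'I_m -> algC),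
    (forall j, H (x j)) -> mult_independent x -> (s <= r)%N.

(* Main.v *)
Require Import Defs.
From HB Require Import structures.
From mathcomp Require Import all_boot all_order all_fingroup all_algebra all_field.
From mathcomp Require Import mpoly.
From mathcomp Require Import ring.
From Stdlib Require Import Classical.

Set Implicit Arguments.
Unset Strict Implicit.
Unset Printing Implicit Defensive.

Import Order.TTheory GRing.Theory Num.Theory.
Local Open Scope ring_scope.

(** Write [A = P^-1 diag(a) P] over the algebraic numbers.  The Zariski closure
    of the powers of [A] consists of the [P^-1 diag(w) P] for which [w] satisfies
    every multiplicative relation [prod a_i ^ c_i = 1] of [a]
    ([power_closure_eval], [power_closureP]).  A point of S is the same thing,
    written on the blocks F[X]/(mu_i): both are pictures of the characters of the
    group generated by the eigenvalues.

    (ii) implies (i).  The group embeds in the affine group with linear part in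
    the closure of the powers of [A], as the matrices with linear part [A ^ k]
    and integral translation part.  An integral point of that affine group has a
    linear part [B] which gives an element of S(Z) ([S_integral_power_closure]).
    If S(Z) has rank 1, then [B ^ u = A ^ v] for some [u > 0]
    ([rank1_power]), so a power of [A] can be divided out of [B] to make its
    eigenvalues, hence its entries, bounded.  Finitely many integral
    matrices remain ([finite_cosets]), and the image has finite index.

    (i) implies (ii).  Let phi embed the group in GL_N(Q) with arithmetic image,
    let [t = phi (0, 1)] and let [x] be in S(Z).  The aim is that a power of [x]
    is a power of [lambda] ([arithmetic_power]); two independent elements of S(Z)
    would then contradict each other, both being powers of [lambda] up to
    torsion.
    - Since [A] is hyperbolic, phi is unipotent on a multiple of Z^n
      ([unipotent_multiple]), so phi is a polynomial map there.
    - The relations of the eigenvalues of [A] hold for the conjugates of [x]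
      ([S_integral_relations]); so sending the former to the latter defines a
      homomorphism, with values in the units, on the multiplicative group
      generated by the eigenvalues of [A].  After replacing it by a power, it
      extends to the group that is also generated by the eigenvalues of [t]
      (one generator at a time), and averaging over the Galois group makes the
      extension equivariant ([equivariant_unit_extension]).
    - Applied to the eigenvalues of the semisimple part of [t], the extension
      produces a rational matrix [d0], and applied to those of [A] a rational
      matrix [B0] ([compatible_units]).  A polynomial identity between the
      entries of [t ^ k] and [A ^ k], valid for all [k], also holds for [d0] and
      [B0]: it is an identity between exponential polynomials, and distinct
      exponentials are linearly independent ([specializes_eq0]).  Therefore
      [d0] is in the algebraic group, and conjugation by [d0] acts on the
      unipotent part as [B0] acts on Z^n ([closure_normalizes]).
    - The eigenvalues of [d0] and [B0] are units, so these matrices have integral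
      powers ([integral_power]).  By arithmeticity a further power of [d0] is
      some [phi (y, i)], which acts as [A ^ i].  So a power of [B0] is [A ^ i],
      and on eigenvalues this says that a power of [x] is [lambda ^ i]. *)

(** * Exponential polynomials and specialization *)

(** The graph of a homomorphism from a subgroup of F^x to F^x. A relation is
    used instead of a function because the domain grows during the proof and
    membership in it is not decidable. *)
Record partial_hom (F : fieldType) (R : F -> F -> Prop) : Prop := PartialHom {
  ph1 : R 1 1;
  phM : forall x y x' y', R x y -> R x' y' -> R (x * x') (y * y');
  phV : forall x y, R x y -> R x^-1 y^-1;
  ph_neq0 : forall x y, R x y -> x != 0 /\ y != 0;
  ph_ker : forall y, R 1 y -> y = 1 }.

Lemma ph_fun (F : fieldType) (R : F -> F -> Prop) x y y' :
  partial_hom R -> R x y -> R x y' -> y = y'.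
Proof.
move=> hR Rxy Rxy'; have [x0 y0] := ph_neq0 hR Rxy.
have := phM hR Rxy' (phV hR Rxy); rewrite divff // => /(ph_ker hR).
by move=> /(canRL (divfK y0)); rewrite mul1r.
Qed.

Section ExpPoly.
Variable F : numFieldType.

Lemma poly_eq0_nat (p : {poly F}) : (forall k, p.[k%:R] = 0) -> p = 0.
Proof.
move=> p0; apply/eqP/negPn/negP => pn0.
have := max_poly_roots pn0 (rs := [seq k%:R | k <- iota 0 (size p)]).
rewrite size_map size_iota ltnn map_inj_uniq ?iota_uniq => [H|i j /eqP].
  suff: false by []; apply: H => //; apply/allP => _ /mapP[k _ ->]; exact/eqP/p0.
by rewrite eqr_nat => /eqP.
Qed.

(** The operator [f(k) |-> f(k+1) - b f(k)] acts on [c(k) a ^ k] through [a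
    c(X+1) - b c]; this and the next lemma compute the effect on the degree. *)
Lemma size_shift_sub (c : {poly F}) (a b : F) :
  (size (a *: (c \Po ('X + 1%:P)) - b *: c)%R <= size c)%N.
Proof.
apply: leq_trans (size_polyD _ _) _; rewrite size_polyN geq_max.
by rewrite !(leq_trans (size_scale_leq _ _)) // size_comp_poly2 // size_XaddC.
Qed.

Lemma coef_shift_sub (c : {poly F}) (a b : F) :
  (a *: (c \Po ('X + 1%:P)) - b *: c)`_(size c).-1 = (a - b) * lead_coef c.
Proof.
have ->: (a *: (c \Po ('X + 1%:P)) - b *: c)`_(size c).-1 =
  a * lead_coef (c \Po ('X + 1%:P)) - b * lead_coef c.
  by rewrite coefB !coefZ !lead_coefE size_comp_poly2 // size_XaddC.
by rewrite lead_coef_comp ?size_XaddC // lead_coefXaddC expr1n mulr1 mulrBl.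
Qed.

(** Induction on the total size of the coefficients: the operator [f(k) |->
    f(k+1) - g0 f(k)] lowers the degree of the coefficient of [g0 ^ k] and
    keeps the degree of every other one. *)
Lemma exp_poly_indep (s : seq F) (c : F -> {poly F}) :
  uniq s -> 0 \notin s ->
  (forall k, \sum_(g <- s) (c g).[k%:R] * g ^+ k = 0) ->
  forall g, g \in s -> c g = 0.
Proof.
have [n] := ubnP (\sum_(g <- s) size (c g)).
elim: n c => // n IHn c lt_n Us s0 c0.
case: (boolP (all (fun g => c g == 0) s)) => [/allP h g /h/eqP //|].
case/allPn => g0 g0s cg0; exfalso.
pose c' g := g *: (c g \Po ('X + 1%:P)) - g0 *: c g.
have c'0 g : g \in s -> c' g = 0.
  apply: IHn => // [|k]; last first.
    transitivity (\sum_(g <- s) (c g).[k.+1%:R] * g ^+ k.+1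
        - g0 * \sum_(g <- s) (c g).[k%:R] * g ^+ k); last first.
      by rewrite !c0 mulr0 subr0.
    rewrite mulr_sumr -sumrB.
    apply: eq_bigr => h _; rewrite /c' !hornerE horner_comp !hornerE.
    by rewrite -natr1 exprS mulrBl (mulrCA _ h) (mulrA h).
  move: lt_n; rewrite ltnS; apply: leq_trans;
    rewrite [X in (_ < X)%N](big_rem g0) //= (big_rem g0) //=.
  rewrite -addSn leq_add // ?leq_sum // => [|h _]; last exact: size_shift_sub.
  have [n1 sz]: exists n1, size (c g0) = n1.+1.
    by exists (size (c g0)).-1; rewrite prednK // lt0n size_poly_eq0.
  rewrite sz ltnS; apply/leq_sizeP => j; rewrite leq_eqVlt => /orP[/eqP <-|lt].
    by have := coef_shift_sub (c g0) g0 g0; rewrite sz /= subrr mul0r.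
  by apply: nth_default; rewrite (leq_trans (size_shift_sub _ _ _)) ?sz.
have cz g : g \in s -> g != g0 -> c g = 0.
  move=> gs ne; have := coef_shift_sub (c g) g g0.
  rewrite -/(c' g) c'0 // coef0 => /esym/eqP; rewrite mulf_eq0 subr_eq0 (negPf ne).
  by rewrite lead_coef_eq0 => /eqP.
case/negP: cg0; apply/eqP/poly_eq0_nat => k; have := c0 k.
rewrite (big_rem g0) //= big1_seq ?addr0 => [/eqP|h /andP[_]].
  rewrite mulf_eq0 => /orP[/eqP //|]; rewrite expf_eq0 => /andP[_ /eqP g00].
  by rewrite g00 (negPf s0) in g0s.
by rewrite mem_rem_uniq // inE => /andP[hg hs]; rewrite cz ?horner0 ?mul0r.
Qed.

Variable R : F -> F -> Prop.
Hypothesis hR : partial_hom R.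

(** [f] is an exponential polynomial [sum_j c_j(k) x_j ^ k] and [v] is
    obtained from it by replacing [k] by 0 in the coefficients and [x_j ^ k]
    by [y_j], where [R x_j y_j]. By the next lemma [v] depends on [f] only, so
    that this is a ring homomorphism defined on a ring of sequences. *)
Definition specializes (f : nat -> F) (v : F) : Prop :=
  exists s : seq ({poly F} * (F * F)),
    [/\ forall c, c \in s -> R c.2.1 c.2.2,
        forall k, f k = \sum_(c <- s) c.1.[k%:R] * c.2.1 ^+ k
      & v = \sum_(c <- s) c.1.[0] * c.2.2].

(** Terms with the same base have the same image under [R], so they may be
    collected; then each coefficient vanishes by independence. *)
Lemma specializes_eq0 f v : specializes f v -> (forall k, f k = 0) -> v = 0.
Proof.
case=> s [sR fE ->] f0.
pose gs := undup (map (fun c => c.2.1) s).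
have group (V : nmodType) (G : {poly F} * (F * F) -> V) : \sum_(c <- s) G c =
    \sum_(g <- gs) \sum_(c <- s | c.2.1 == g) G c.
  rewrite (exchange_big_dep xpredT) //= big_seq [RHS]big_seq.
  apply: eq_bigr => c cs; rewrite -big_filter.
  rewrite (_ : [seq i <- gs | _] = [:: c.2.1]) ?big_seq1 //.
  rewrite (eq_filter (a2 := pred1 c.2.1)) => [|g]; last by rewrite /= eq_sym.
  by rewrite filter_pred1_uniq ?undup_uniq // mem_undup; apply/mapP; exists c.
pose C g := \sum_(c <- s | c.2.1 == g) c.1.
have C0 g : g \in gs -> C g = 0.
  apply: exp_poly_indep; first exact: undup_uniq.
    apply/negP; rewrite mem_undup => /mapP[c cs c0].
    by have [] := ph_neq0 hR (sR _ cs); rewrite -c0 eqxx.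
  move=> k; rewrite -[RHS](f0 k) fE group; apply: eq_bigr => h _.
  by rewrite /C horner_sum mulr_suml; apply: eq_bigr => c /eqP ->.
rewrite group big1_seq // => g /andP[_ gg].
have: g \in map (fun c => c.2.1) s by rewrite -mem_undup.
case/mapP => c0 c0s gE.
rewrite big_seq_cond (eq_bigr (fun c => c.1.[0] * c0.2.2)) => [|c]; last first.
  case/andP => cs /eqP cg; congr (_ * _); apply: (ph_fun hR (sR _ cs)).
  by rewrite cg gE; apply: sR.
by rewrite -big_seq_cond -mulr_suml -horner_sum -/(C g) C0 // horner0 mul0r.
Qed.

Lemma eq_specializes f g v : f =1 g -> specializes f v -> specializes g v.
Proof. by move=> fg [s [h1 h2 h3]]; exists s; split=> // k; rewrite -fg. Qed.

Lemma specializes_exp p x y : R x y -> specializes (fun k => p.[k%:R] * x ^+ k) (p.[0] * y).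
Proof.
move=> Rxy; exists [:: (p, (x, y))]; split=> [c||]; last by rewrite big_seq1.
  by rewrite inE => /eqP ->.
by move=> k; rewrite big_seq1.
Qed.

Lemma specializes_const a : specializes (fun _ => a) a.
Proof.
have := specializes_exp a%:P (ph1 hR); rewrite hornerC mulr1; apply: eq_specializes => k.
by rewrite hornerC expr1n mulr1.
Qed.

Lemma specializesD f v g w : specializes f v -> specializes g w -> specializes (fun k =>
  f k + g k) (v + w).
Proof.
move=> [s [h1 h2 h3]] [s' [h1' h2' h3']]; exists (s ++ s'); split.
- by move=> c; rewrite mem_cat => /orP[/h1|/h1'].
- by move=> k; rewrite big_cat h2 h2'.
- by rewrite big_cat h3 h3'.
Qed.

Lemma specializesM f v g w : specializes f v -> specializes g w -> specializes (fun k =>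
  f k * g k) (v * w).
Proof.
move=> [s [h1 h2 h3]] [s' [h1' h2' h3']].
exists [seq (c.1 * d.1, (c.2.1 * d.2.1, c.2.2 * d.2.2)) | c <- s, d <- s']; split.
- by move=> _ /allpairsP[[c d] /= [cs ds ->]]; apply: (phM hR); [apply: h1|apply: h1'].
- move=> k; rewrite big_allpairs_dep h2 h2' big_distrlr /=; apply: eq_bigr => c _.
  by apply: eq_bigr => d _; rewrite hornerM exprMn mulrACA.
- rewrite big_allpairs_dep h3 h3' big_distrlr /=; apply: eq_bigr => c _.
  by apply: eq_bigr => d _; rewrite hornerM mulrACA.
Qed.

Lemma specializes_sum (I : Type) (r : seq I) (P : pred I) (f : I -> nat -> F) v :
  (forall i, P i -> specializes (f i) (v i)) ->
  specializes (fun k => \sum_(i <- r | P i) f i k) (\sum_(i <- r | P i) v i).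
Proof.
move=> h; elim: r => [|i r IH].
  by rewrite big_nil; apply: eq_specializes (specializes_const 0) => k; rewrite big_nil.
rewrite big_cons; case: ifP => Pi.
  by apply: eq_specializes (specializesD (h _ Pi) IH) => k; rewrite big_cons Pi.
by apply: eq_specializes IH => k; rewrite big_cons Pi.
Qed.

Lemma specializes_prod (I : Type) (r : seq I) (P : pred I) (f : I -> nat -> F) v :
  (forall i, P i -> specializes (f i) (v i)) ->
  specializes (fun k => \prod_(i <- r | P i) f i k) (\prod_(i <- r | P i) v i).
Proof.
move=> h; elim: r => [|i r IH].
  by rewrite big_nil; apply: eq_specializes (specializes_const 1) => k; rewrite big_nil.
rewrite big_cons; case: ifP => Pi.
  by apply: eq_specializes (specializesM (h _ Pi) IH) => k; rewrite big_cons Pi.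
by apply: eq_specializes IH => k; rewrite big_cons Pi.
Qed.

Lemma specializesX f v n : specializes f v -> specializes (fun k => f k ^+ n) (v ^+ n).
Proof.
move=> h; elim: n => [|n IH].
  by rewrite expr0; apply: eq_specializes (specializes_const 1) => k; rewrite expr0.
by rewrite exprS; apply: eq_specializes (specializesM h IH) => k; rewrite exprS.
Qed.

Definition specializes_mx a b (f : nat -> 'M[F]_(a, b)) (v : 'M[F]_(a, b)) : Prop :=
  forall i j, specializes (fun k => f k i j) (v i j).

Lemma specializes_mx_const a b (M : 'M[F]_(a, b)) : specializes_mx (fun _ => M) M.
Proof. by move=> i j; apply: specializes_const. Qed.

Lemma eq_specializes_mx a b (f g : nat -> 'M[F]_(a, b)) v :
  f =1 g -> specializes_mx f v -> specializes_mx g v.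
Proof. by move=> fg h i j; apply: eq_specializes (h i j) => k; rewrite fg. Qed.

Lemma specializes_mxD a b (f g : nat -> 'M[F]_(a, b)) v w :
  specializes_mx f v -> specializes_mx g w -> specializes_mx (fun k => f k + g k) (v + w).
Proof.
by move=> h h' i j; rewrite mxE; apply: eq_specializes (specializesD (h i j) (h' i j)) =>
  k; rewrite mxE.
Qed.

Lemma specializes_mxM a b c (f : nat -> 'M[F]_(a, b)) (g : nat -> 'M[F]_(b, c)) v w :
  specializes_mx f v -> specializes_mx g w -> specializes_mx (fun k => f k *m g k) (v *m w).
Proof.
move=> h h' i j; rewrite mxE.
apply: eq_specializes (specializes_sum (index_enum _) (P := xpredT)
  (fun l (_ : true) => specializesM (h i l) (h' l j))) => k; by rewrite mxE.
Qed.

Lemma specializes_mxZ a b (f : nat -> F) (g : nat -> 'M[F]_(a, b)) v w :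
  specializes f v -> specializes_mx g w -> specializes_mx (fun k => f k *: g k) (v *: w).
Proof.
by move=> h h' i j; rewrite mxE; apply: eq_specializes (specializesM h (h' i j)) => k;
  rewrite mxE.
Qed.

Lemma specializes_mx_sum a b (I : Type) (r : seq I) (f : I -> nat -> 'M[F]_(a, b)) v :
  (forall i, specializes_mx (f i) (v i)) ->
  specializes_mx (fun k => \sum_(i <- r) f i k) (\sum_(i <- r) v i).
Proof.
move=> h i j; rewrite summxE.
apply: eq_specializes (specializes_sum r (P := xpredT) (fun l (_ : true) => h l i j)) => k.
by rewrite summxE.
Qed.

Lemma specializes_mx_eq0 a b (f : nat -> 'M[F]_(a, b)) v :
  specializes_mx f v -> (forall k, f k = 0) -> v = 0.
Proof.
move=> h f0; apply/matrixP => i j; rewrite [RHS]mxE.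
by apply: specializes_eq0 (h i j) _ => k; rewrite f0 mxE.
Qed.

End ExpPoly.

(** * Powers of matrices as exponential polynomials *)

Section BinomialPolynomials.
Variable F : numFieldType.

(** The polynomial X (X-1) ... (X-i+1) / i!. *)
Fixpoint binom_poly i : {poly F} :=
  if i is j.+1 then j.+1%:R^-1 *: (binom_poly j * ('X - j%:R%:P)) else 1.

Arguments binom_poly : simpl never.

Lemma horner_binom_poly0 y : (binom_poly 0).[y] = 1.
Proof. by rewrite /binom_poly hornerC. Qed.

Lemma horner_binom_polyS i y : (binom_poly i.+1).[y] =
  i.+1%:R^-1 * ((binom_poly i).[y] * (y - i%:R)).
Proof. by rewrite /binom_poly -/binom_poly !hornerE. Qed.

Lemma binom_poly_pascal i y : (binom_poly i.+1).[y + 1] =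
  (binom_poly i.+1).[y] + (binom_poly i).[y].
Proof.
elim: i => [|i IH];
  first by rewrite !horner_binom_polyS !horner_binom_poly0 invr1 !mul1r !subr0.
have e : (binom_poly i).[y] =
  i.+1%:R * (binom_poly i.+1).[y] - (binom_poly i).[y] * (y - i%:R - 1).
  rewrite horner_binom_polyS mulrA divff ?pnatr_eq0 // mul1r; ring.
have i2 : i.+2%:R = i%:R + 2 :> F by rewrite -addn2 natrD.
have i20 : i%:R + 2 != 0 :> F by rewrite -i2 pnatr_eq0.
rewrite horner_binom_polyS IH (horner_binom_polyS i.+1) i2.
move: e; rewrite -[i.+1%:R]natr1.
move: (binom_poly i).[y] (binom_poly i.+1).[y] i%:R i20 => u v c c0 e.
apply: (mulfI c0); rewrite !mulrA divff // mul1r.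
rewrite [RHS]mulrDr !mulrA divff // mul1r.
have -> : (v + u) * (y + 1 - (c + 1)) = v * (y - c) + (u + u * (y - c - 1)) by ring.
by rewrite {1}e; ring.
Qed.

Lemma horner0_binom_poly i : (binom_poly i).[0] = (i == 0%N)%:R.
Proof.
elim: i => [|i IH]; first by rewrite horner_binom_poly0.
by rewrite horner_binom_polyS IH; case: i {IH} => [|i]; rewrite /= ?subrr ?mul0r !mulr0.
Qed.

(** The power [(1 + nu) ^ y] for an arbitrary scalar [y], when [nu ^ r = 0]. *)
Definition unip_exp N r (nu : 'M[F]_N) (y : F) : 'M[F]_N :=
  \sum_(i < r) (binom_poly i).[y] *: nu ^+ i.

Lemma unip_exp0 N r (nu : 'M[F]_N) : unip_exp r.+1 nu 0 = 1.
Proof.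
rewrite /unip_exp big_ord_recl /= horner_binom_poly0 scale1r expr0 big1 ?addr0 // => i _.
by rewrite horner0_binom_poly scale0r.
Qed.

Lemma unip_expS N r (nu : 'M[F]_N) y :
  nu ^+ r.+1 = 0 -> unip_exp r.+1 nu (y + 1) = (1 + nu) * unip_exp r.+1 nu y.
Proof.
have sA c (M : 'M_N) : nu * (c *: M) = c *: (nu * M) by rewrite -!mulmxE -scalemxAr.
move=> nu0; rewrite /unip_exp mulrDl mul1r mulr_sumr.
rewrite big_ord_recl [X in _ = X + _]big_ord_recl [X in _ = _ + X]big_ord_recr /=.
rewrite sA -exprS nu0 scaler0 addr0 !horner_binom_poly0 -addrA; congr (_ + _).
rewrite -big_split /=; apply: eq_bigr => i _.
by rewrite binom_poly_pascal scalerDl /bump /= add1n sA -exprS.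
Qed.

Lemma unip_exp_nat N r (nu : 'M[F]_N) k :
  nu ^+ r.+1 = 0 -> unip_exp r.+1 nu k%:R = (1 + nu) ^+ k.
Proof.
move=> nu0; elim: k => [|k IH]; first by rewrite unip_exp0.
by rewrite -natr1 unip_expS // IH exprS.
Qed.

Variables (R : F -> F -> Prop) (hR : partial_hom R).

Lemma specializes_horner (p : {poly F}) f v :
  specializes R f v -> specializes R (fun k => p.[f k]) p.[v].
Proof.
move=> h; rewrite horner_coef.
apply: (@eq_specializes _ _ (fun k => \sum_(i < size p) p`_i * f k ^+ i)) => [k|].
  by rewrite horner_coef.
by apply: specializes_sum => // i _; apply: specializesM => //; [apply:
  specializes_const|apply: specializesX].
Qed.

Lemma specializes_unip_exp N r (nu : 'M[F]_N) f v :
  specializes R f v -> specializes_mx R (fun k => unip_exp r nu (f k)) (unip_exp r nu v).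
Proof.
move=> h; apply: specializes_mx_sum => // i; apply: specializes_mxZ => //; last exact:
  specializes_mx_const.
exact: specializes_horner.
Qed.

Lemma specializes_nat : specializes R (fun k => k%:R) 0.
Proof.
have := specializes_exp 'X (ph1 hR); rewrite hornerX mul0r; apply: eq_specializes => k.
by rewrite hornerX expr1n mulr1.
Qed.

Lemma diag_mxX N (a : 'rV[F]_N) k : diag_mx a ^+ k = diag_mx (\row_i a 0 i ^+ k).
Proof.
elim: k => [|k IH].
  by apply/matrixP => i j; rewrite !mxE.
rewrite exprS IH -mulmxE mulmx_diag; congr diag_mx; apply/rowP => i.
by rewrite !mxE exprS.
Qed.

Lemma conj_diagX N (P : 'M[F]_N) a k : P \in unitmx ->
  (invmx P *m diag_mx a *m P) ^+ k = invmx P *m diag_mx (\row_i a 0 i ^+ k) *m P.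
Proof.
move=> uP; rewrite -diag_mxX; elim: k => [|k IH].
  by rewrite !expr0 mulmx1 mulVmx.
by rewrite exprS IH -mulmxE [in RHS]exprS -mulmxE !mulmxA mulmxK.
Qed.

Lemma specializes_powers_diag N (P : 'M[F]_N) (a z : 'rV[F]_N) :
  P \in unitmx -> (forall i, R (a 0 i) (z 0 i)) ->
  specializes_mx R (fun k => (invmx P *m diag_mx a *m P) ^+ k)
    (invmx P *m diag_mx z *m P).
Proof.
move=> uP az.
apply: (@eq_specializes_mx _ _ _ _ (fun k => invmx P *m diag_mx (\row_i a 0 i ^+ k) *m P)).
  by move=> k; rewrite conj_diagX.
apply: specializes_mxM (specializes_mx_const hR _) => //; apply:
  specializes_mxM (specializes_mx_const hR _) _ => //.
move=> i j; rewrite mxE; case: eqP => [<-|ne].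
  rewrite mulr1n; have := specializes_exp 1 (az i); rewrite hornerC mul1r.
  by apply: eq_specializes => k; rewrite !mxE eqxx mulr1n hornerC mul1r.
rewrite mulr0n; apply: eq_specializes (specializes_const hR 0) => k.
by rewrite !mxE; case: eqP ne => // _ _; rewrite mulr0n.
Qed.

(** With [t = ts + nu] the Jordan decomposition, [t ^ k] is [ts ^ k] times a
    polynomial in [k] whose value at [k = 0] is 1: only the semisimple part
    survives. *)
Lemma specializes_powers N r (ts nu P : 'M[F]_N.+1) (a z : 'rV[F]_N.+1) :
  P \in unitmx -> ts = invmx P *m diag_mx a *m P ->
  (forall i, R (a 0 i) (z 0 i)) ->
  GRing.comm ts nu -> nu ^+ r.+1 = 0 ->
  specializes_mx R (fun k => (ts + nu) ^+ k) (invmx P *m diag_mx z *m P).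
Proof.
move=> uP tsE az cnu nu0.
have uts : ts \is a GRing.unit.
  rewrite -[_ \is a _]/(_ \in unitmx) tsE !unitmx_mul unitmx_inv uP /= andbT unitmxE.
  rewrite det_diag unitfE prodf_seq_neq0; apply/allP => i _ /=.
  by have [] := ph_neq0 hR (az i).
have cnu' : GRing.comm nu ts^-1 by apply: commrV; apply: commr_sym.
pose mu := ts^-1 * nu.
have mu0 : mu ^+ r.+1 = 0 by rewrite exprMn_comm ?nu0 ?mulr0 //; apply: commr_sym.
have cmu : GRing.comm ts (1 + mu).
  apply: commrD; first exact: commr1.
  by apply: commrM => //; apply: commrV.
apply: (@eq_specializes_mx _ _ _ _ (fun k => ts ^+ k *m unip_exp r.+1 mu k%:R)) => [k|].
  rewrite unip_exp_nat // mulmxE -exprMn_comm //; congr (_ ^+ k).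
  by rewrite mulrDr mulr1 /mu mulrA mulrV // mul1r.
have -> : invmx P *m diag_mx z *m P = (invmx P *m diag_mx z *m P) *m unip_exp r.+1 mu 0.
  by rewrite unip_exp0 mulmx1.
rewrite tsE.
apply: specializes_mxM => //; first exact: specializes_powers_diag.
exact/specializes_unip_exp/specializes_nat.
Qed.

End BinomialPolynomials.

(** * Extending and averaging partial homomorphisms *)

Lemma prod_exprz (F : fieldType) (I : finType) (x : I -> F) (c : I -> int) z :
  \prod_k (x k ^ z) ^ c k = (\prod_k x k ^ c k) ^ z.
Proof.
under eq_bigr do rewrite exprzAC.
by rewrite -(big_morph (fun u : F => u ^ z) (fun u v => expfzMl u v z) (exp1rz _ z)).
Qed.

Section Extension.
Variable L : fieldType.

Record mul_closed (U : L -> Prop) : Prop := MulClosed {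
  mcM : forall x y, U x -> U y -> U (x * y);
  mcV : forall x, U x -> U x^-1;
  mc1 : U 1 }.

Lemma mcX (U : L -> Prop) x (j : int) : mul_closed U -> U x -> U (x ^ j).
Proof.
move=> hU Ux; have hn n : U (x ^+ n).
  by elim: n => [|n IH]; [apply: mc1|rewrite exprS; apply: mcM].
case: j => n; first exact: hn.
by rewrite NegzE -exprnN; apply: mcV.
Qed.

Lemma phX (R : L -> L -> Prop) x y (j : int) : partial_hom R -> R x y -> R (x ^ j) (y ^ j).
Proof.
move=> hR Rxy; have hn n : R (x ^+ n) (y ^+ n).
  by elim: n => [|n IH]; [apply: ph1|rewrite !exprS; apply: phM].
case: j => n; first exact: hn.
by rewrite NegzE -!exprnN; apply: phV.
Qed.

Definition ph_pow (R : L -> L -> Prop) k x y := exists2 z, R x z & y = z ^+ k.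

Lemma ph_powP (R : L -> L -> Prop) k : partial_hom R -> partial_hom (ph_pow R k).
Proof.
move=> hR; split.
- by exists 1; [apply: ph1|rewrite expr1n].
- move=> x _ x' _ [y Rxy ->] [y' Rxy' ->]; exists (y * y'); last by rewrite exprMn.
  exact: phM.
- by move=> x _ [y Rxy ->]; exists y^-1; [apply: phV|rewrite exprVn].
- by move=> x _ [y /(ph_neq0 hR)[x0 y0] ->]; rewrite expf_neq0.
- by move=> _ [y /(ph_ker hR) -> ->]; rewrite expr1n.
Qed.

Variable U : L -> Prop.
Hypothesis hU : mul_closed U.

(** If a power [a ^ n] is in the domain, with image [w], then after raising
    all values to the power [n] the element [w] may be chosen as the image of
    [a]; otherwise [a] is independent of the domain, and 1 may be chosen. *)
Lemma ph_extend1 (R : L -> L -> Prop) a : partial_hom R ->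
  (forall x y, R x y -> U y) -> a != 0 ->
  exists k R', [/\ (0 < k)%N, partial_hom R', forall x y, R' x y -> U y,
    forall x y, R x y -> R' x (y ^+ k) & exists b, R' a b].
Proof.
move=> hR RU a0.
(* [key] is what makes the extended relation single-valued. *)
suff [n [w [n0 Uw w0 key]]] : exists n w, [/\ (0 < n)%N, U w, w != 0 &
    forall (j : int) x y, R x y -> x * a ^ j = 1 -> y ^+ n * w ^ j = 1].
  exists n, (fun x y => exists x0 y0 (j : int),
    [/\ R x0 y0, x = x0 * a ^ j & y = y0 ^+ n * w ^ j]); split=> //.
  - split.
    + by exists 1, 1, 0; split; rewrite ?expr1n ?mul1r //; apply: ph1.
    + move=> _ _ _ _ [x [y [j [Rxy -> ->]]]] [x' [y' [j' [Rxy' -> ->]]]].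
      exists (x * x'), (y * y'), (j + j'); split; first exact: phM.
        by rewrite expfzDr // mulrACA.
      by rewrite expfzDr // exprMn mulrACA.
    + move=> _ _ [x [y [j [Rxy -> ->]]]]; exists x^-1, y^-1, (- j).
      by split; [apply: phV|rewrite invfM invr_expz|rewrite invfM invr_expz exprVn].
    + move=> _ _ [x [y [j [/(ph_neq0 hR)[x0 y0] -> ->]]]].
      by rewrite !mulf_neq0 ?expf_neq0 ?expfz_neq0.
    + by move=> _ [x [y [j [Rxy /esym/(key _ _ _ Rxy) <- ->]]]].
  - move=> _ _ [x [y [j [/RU Uy _ ->]]]]; apply: mcM => //; last exact: mcX.
    exact: (mcX n).
  - by move=> x y Rxy; exists x, y, 0; rewrite !mulr1.
  - exists w, 1, 1, 1; split; first exact: ph1.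
      by rewrite mul1r.
    by rewrite expr1n mul1r.
case: (classic (exists n w, (0 < n)%N /\ R (a ^+ n) w)) => [[n [w [n0 Rw]]]|no].
  exists n, w; split=> //; [exact: RU Rw|by have [] := ph_neq0 hR Rw|].
  move=> j x y Rxy e; apply: (ph_ker hR).
  have := phM hR (phX n hR Rxy) (phX j hR Rw).
  rewrite [X in R X _](_ : _ = 1) // -[X in _ * X](exprzAC a j n).
  by rewrite -[X in X * _]/(x ^+ n) -[X in _ * X]/((a ^ j) ^+ n) -exprMn e expr1n.
exists 1%N, 1; split=> //; [exact: mc1|exact: oner_neq0|].
move=> j x y Rxy e; rewrite exp1rz mulr1 expr1.
have xE : x = a ^ (- j).
  by apply: (mulIf (expfz_neq0 j a0)); rewrite e -expfzDr // addNr.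
case: j e xE => [[|n]|n] e xE.
- by move: e Rxy; rewrite mulr1 => -> /(ph_ker hR).
- case: no; exists n.+1, y^-1; split=> //.
  by have := phV hR Rxy; rewrite xE -exprnN invrK.
- by case: no; exists n.+1, y; split=> //; rewrite xE NegzE opprK in Rxy *.
Qed.

Lemma ph_extend (s : seq L) (R : L -> L -> Prop) : partial_hom R ->
  (forall x y, R x y -> U y) -> 0 \notin s ->
  exists k R', [/\ (0 < k)%N, partial_hom R', forall x y, R' x y -> U y,
    forall x y, R x y -> R' x (y ^+ k) & forall a, a \in s -> exists b, R' a b].
Proof.
move=> hR RU; elim: s => [|a s IH]; first by exists 1%N, R.
rewrite inE negb_or eq_sym => /andP[a0 /IH[k [R1 [k0 hR1 RU1 RR1 R1s]]]].
have [k' [R2 [k'0 hR2 RU2 RR2 R2a]]] := ph_extend1 hR1 RU1 a0.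
exists (k * k')%N, R2; split=> //; first by rewrite muln_gt0 k0.
  by move=> x y /RR1/RR2; rewrite exprM.
move=> b; rewrite inE => /orP[/eqP -> //|/R1s[c /RR2 h]]; by exists (c ^+ k').
Qed.

Lemma interpolation (s : seq L) (Q : L -> L -> Prop) : uniq s ->
  (forall a, a \in s -> exists b, Q a b) ->
  exists p : {poly L}, forall a, a \in s -> Q a p.[a].
Proof.
elim: s => [|a s IH] /=; first by exists 0.
case/andP=> as_ us Qs; have [|p hp] := IH us.
  by move=> b bs; apply: Qs; rewrite inE bs orbT.
have [b Qb] := Qs _ (mem_head _ _).
pose q := \prod_(x <- s) ('X - x%:P); have qa : q.[a] != 0.
  by rewrite -[_ == 0]/(root q a) root_prod_XsubC.
exists (p + ((b - p.[a]) / q.[a]) *: q) => c; rewrite inE => /orP[/eqP -> |cs].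
  by rewrite !hornerE divfK // subrKC.
have /rootP q0 : root q c by rewrite root_prod_XsubC.
by rewrite !hornerE q0 mulr0 addr0; apply: hp.
Qed.

End Extension.

Section Average.
Variable L : splittingFieldType rat.
Hypothesis galL : galois 1 {:L}.
Let G := ('Gal({:L} / 1))%g.

Lemma galVK (t : gal_of {:L}) x : (t^-1)%g (t x) = x.
Proof. by rewrite -galM ?memvf // mulgV gal_id. Qed.

Lemma galKV (t : gal_of {:L}) x : t ((t^-1)%g x) = x.
Proof. by rewrite -galM ?memvf // mulVg gal_id. Qed.

(** The pointwise product, over the Galois group, of the conjugates of [R]. *)
Definition gal_avg (R : L -> L -> Prop) x y := exists W : gal_of {:L} -> L,
  (forall t, t \in G -> R (t x) (W t)) /\ y = \prod_(t in G) (t^-1)%g (W t).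

Lemma gal_avgP (R : L -> L -> Prop) : partial_hom R -> partial_hom (gal_avg R).
Proof.
move=> hR; split.
- exists (fun _ => 1); split=> [t _|]; first by rewrite rmorph1; apply: ph1.
  by rewrite big1 // => t _; rewrite rmorph1.
- move=> x _ x' _ [W [RW ->]] [W' [RW' ->]]; exists (fun t => W t * W' t).
  split=> [t Gt|]; first by rewrite rmorphM; exact: (phM hR (RW _ Gt) (RW' _ Gt)).
  by rewrite -big_split; apply: eq_bigr => t _; rewrite rmorphM.
- move=> x _ [W [RW ->]]; exists (fun t => (W t)^-1).
  split=> [t Gt|]; first by rewrite fmorphV; exact: (phV hR (RW _ Gt)).
  by rewrite -prodfV; apply: eq_bigr => t _; rewrite fmorphV.
- move=> x _ [W [RW ->]]; split.
    by have [] := ph_neq0 hR (RW _ (group1 _)); rewrite gal_id.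
  apply/prodf_neq0 => t Gt; have [_] := ph_neq0 hR (RW _ Gt).
  by rewrite fmorph_eq0.
- move=> _ [W [RW ->]]; rewrite big1 // => t Gt.
  by have := RW _ Gt; rewrite rmorph1 => /(ph_ker hR) ->; rewrite rmorph1.
Qed.

(** The product of the conjugates of an interpolation polynomial of [R]
    interpolates the average, and it is rational because it is invariant. *)
Lemma gal_avg_poly (R : L -> L -> Prop) (p : {poly L}) (s : seq L) :
  (forall a t, a \in s -> t \in G -> t a \in s) ->
  (forall a, a \in s -> R a p.[a]) ->
  exists q : {poly rat}, forall a, a \in s ->
    gal_avg R a (map_poly (in_alg L) q).[a].
Proof.
move=> sG Rp.
pose P := \prod_(t in G) map_poly (t^-1)%g p.
have PG u : u \in G -> map_poly u P = P.
  move=> Gu; rewrite rmorph_prod (reindex_inj (mulgI u)) /=.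
  apply: eq_big => t; first by rewrite groupMl.
  rewrite -map_poly_comp => _; apply: eq_map_poly => x /=.
  by rewrite invMg galM ?memvf // galKV.
have : P \is a polyOver 1%VS.
  apply/polyOverP => i; rewrite -(galois_fixedField galL).
  apply/fixedFieldP => [|u Gu]; first exact: memvf.
  by rewrite -[in RHS](PG u Gu) coef_map.
case/polyOver1P => q Pq; exists q => a as_; rewrite -Pq.
exists (fun t => p.[t a]); split=> [t Gt|]; first by apply/Rp/sG.
rewrite horner_prod; apply: eq_bigr => t _.
by rewrite -horner_map /= galVK.
Qed.

(** Where [R] is already equivariant, averaging raises to the power #|G|. *)
Lemma gal_avg_equivariant (R : L -> L -> Prop) x y :
  (forall t, t \in G -> R (t x) (t y)) -> gal_avg R x (y ^+ #|G|).
Proof.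
move=> Rxy; exists (fun t => t y); split=> //.
by rewrite -prodr_const; apply: eq_bigr => t _; rewrite galVK.
Qed.

End Average.

(** * Galois-equivariant extension with unit values *)

Notation ratpC p := (map_poly (ratr : rat -> algC) p).

Definition alg_unit (x : algC) : Prop := x \in Aint /\ x^-1 \in Aint.

Lemma alg_unit_closed : mul_closed alg_unit.
Proof.
split.
- by move=> x y [? ?] [? ?]; split; rewrite ?invfM rpredM.
- by move=> x [? ?]; split; rewrite ?invrK.
- by split; rewrite ?invr1.
Qed.

(** [D p a] says that [p.[a]] is the prescribed value at [a]. The homomorphism
    [R0] takes these values; its extension, up to a power, is defined at all
    roots of [f] and, being equivariant, is given there by a rational
    polynomial [g]. *)
Theorem equivariant_unit_extension (f : {poly rat}) (rs : seq algC) :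
  separable_poly f -> ratpC f %= \prod_(r <- rs) ('X - r%:P) -> 0 \notin rs ->
  forall R0 : algC -> algC -> Prop, partial_hom R0 ->
  (forall x y, R0 x y -> alg_unit y) ->
  forall D : {poly rat} -> algC -> Prop,
  (forall p a, D p a -> a \in rs) ->
  (forall p a, D p a -> forall nu : {rmorphism algC -> algC}, D p (nu a)) ->
  (forall p a, D p a -> R0 a (ratpC p).[a]) ->
  exists K (g : {poly rat}) R, [/\ (0 < K)%N, partial_hom R,
    forall a, a \in rs -> R a (ratpC g).[a],
    forall a, a \in rs -> alg_unit (ratpC g).[a]
    & forall p a, D p a -> (ratpC g).[a] = (ratpC p).[a] ^+ K].
Proof.
move=> sepf frs rs0 R0 hR0 R0U D Drs Dnu DR0.
have [L0 [iota0 [s0 Ds gen]]] := num_field_exists rs.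
have iota_alg (F : fieldExtType rat) (i : {rmorphism F -> algC}) x : i (in_alg F x) = ratr x.
  exact: (fmorph_eq_rat (i \o in_alg F)).
have map_alg (F : fieldExtType rat) (i : {rmorphism F -> algC}) p :
    map_poly i (map_poly (in_alg F) p) = ratpC p.
  by rewrite -map_poly_comp; apply: eq_map_poly => x; rewrite /= iota_alg.
have fs0 : map_poly (in_alg L0) f %= \prod_(z <- s0) ('X - z%:P).
  rewrite -(eqp_map iota0) map_alg rmorph_prod /=.
  rewrite (eq_bigr (fun z => 'X - (iota0 z)%:P)) => [|z _]; last by rewrite map_polyXsubC.
  by rewrite -(big_map iota0 xpredT (fun z => 'X - z%:P)) Ds.
have spl : splitting_field_axiom L0.
  exists (map_poly (in_alg L0) f); first by apply/polyOver1P; exists f.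
  by exists s0.
pose L : splittingFieldType rat := HB.pack L0 (FieldExt_isSplittingField.Build rat L0 spl).
have galL : galois 1 {:L}.
  apply/splitting_galoisField; exists (map_poly (in_alg L) f); split.
  - by apply/polyOver1P; exists f.
  - by rewrite separable_map.
  - by exists s0.
pose iota : {rmorphism L -> algC} := iota0.
pose s : seq L := s0.
have Dss : map iota s = rs by [].
have root_s (a : L) : (a \in s) = root (map_poly (in_alg L) f) a.
  by rewrite (eqp_root fs0) root_prod_XsubC.
have us : uniq s.
  rewrite -separable_prod_XsubC.
  by rewrite -(eqp_separable fs0) separable_map.
have s0n : 0 \notin s.
  by apply: contra rs0 => h; rewrite -Dss; apply/mapP; exists 0 => //; rewrite rmorph0.
pose R1 x y := R0 (iota x) (iota y).
have hR1 : partial_hom R1.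
  split; rewrite /R1.
  - by rewrite rmorph1; apply: (ph1 hR0).
  - by move=> x y x' y' h h'; rewrite !rmorphM; apply: (phM hR0).
  - by move=> x y h; rewrite !fmorphV; apply: (phV hR0).
  - by move=> x y /(ph_neq0 hR0); rewrite !fmorph_eq0.
  - by move=> y; rewrite rmorph1 => /(ph_ker hR0)/eqP; rewrite fmorph_eq1 => /eqP.
pose U (x : L) := alg_unit (iota x).
have hU : mul_closed U.
  split; rewrite /U.
  - by move=> x y h h'; rewrite rmorphM; apply: (mcM alg_unit_closed).
  - by move=> x h; rewrite fmorphV; apply: (mcV alg_unit_closed).
  - by rewrite rmorph1; apply: (mc1 alg_unit_closed).
have [k [R2 [k0 hR2 R2U R12 R2s]]] := ph_extend hU hR1 (fun x y h => R0U _ _ h) s0n.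
have [p Rp] := interpolation us R2s.
have [|q Rq] := gal_avg_poly galL _ Rp.
  move=> a t; rewrite !root_s => ra _.
  by rewrite -(fmorph_root t) -map_poly_comp (eq_map_poly (fun x => rmorph_alg t x)) in ra.
have Ut (t : gal_of {:L}) x : U x -> U (t x).
  have [nu Dnu'] := extend_algC_subfield_aut iota t.
  rewrite /U (_ : iota (t x) = nu (iota x)); last exact: Dnu'.
  by case=> h h'; rewrite /alg_unit -fmorphV !Aint_aut.
exists (k * #|('Gal({:L} / 1))%g|)%N, q.
exists (fun x y => exists x' y', [/\ x = iota x', y = iota y' & gal_avg R2 x' y']).
have hR3 := gal_avgP hR2.
have Rqs a : a \in s -> (ratpC q).[iota a] = iota (map_poly (in_alg L) q).[a].
  by rewrite -horner_map map_alg.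
split.
- by rewrite muln_gt0 k0 cardG_gt0.
- split.
  + by exists 1, 1; rewrite rmorph1; split=> //; apply: (ph1 hR3).
  + move=> _ _ _ _ [x [y [-> -> h]]] [x' [y' [-> -> h']]].
    by exists (x * x'), (y * y'); rewrite !rmorphM; split=> //; apply: (phM hR3).
  + move=> _ _ [x [y [-> -> h]]]; exists x^-1, y^-1.
    by rewrite !fmorphV; split=> //; apply: (phV hR3).
  + by move=> _ _ [x [y [-> -> /(ph_neq0 hR3)]]]; rewrite !fmorph_eq0.
  + move=> _ [x [y [/esym/eqP + -> h]]]; rewrite fmorph_eq1 => /eqP x1.
    by rewrite x1 in h; rewrite (ph_ker hR3 h) rmorph1.
- rewrite -Dss => _ /mapP[a as_ ->]; exists a, (map_poly (in_alg L) q).[a].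
  by split=> //; [apply: Rqs|apply: Rq].
- rewrite -Dss => _ /mapP[a as_ ->]; rewrite Rqs //.
  have [W [RW ->]] := Rq _ as_.
  elim/big_ind: _ => [||t Gt]; [exact: mc1 hU|exact: mcM hU|].
  exact/Ut/(R2U _ _ (RW _ Gt)).
move=> g a Dga; have := Drs _ _ Dga; rewrite -Dss => /mapP[a' a's aE].
rewrite aE Rqs // -(map_alg _ iota) horner_map -rmorphXn exprM; congr (iota _).
apply: (ph_fun hR3); first exact: Rq.
apply: gal_avg_equivariant => t Gt; rewrite rmorphXn; apply: R12.
have [nu Dnu'] := extend_algC_subfield_aut iota t.
rewrite /R1 /= !Dnu' -horner_map map_alg -aE -horner_map -map_poly_comp.
rewrite (eq_map_poly (fmorph_eq_rat (nu \o ratr))).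
exact/DR0/Dnu.
Qed.

(** * Rational Jordan-Chevalley decomposition *)

Lemma comp_poly_taylor (F : fieldType) (p s h : {poly F}) :
  exists r, p \Po (s + h) = p \Po s + h * (p^`() \Po s) + h ^+ 2 * r.
Proof.
elim/poly_ind: p => [|p c [r e]].
  by exists 0; rewrite deriv0 !comp_poly0 !mulr0 !addr0.
exists (r * (s + h) + (p^`() \Po s)).
rewrite !comp_poly_MXaddC e derivMXaddC comp_polyD comp_polyM comp_polyX; ring.
Qed.

(** Newton iteration for the equation f(s) = 0, starting from s = X: since f
    and f' are coprime, each step raises the power of f that divides f(s). *)
Lemma newton_lift (F : fieldType) (f : {poly F}) n : coprimep f f^`() ->
  exists s, f %| s - 'X /\ f ^+ n.+1 %| f \Po s.
Proof.
move=> cop; have /Bezout_eq1_coprimepP[[u v] /= uv] := cop.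
elim: n => [|n [s [dvdX dvdn]]].
  by exists 'X; rewrite subrr dvdp0 comp_polyXr expr1 dvdpp.
(* [v] inverts [f'] modulo [f], so this is the Newton correction. *)
pose h := - ((f \Po s) * (v \Po s)).
have dvd1 : f %| f \Po s.
  by apply: dvdp_trans dvdn; rewrite exprS dvdp_mulr.
exists (s + h); split.
  by rewrite addrAC dvdp_addl // /h dvdpNr dvdp_mulr.
have [r ->] := comp_poly_taylor f s h.
have -> : f \Po s + h * (f^`() \Po s) + h ^+ 2 * r =
   (f \Po s) ^+ 2 * (u \Po s + (v \Po s) ^+ 2 * r).
  have := congr1 (fun p => p \Po s) uv.
  rewrite comp_polyD !comp_polyM -[1]/(1%:P) comp_polyC => e.
  have -> : f \Po s + h * (f^`() \Po s) = (f \Po s) * (1 - (v \Po s) * (f^`() \Po s)).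
    by rewrite /h; ring.
  by rewrite -[1]/(1%:P) -{1}e /h; ring.
apply: dvdp_mulr; rewrite exprS expr2; exact: dvdp_mul.
Qed.

(** Passing from [p] to [p^`()] lowers the multiplicity of a root by exactly
    one, so [g] cannot absorb it completely. *)
Lemma root_radical (p g f : {poly algC}) a : p != 0 -> p = f * g -> g %| p^`() ->
  root p a -> root f a.
Proof.
move=> p0 pE gp' pa; apply: contraT => fa.
have g0 : g != 0 by apply: contraNneq p0; rewrite pE => ->; rewrite mulr0.
have [[|k] [g1]] := multiplicity_XsubC g a; rewrite g0 /= => g1a gE.
  by move: pa; rewrite pE rootM (negPf fa) gE expr0 mulr1 (negPf g1a).
have : g %| f * g^`().
  by move: gp'; rewrite pE derivM dvdp_addr // dvdp_mull.
rewrite gE derivM deriv_exp derivXsubC mul1r /= -mulr_natl.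
have -> : g1^`() * ('X - a%:P) ^+ k.+1 + g1 * ((k.+1)%:R * ('X - a%:P) ^+ k) =
  (g1^`() * ('X - a%:P) + g1 * k.+1%:R) * ('X - a%:P) ^+ k by rewrite exprS; ring.
rewrite exprS !mulrA dvdp_mul2r ?expf_neq0 ?polyXsubC_eq0 //.
move/(dvdp_trans (dvdp_mull _ (dvdpp _))); rewrite dvdp_XsubCl rootM (negPf fa) /=.
rewrite /root !hornerE subrr mulr0 add0r -polyC_natr hornerC mulf_eq0.
by rewrite -[_ == 0]/(root g1 a) (negPf g1a) pnatr_eq0.
Qed.

Lemma radical_poly (p : {poly rat}) : p != 0 ->
  exists f, [/\ separable_poly f, f %| p & exists k, p %| f ^+ k].
Proof.
move=> p0; exists (p %/ gcdp p p^`()); set g := gcdp _ _; set f := p %/ g.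
have pE : p = f * g by rewrite divpK // dvdp_gcdl.
split; [exact: make_separable|by rewrite pE dvdp_mulr|].
have pC0 : ratpC p != 0 by rewrite map_poly_eq0.
have [rs rsE] := closed_field_poly_normal (ratpC p).
exists (size rs); rewrite -(dvdp_map (ratr : {rmorphism rat -> algC})) rmorphXn /=.
rewrite rsE dvdpZl ?lead_coef_eq0 //.
have : forall r, r \in rs -> root (ratpC f) r.
  move=> r rrs; apply: (@root_radical (ratpC p) (ratpC g)) => //.
  - by rewrite [in LHS]pE rmorphM.
  - by rewrite deriv_map dvdp_map dvdp_gcdr.
  - by rewrite rsE rootZ ?lead_coef_eq0 // root_prod_XsubC.
elim: rs {rsE} => [|r rs IH] h; first by rewrite big_nil dvd1p.
rewrite big_cons exprS dvdp_mul ?dvdp_XsubCl ?h ?mem_head //.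
by apply: IH => x xs; rewrite h // inE xs orbT.
Qed.

Lemma horner_mx_comp (F : fieldType) N (A : 'M[F]_N.+1) (p q : {poly F}) :
  horner_mx A (p \Po q) = horner_mx (horner_mx A q) p.
Proof.
elim/poly_ind: p => [|p c IH]; first by rewrite comp_poly0 !rmorph0.
by rewrite comp_poly_MXaddC !rmorphD !rmorphM /= IH !horner_mx_C horner_mx_X.
Qed.

Lemma scaler_cancel (F : fieldType) (V : lmodType F) (v : V) c d :
  v != 0 -> c *: v = d *: v -> c = d.
Proof.
move=> v0 /eqP; rewrite -subr_eq0 -scalerBl scaler_eq0 (negPf v0) orbF subr_eq0.
by move/eqP.
Qed.

Lemma eigen_horner (F : fieldType) N (M : 'M[F]_N.+1) (p : {poly F}) (v : 'rV_N.+1) c :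
  v *m M = c *: v -> v *m horner_mx M p = p.[c] *: v.
Proof.
move=> vM; elim/poly_ind: p => [|q b IH].
  by rewrite rmorph0 mulmx0 horner0 scale0r.
rewrite rmorphD rmorphM /= horner_mx_X horner_mx_C hornerMXaddC -mulmxE mulmxDr mulmxA IH.
by rewrite -scalemxAl vM scalerA mul_mx_scalar scalerDl.
Qed.

(** The semisimple part is a polynomial in [t], so it is defined over the same
    field. *)
Lemma jordan_chevalley (F : fieldType) N (t : 'M[F]_N.+1) (f : {poly F}) k :
  separable_poly f -> char_poly t %| f ^+ k ->
  exists s, let ts := horner_mx t s in
    horner_mx ts f = 0 /\ (t - ts) ^+ k.+1 = 0.
Proof.
move=> sep dvd; have cop : coprimep f f^`() by rewrite separable_poly.unlock in sep.
have tf0 p : f ^+ k.+1 %| p -> horner_mx t p = 0.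
  move=> h; apply/eqP; rewrite -dvd_mxminpoly.
  apply: dvdp_trans (mxminpoly_dvd_char _) _.
  apply: dvdp_trans dvd _; apply: dvdp_trans h; by rewrite exprS dvdp_mull.
have [s [sX sf]] := newton_lift k cop; exists s; split.
  by rewrite -horner_mx_comp tf0.
rewrite -{1}[t]horner_mx_X -rmorphB -rmorphXn; apply: tf0.
by rewrite dvdp_exp2r // -dvdpNr opprB.
Qed.

Lemma diagonalize (F : fieldType) N (M : 'M[F]_N.+1) (rs : seq F) : uniq rs ->
  horner_mx M (\prod_(r <- rs) ('X - r%:P)) = 0 ->
  exists P a, [/\ P \in unitmx, M = invmx P *m diag_mx a *m P
    & forall i, a 0 i \in rs].
Proof.
move=> us M0; have [_] := diagonalizableP M.
case=> [|P uP /(diagonalizable_forLR uP)[a Ma]].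
  by exists rs; rewrite ?mxminpoly_min.
have {}Ma : M = invmx P *m diag_mx a *m P.
  by rewrite Ma mxpoly.conjumx ?unitmx_inv // invmxK.
exists P, a; split=> // i.
have := M0; rewrite Ma horner_mx_uconjC // => /(congr1 (fun X => P *m X *m invmx P)).
rewrite !mulmxA mulmxV // mul1mx mulmxK // mulmx0 mul0mx horner_mx_diag.
move=> /matrixP/(_ i i); rewrite !mxE eqxx mulr1n => /eqP.
by rewrite -[_ == 0]/(root _ _) root_prod_XsubC.
Qed.

(** * Integral powers of rational matrices *)

(** If c is the leading coefficient of an integral polynomial that annihilates
    x, then c x is integral. *)
Lemma Aint_multiple (x : algC) : exists2 e, (0 < e)%N & e%:R * x \in Aint.
Proof.
have [p [pE pm] _] := minCpolyP x; have [q [a a0 pq]] := rat_poly_scale p.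
have qx : (map_poly intr q).[x] = 0 :> algC.
  have := root_minCpoly x; rewrite pE pq map_polyZ rootZ; last first.
    by rewrite fmorph_eq0 invr_eq0 intr_eq0.
  move/rootP; rewrite -map_poly_comp => <-; congr (_.[_]).
  by apply: eq_map_poly => y /=; rewrite ratr_int.
set c := lead_coef q; have c0 : c != 0.
  rewrite lead_coef_eq0; apply: contraTneq pm => q0.
  by rewrite pq q0 map_poly0 scaler0 monicE lead_coef0 eq_sym oner_eq0.
have [n sq] : exists n, size q = n.+2.
  exists (size q).-2; have : (1 < size q)%N.
    rewrite ltnNge; apply/negP => /size1_polyC qE; move: qx c0.
    rewrite /c qE map_polyC hornerC lead_coefC /= => /eqP.
    by rewrite intr_eq0 => ->.
  by case: (size q) => [|[]].
exists (absz (c * c)%R); first by rewrite absz_gt0 mulf_neq0.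
have -> : (absz (c * c)%R)%:R = (c%:~R * c%:~R) :> algC.
  by rewrite -[LHS]/((Posz (absz (c * c)%R))%:~R) gez0_abs ?intrM // -expr2 sqr_ge0.
rewrite -mulrA rpredM ?Aint_int //.
pose r : {poly algC} :=
  \poly_(i < n.+2) (if i == n.+1 then 1 else (q`_i * c ^+ (n - i))%:~R).
apply: (@root_monic_Aint r).
- apply/rootP; suff -> : r.[c%:~R * x] = (c ^+ n)%:~R * (map_poly intr q).[x].
    by rewrite qx mulr0.
  rewrite horner_poly horner_coef.
  rewrite size_map_inj_poly ?sq //; last exact: intr_inj.
  rewrite mulr_sumr; apply: eq_bigr => -[i /= lti] _; rewrite coef_map /= exprMn.
  case: eqP => [->|/eqP ne].
    rewrite mul1r -[q`_ _]/(q`_(n.+2.-1)) -sq -lead_coefE -/c mulrA.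
    by rewrite -intrM -exprSr rmorphXn.
  have le : (i <= n)%N by move: lti; rewrite ltnS leq_eqVlt (negPf ne).
  rewrite -{2}(subnK le) exprD !intrM !rmorphXn /=; ring.
- rewrite monicE lead_coefE size_poly_eq ?eqxx ?oner_eq0 //=.
  by rewrite coef_poly ltnSn eqxx.
- apply/polyOverP => i; rewrite coef_poly; case: ifP => _; last exact: rpred0.
  by case: ifP => // _; rewrite rpred_int_num.
Qed.

Lemma Aint_common_multiple (s : seq algC) :
  exists2 e, (0 < e)%N & forall x, x \in s -> e%:R * x \in Aint.
Proof.
elim: s => [|y s [e e0 IH]]; first by exists 1%N.
have [d d0 dy] := Aint_multiple y; exists (e * d)%N; first by rewrite muln_gt0 e0.
move=> x; rewrite inE natrM => /orP[/eqP ->|/IH h].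
  by rewrite -mulrA rpredM // Aint_Cnat.
by rewrite mulrAC rpredM // Aint_Cnat.
Qed.

Lemma pigeonhole (T : finType) (f : nat -> T) : exists i j, (i < j)%N /\ f i = f j.
Proof.
have /injectivePn[i [j ne fij]] : ~~ injectiveb (fun i : 'I_(#|T|.+1) => f i).
  apply/injectiveP => /leq_card; by rewrite card_ord ltnn.
have [lt|lt|eq] := ltngtP i j; [by exists i, j|by exists j, i|].
by case/eqP: ne; apply: val_inj.
Qed.

Definition integral_mx m n (M : 'M[rat]_(m, n)) := exists H : 'M[int]_(m, n), M =
  map_mx intr H.

Lemma integral_mxP m n (M : 'M[rat]_(m, n)) : integral_mx M <-> M \is a mxOver Num.int.
Proof.
split=> [[H ->]|/mxOverP h]; first by apply/mxOverP => i j; rewrite mxE.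
exists (\matrix_(i, j) Num.floor (M i j)); apply/matrixP => i j.
by rewrite !mxE floorK.
Qed.

Lemma integral_mxM m n p (M : 'M[rat]_(m, n)) (N : 'M[rat]_(n, p)) :
  integral_mx M -> integral_mx N -> integral_mx (M *m N).
Proof. by move=> [H ->] [K ->]; exists (H *m K); rewrite map_mxM. Qed.

Lemma integral_mxD m n (M N : 'M[rat]_(m, n)) : integral_mx M -> integral_mx N ->
  integral_mx (M + N).
Proof. by move=> [H ->] [K ->]; exists (H + K); rewrite map_mxD. Qed.

Lemma integral_mxN m n (M : 'M[rat]_(m, n)) : integral_mx M -> integral_mx (- M).
Proof. by move=> [H ->]; exists (- H); rewrite map_mxN. Qed.

Lemma integral_mx1 n : integral_mx (1%:M : 'M[rat]_n).
Proof. by exists 1%:M; rewrite map_mx1. Qed.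

Lemma integral_mxX n (M : 'M[rat]_n.+1) k : integral_mx M -> integral_mx (M ^+ k).
Proof.
move=> h; elim: k => [|k IH]; first exact: integral_mx1.
by rewrite exprS; apply: integral_mxM.
Qed.

Lemma Crat_Aint_int (x : rat) : (ratr x : algC) \in Aint -> exists k : int, x = k%:~R.
Proof.
move=> h; have /intrP[k xk] := Cint_rat_Aint (Crat_rat x) h.
by exists k; apply: (fmorph_inj (ratr : {rmorphism rat -> algC})); rewrite /= xk ratr_int.
Qed.

(** The entries of the powers are combinations of the [z_l ^ k] with fixed
    coefficients; clearing the denominators of these coefficients makes all
    the entries algebraic integers, and rational algebraic integers are
    integers. *)
Lemma bounded_denominators N (g : 'M[rat]_N.+1) (P : 'M[algC]_N.+1) (z : 'rV[algC]_N.+1) :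
  P \in unitmx -> map_mx ratr g = invmx P *m diag_mx z *m P ->
  (forall i, z 0 i \in Aint) ->
  exists2 e, (0 < e)%N & forall k, integral_mx (e%:R *: g ^+ k).
Proof.
move=> uP gE zA.
have [e e0 eP] := Aint_common_multiple
  [seq invmx P abl.1.1 abl.2 * P abl.2 abl.1.2 | abl : 'I_N.+1 * 'I_N.+1 * 'I_N.+1].
exists e => // k.
have h a b : exists x : int, (e%:R *: g ^+ k) a b = x%:~R.
  apply: Crat_Aint_int.
  have -> : ratr ((e%:R *: g ^+ k) a b) = e%:R * (map_mx ratr g ^+ k : 'M[algC]__) a b.
    by rewrite -rmorphXn !mxE rmorphM rmorph_nat.
  rewrite gE conj_diagX // -mulmxA mxE mulr_sumr rpred_sum // => l _.
  rewrite mul_diag_mx !mxE (mulrCA (invmx P a l)) (mulrCA e%:R) rpredM ?rpredX //.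
  by apply: eP; apply/mapP; exists (a, b, l); rewrite ?mem_enum.
exists (\matrix_(a, b) Num.floor ((e%:R *: g ^+ k) a b)).
by apply/matrixP => a b; rewrite [RHS]mxE [in RHS]mxE; have [x ->] := h a b;
  rewrite intrKfloor.
Qed.

(** With [e] a common denominator of all powers of [g] and [g^-1], two powers
    of [g] differ by [e] times an integral matrix, by pigeonhole; dividing by
    one of them turns this into an integral matrix. *)
Lemma integral_power N (g : 'M[rat]_N.+1) (P : 'M[algC]_N.+1) (z : 'rV[algC]_N.+1) :
  P \in unitmx -> map_mx ratr g = invmx P *m diag_mx z *m P ->
  (forall i, alg_unit (z 0 i)) -> (forall i, z 0 i != 0) ->
  exists2 j, (0 < j)%N & integral_mx (g ^+ j) /\ integral_mx (g^-1 ^+ j).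
Proof.
move=> uP gE zU z0.
have ug : g \is a GRing.unit.
  rewrite -[_ \is a _]/(g \in unitmx) -(map_unitmx (ratr : {rmorphism rat -> algC})) /= gE.
  rewrite !unitmx_mul unitmx_inv uP /= andbT unitmxE det_diag unitfE.
  by rewrite prodf_seq_neq0; apply/allP => i _ /=.
have gVE : map_mx ratr g^-1 = invmx P *m diag_mx (\row_i (z 0 i)^-1) *m P.
  have ug' : map_mx (ratr : {rmorphism rat -> algC}) g \in unitmx by rewrite map_unitmx.
  rewrite map_invmx /=; apply: (can_inj (mulmxK ug')); rewrite mulVmx //
    gE !mulmxA mulmxK // -(mulmxA (invmx P)) mulmx_diag.
  rewrite (_ : diag_mx _ = 1%:M) ?mulmx1 ?mulVmx //.
  apply/matrixP => i j; rewrite !mxE; case: eqP => // _.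
  by rewrite !mulr1n mulVf.
have [e1 e10 h1] := bounded_denominators uP gE (fun i => (zU i).1).
have [|e2 e20 h2] := bounded_denominators uP gVE.
  by move=> i; rewrite mxE; case: (zU i).
pose e := (e1 * e2)%N; have e0 : (0 < e)%N by rewrite muln_gt0 e10.
have scale (a : nat) (M : 'M[rat]_N.+1) : integral_mx M -> integral_mx (a%:R *: M).
  by case=> H ->; exists (a%:R *: H); rewrite map_mxZ /= rmorph_nat.
have {h1} h1 k : integral_mx (e%:R *: g ^+ k).
  by rewrite /e mulnC natrM -scalerA; apply: scale.
have {h2} h2 k : integral_mx (e%:R *: g^-1 ^+ k).
  by rewrite /e natrM -scalerA; apply: scale.
(* The integral matrices [e g ^ k] are compared modulo [e * e], so that the
   difference of two powers of [g] is [e] times an integral matrix. *)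
pose H k : 'M[int]_N.+1 := \matrix_(a, b) Num.floor ((e%:R *: g ^+ k) a b).
have HE k : map_mx intr (H k) = e%:R *: g ^+ k.
  have [K KE] := h1 k; apply/matrixP => a b; rewrite mxE [H k a b]mxE KE mxE.
  by rewrite intrKfloor.
pose f k : {ffun 'I_N.+1 * 'I_N.+1 -> 'I_(e * e).+1} :=
  [ffun ab => inord (absz (H k ab.1 ab.2 %% (e * e)%N)%Z)].
have [i [j [ltij fij]]] := pigeonhole f.
have ee0 : (e * e)%N%:Z != 0 by rewrite eqz_nat -lt0n muln_gt0 e0.
have mod_eq a b : (H j a b %% (e * e)%N)%Z = (H i a b %% (e * e)%N)%Z.
  have /ffunP/(_ (a, b)) := fij; rewrite !ffunE /= => /(congr1 val)/esym/=.
  have bnd k : (absz (H k a b %% (e * e)%N)%Z < (e * e).+1)%N.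
    rewrite ltnS -lez_nat gez0_abs ?modz_ge0 //.
    by rewrite ltW // ltz_pmod // ltz_nat muln_gt0 e0.
  rewrite !inordK // => /(congr1 Posz); rewrite !gez0_abs ?modz_ge0 //.
clear f fij; clearbody H.
pose X : 'M[rat]_N.+1 := map_mx intr
  (\matrix_(a, b) ((H j a b %/ (e * e)%N)%Z - (H i a b %/ (e * e)%N)%Z)).
have iX : integral_mx X by eexists.
have eQ : e%:R != 0 :> rat by rewrite pnatr_eq0 -lt0n.
have gX : g ^+ j - g ^+ i = e%:R *: X.
  apply: (scalerI eQ); rewrite scalerBr -!HE scalerA -natrM.
  apply/matrixP => a b; rewrite !mxE.
  rewrite {1}(divz_eq (H j a b) (e * e)%N) {1}(divz_eq (H i a b) (e * e)%N) mod_eq.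
  by rewrite -!rmorphB /= !rmorphB !rmorphD !rmorphM /=; ring.
have gK k l : g^-1 ^+ k * g ^+ (k + l) = g ^+ l.
  by rewrite exprD mulrA -exprMn_comm ?mulVr ?expr1n ?mul1r //; apply/commr_sym/commrV.
have gK0 k : g^-1 ^+ k * g ^+ k = 1 by have := gK k 0%N; rewrite addn0.
have gVK : g^-1 ^+ j * g ^+ i = g^-1 ^+ (j - i).
  by rewrite -{1}(subnK (ltnW ltij)) exprD -mulrA gK0 mulr1.
have gKj : g^-1 ^+ i * g ^+ j = g ^+ (j - i).
  by rewrite -{1}(subnKC (ltnW ltij)) gK.
exists (j - i)%N; first by rewrite subn_gt0.
split.
  have -> : g ^+ (j - i) = 1 + (e%:R *: g^-1 ^+ i) *m X.
    by rewrite -scalemxAl scalemxAr -gX mulmxBr !mulmxE gKj gK0 addrC subrK.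
  by apply: integral_mxD; [apply: integral_mx1|apply: integral_mxM].
have -> : g^-1 ^+ (j - i) = 1 - (e%:R *: g^-1 ^+ j) *m X.
  by rewrite -scalemxAl scalemxAr -gX mulmxBr !mulmxE gVK gK0 opprB addrC subrK.
apply: integral_mxD; first exact: integral_mx1.
exact/integral_mxN/integral_mxM.
Qed.

(** * Unipotence of the translation part *)

Lemma int_col_ind n (Q : 'cV[int]_n -> Prop) :
  Q 0 -> (forall x y, Q x -> Q y -> Q (x + y)) -> (forall x, Q x -> Q (- x)) ->
  (forall j, Q (delta_mx j 0)) -> forall x, Q x.
Proof.
move=> Q0 QD QN Qe x; rewrite (matrix_sum_delta x).
elim/big_ind: _ => // j _; rewrite big_ord1.
case: (x j 0) => k.
  rewrite -[Posz k]natz scaler_nat; elim: k => [|k IH]; first by rewrite mulr0n.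
  by rewrite mulrS; apply: QD.
rewrite NegzE -natz scaleNr scaler_nat; apply: QN.
elim: k => [|k IH]; first by rewrite mulr1n.
by rewrite mulrS; apply: QD.
Qed.

Lemma is_trig_mxM (F : nzRingType) n (M M' : 'M[F]_n) : is_trig_mx M -> is_trig_mx M' ->
  is_trig_mx (M *m M') /\ forall i, (M *m M') i i = M i i * M' i i.
Proof.
move=> /is_trig_mxP h /is_trig_mxP h'; split.
  apply/is_trig_mxP => i j ltij; rewrite mxE big1 // => k _.
  case: (ltnP i k) => [lt|le]; first by rewrite h ?mul0r.
  by rewrite h' ?mulr0 // (leq_ltn_trans le).
move=> i; rewrite mxE (bigD1 i) //= big1 ?addr0 // => k ne.
case: (ltngtP i k) => [lt|gt|eq]; first by rewrite h ?mul0r.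
  by rewrite h' ?mulr0.
by case/eqP: ne; apply: val_inj.
Qed.

Lemma eigenvalue_conj (F : fieldType) n (S M : 'M[F]_n) c : S \in unitmx ->
  eigenvalue (S *m M *m invmx S) c -> eigenvalue M c.
Proof.
move=> uS /eigenvalueP[v vE v0]; apply/eigenvalueP; exists (v *m S).
  have := congr1 (fun X => X *m S) vE; rewrite /= !mulmxA mulmxKV // => ->.
  by rewrite scalemxAl.
apply: contraNneq v0 => e.
by rewrite -(mulmxK uS v) e mul0mx.
Qed.

Section Hyperbolic.
Variables (n : nat) (A : 'M[int]_n.+1).
Hypothesis hA : A \in unitmx.
Hypothesis hyp : hyperbolic A.
Hypothesis ss : semisimple A.

Lemma hyperbolic_diag : exists P (a : 'rV[algC]_n.+1), [/\ P \in unitmx,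
  map_mx intr A = invmx P *m diag_mx a *m P,
  forall i, eigenvalue (map_mx intr A : 'M[algC]_n.+1) (a 0 i)
  & forall i, `|a 0 i| != 1].
Proof.
have [P uP /(diagonalizable_forLR uP)[a Ma]] := ss.
have {}Ma : map_mx intr A = invmx P *m diag_mx a *m P.
  by rewrite Ma mxpoly.conjumx ?unitmx_inv // invmxK.
have ev i : eigenvalue (map_mx intr A : 'M[algC]_n.+1) (a 0 i).
  apply/eigenvalueP; exists (row i P).
    rewrite Ma -row_mul !mulmxA mulmxV // mul1mx; apply/rowP => j.
    by rewrite mul_diag_mx !mxE.
  apply: contraTneq uP => ri; rewrite -row_free_unit; apply/negP => /row_free_inj inj.
  have := inj 1%N (delta_mx 0 i) 0; rewrite /= -rowE ri mul0mx => /(_ erefl).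
  by move=> /matrixP/(_ 0 i); rewrite !mxE !eqxx => /eqP; rewrite oner_eq0.
exists P, a; split=> // i; exact: hyp (ev i).
Qed.

(** No eigenvalue is a root of unity. *)
Lemma hyperbolic_det k l : (k < l)%N -> \det (A ^+ l - A ^+ k) != 0.
Proof.
move=> lt; have [P [a [uP AE ev a1]]] := hyperbolic_diag.
have d0 : (0 < l - k)%N by rewrite subn_gt0.
rewrite -(subnKC (ltnW lt)); move: (l - k)%N d0 => d d0.
rewrite exprD -{2}[A ^+ k]mulr1 -mulrBr -mulmxE det_mulmx mulf_neq0 //.
  have : A ^+ k \in unitmx by apply: unitrX.
  by rewrite unitmxE; apply: contraTneq => ->; rewrite unitr0.
rewrite -(intr_eq0 algC) -det_map_mx rmorphB rmorphXn rmorph1 /= AE conj_diagX //.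
have -> : invmx P *m diag_mx (\row_i a 0 i ^+ d) *m P - 1 =
    invmx P *m diag_mx (\row_i (a 0 i ^+ d - 1)) *m P.
  rewrite -[1](mulVmx uP) -[X in _ - X *m _]mulmx1 -mulmxBl -mulmxBr.
  congr (_ *m _ *m _); apply/matrixP => i j; rewrite !mxE.
  by case: eqP => _; rewrite ?mulr1n // !mulr0n subrr.
rewrite !det_mulmx mulf_neq0 ?mulf_neq0 //.
- by rewrite det_inv invr_eq0; move: uP; rewrite unitmxE unitfE.
- rewrite det_diag prodf_seq_neq0; apply/allP => i _ /=; rewrite mxE subr_eq0.
  apply: contra (a1 i) => /eqP/(congr1 Num.norm); rewrite normrX normr1 => /eqP.
  by rewrite pexprn_eq1 // eqn0Ngt d0.
- by move: uP; rewrite unitmxE unitfE.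
Qed.

Section Unipotent.
Variables (N : nat) (U : 'cV[int]_n.+1 -> 'M[rat]_N.+1) (t : 'M[rat]_N.+1).
Hypothesis U0 : U 0 = 1%:M.
Hypothesis UD : forall x y, U (x + y) = U x *m U y.
Hypothesis ut : t \in unitmx.
Hypothesis tU : forall x, t *m U x = U (A *m x) *m t.

Lemma intertwine_expn k x : t ^+ k *m U x = U (A ^+ k *m x) *m t ^+ k.
Proof.
elim: k x => [|k IH] x; first by rewrite !expr0 !mul1mx mulmx1.
by rewrite exprSr -mulmxE -mulmxA tU !mulmxA IH !mulmxE exprSr mulmxA.
Qed.

(** In a basis that triangularizes all [U x], the diagonal entries are
    characters of Z^n. As [U (A ^ k e_j)] is conjugate to [U e_j] by [t ^ k],
    the values of a character at the [A ^ k e_j] lie in the finite spectrum of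
    [U e_j], and two exponents [k < l] give the same values at every [e_j].
    The characters are then trivial on the image of [A ^ l - A ^ k], which
    contains a multiple of Z^n. *)
Lemma unipotent_multiple : exists2 M : nat, (0 < M)%N &
  forall x, (U (M%:Z *: x) - 1) ^+ N.+1 = 0.
Proof.
pose UC x : 'M[algC]_N.+1 := map_mx ratr (U x).
have UCD x y : UC (x + y) = UC x *m UC y by rewrite /UC UD map_mxM.
have UCC x y : comm_mx (UC x) (UC y) by rewrite /comm_mx -!UCD addrC.
pose As := [seq UC (delta_mx j 0) | j : 'I_n.+1] ++ [seq UC (- delta_mx j 0) | j : 'I_n.+1].
have [|P /unitarymx_unit uP /allP trigP] := @cotrigonalization _ _ As.
  have h X : X \in As -> exists x, X = UC x.
    by rewrite mem_cat => /orP[] /mapP[j _ ->]; eexists.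
  by move=> X Y /h[x ->] /h[y ->]; apply: UCC.
pose T x := P *m UC x *m invmx P.
have TD x y : T (x + y) = T x *m T y.
  by rewrite /T UCD !mulmxA mulmxKV.
have T0 : T 0 = 1%:M by rewrite /T /UC U0 map_mx1 mulmx1 mulmxV.
have trigT x : is_trig_mx (T x).
  suff : is_trig_mx (T x) /\ is_trig_mx (T (- x)) by case.
  elim/int_col_ind: x => [|x y [h1 h2] [h3 h4]|x [h1 h2]|j].
  - by rewrite oppr0 T0; split; apply: scalar_mx_is_trig.
  - by rewrite opprD !TD; split; have [] := is_trig_mxM h1 h3; have [] := is_trig_mxM h2 h4.
  - by rewrite opprK.
  have h X : X \in As -> is_trig_mx (P *m X *m invmx P).
    by move=> /trigP h; rewrite -(conjumx _ uP); exact: h.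
  by split; apply: h; rewrite mem_cat; apply/orP; [left|right];
     apply/mapP; exists j; rewrite ?mem_enum.
have chiD x y i : T (x + y) i i = T x i i * T y i i.
  by rewrite TD; have [_ ->] := is_trig_mxM (trigT x) (trigT y).
have chiN x i : T x i i * T (- x) i i = 1.
  by rewrite -chiD subrr T0 mxE eqxx.
have chi0 x i : T x i i != 0.
  by apply/negP => /eqP e; have /eqP := chiN x i; rewrite e mul0r eq_sym oner_eq0.
have root_chi k j i : root (char_poly (UC (delta_mx j 0))) (T (A ^+ k *m delta_mx j 0) i i).
  rewrite -eigenvalue_root_char.
  have utk : map_mx (ratr : {rmorphism rat -> algC}) (t ^+ k) \in unitmx.
    by rewrite map_unitmx; apply: unitrX.
  apply: (@eigenvalue_conj _ _ (P *m map_mx ratr (t ^+ k))).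
    by rewrite unitmx_mul uP.
  have -> : P *m map_mx ratr (t ^+ k) *m UC (delta_mx j 0) *m
      invmx (P *m map_mx ratr (t ^+ k)) = T (A ^+ k *m delta_mx j 0).
    have u : P *m map_mx (ratr : {rmorphism rat -> algC}) (t ^+ k) \in unitmx.
      by rewrite unitmx_mul uP.
    apply: (can_inj (mulmxK u)); rewrite mulmxKV // /T !mulmxA mulmxKV // -!mulmxA;
      congr (_ *m _).
    by rewrite /UC -!map_mxM intertwine_expn.
  rewrite eigenvalue_root_char char_poly_trig //.
  by rewrite /root horner_prod (bigD1 i) //= hornerXsubC subrr mul0r.
pose rs j := sval (closed_field_poly_normal (char_poly (UC (delta_mx j 0)))).
have mem_rs k j i : T (A ^+ k *m delta_mx j 0) i i \in rs j.
  have := root_chi k j i; rewrite /rs; case: closed_field_poly_normal => r /= ->.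
  rewrite rootZ ?root_prod_XsubC // lead_coef_eq0.
  exact/monic_neq0/char_poly_monic.
pose S := flatten [seq rs j | j : 'I_n.+1].
have mem_S k j i : T (A ^+ k *m delta_mx j 0) i i \in S.
  apply/flattenP; exists (rs j) => //; apply/mapP; exists j; by rewrite ?mem_enum.
pose f k : {ffun 'I_N.+1 * 'I_n.+1 -> 'I_(size S).+1} :=
  [ffun ij => inord (index (T (A ^+ k *m delta_mx ij.2 0) ij.1 ij.1) S)].
have [k [l [ltkl fkl]]] := pigeonhole f.
have eqe i j : T (A ^+ k *m delta_mx j 0) i i = T (A ^+ l *m delta_mx j 0) i i.
  have /ffunP/(_ (i, j)) := fkl; rewrite !ffunE /= => /(congr1 val) /=.
  rewrite !inordK ?ltnS ?index_size // => e.
  by rewrite -[LHS](nth_index 0 (mem_S k j i)) e nth_index.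
clear f fkl.
have eqx i x : T (A ^+ k *m x) i i = T (A ^+ l *m x) i i.
  elim/int_col_ind: x => [|x y h h'|x h|j]; [by rewrite !mulmx0| | |exact: eqe].
  - by rewrite !mulmxDr !chiD h h'.
  - rewrite !mulmxN; apply: (mulfI (chi0 (A ^+ k *m x) i)).
    by rewrite chiN h chiN.
pose D := A ^+ l - A ^+ k.
have chiDx i x : T (D *m x) i i = 1.
  by rewrite mulmxBl chiD -eqx chiN.
have D0 : \det D != 0 by apply: hyperbolic_det.
(* The determinant is squared to make it positive. *)
exists (absz (\det D * \det D)); first by rewrite absz_gt0 mulf_neq0.
move=> x; rewrite gez0_abs -?expr2 ?sqr_ge0 // expr2.
have -> : (\det D * \det D) *: x = D *m (\adj D *m (\det D *: x)).
  by rewrite mulmxA mul_mx_adj -scalerA mul_scalar_mx.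
set y := D *m _.
have TE z : T z = P *m UC z *m invmx P by [].
clearbody T.
have trigy : is_trig_mx (T y - 1%:M).
  apply/is_trig_mxP => i j lt; have /is_trig_mxP/(_ i j lt) e := trigT y.
  by rewrite !mxE e -val_eqE /= (ltn_eqF lt) subr0.
have nil : (T y - 1%:M) ^+ N.+1 = 0.
  have := Cayley_Hamilton (T y - 1%:M); rewrite char_poly_trig //.
  under eq_bigr => i _ do rewrite [_ i i]mxE chiDx mxE mxE eqxx subrr subr0.
  by rewrite prodr_const card_ord rmorphXn /= horner_mx_X.
have nilC : (UC y - 1%:M) ^+ N.+1 = 0.
  have -> : UC y - 1%:M = invmx P *m (T y - 1%:M) *m P.
    rewrite mulmxBr mulmxBl mulmx1 mulVmx // TE !mulmxA mulVmx // mul1mx mulmxKV //.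
  have conjX m : (invmx P *m (T y - 1%:M) *m P) ^+ m = invmx P *m (T y - 1%:M) ^+ m *m P.
    elim: m => [|m IH]; first by rewrite !expr0 mulmx1 mulVmx.
    by rewrite !exprS IH -!mulmxE !mulmxA mulmxK.
  by rewrite conjX nil mulmx0 mul0mx.
apply: (map_mx_inj (f := ratr : {rmorphism rat -> algC})).
by rewrite rmorphXn rmorphB rmorph1 map_mx0.
Qed.

End Unipotent.
End Hyperbolic.

(** * Unipotent representations are polynomial *)

Lemma specializes_mx_prod (F : numFieldType) (R : F -> F -> Prop) a (I : Type) (r : seq I)
  (f : I -> nat -> 'M[F]_a.+1) v : partial_hom R ->
  (forall i, specializes_mx R (f i) (v i)) ->
  specializes_mx R (fun k => \prod_(i <- r) f i k) (\prod_(i <- r) v i).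
Proof.
move=> hR h; elim: r => [|i r IH].
  by rewrite big_nil; apply: eq_specializes_mx (specializes_mx_const hR 1) => k;
    rewrite big_nil.
by rewrite big_cons; apply: eq_specializes_mx (specializes_mxM hR (h i) IH) => k;
  rewrite big_cons.
Qed.

Lemma specializes_mxB (F : numFieldType) (R : F -> F -> Prop) a b
  (f g : nat -> 'M[F]_(a, b)) v w : partial_hom R ->
  specializes_mx R f v -> specializes_mx R g w -> specializes_mx R (fun k =>
    f k - g k) (v - w).
Proof.
move=> hR hf hg; rewrite -scaleN1r.
apply: (@eq_specializes_mx _ _ _ _ (fun k => f k + (-1) *: g k)) => [k|].
  by rewrite scaleN1r.
by apply: specializes_mxD => //; apply: specializes_mxZ => //; apply: specializes_const.
Qed.

Section PolynomialMap.
Variables (n N : nat) (U : 'cV[int]_n.+1 -> 'M[rat]_N.+1).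
Hypothesis U0 : U 0 = 1%:M.
Hypothesis UD : forall x y, U (x + y) = U x *m U y.
Hypothesis Unil : forall x, (U x - 1) ^+ N.+1 = 0.

Let UC x : 'M[algC]_N.+1 := map_mx ratr (U x).

Let UCD x y : UC (x + y) = UC x * UC y.
Proof. by rewrite /UC UD map_mxM. Qed.

Let UC0 : UC 0 = 1.
Proof. by rewrite /UC U0 map_mx1. Qed.

(** Each factor is [U (y_j e_j)], with the integer [y_j] replaced by a scalar. *)
Definition poly_ext (y : 'cV[algC]_n.+1) : 'M[algC]_N.+1 :=
  \prod_(j < n.+1) unip_exp N.+1 (UC (delta_mx j 0) - 1) (y j 0).

Lemma unip_exp_hom (x : 'cV[int]_n.+1) (k : int) :
  unip_exp N.+1 (UC x - 1) k%:~R = UC (k *: x).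
Proof.
have nil : (UC x - 1) ^+ N.+1 = 0.
  have := congr1 (map_mx (ratr : {rmorphism rat -> algC})) (Unil x).
  by rewrite rmorphXn rmorphB rmorph1 map_mx0.
have S (y : algC) : unip_exp N.+1 (UC x - 1) (y + 1) = UC x * unip_exp N.+1 (UC x - 1) y.
  by rewrite unip_expS // addrC subrK.
elim/int_ind: k => [|k IH|k IH]; first by rewrite unip_exp0 scale0r UC0.
  by rewrite -(addn1 k) PoszD rmorphD /= S IH -UCD addrC scalerDl scale1r.
have uU : UC (- x) * UC x = 1 by rewrite -UCD addNr UC0.
rewrite -[LHS]mul1r -{1}uU -mulrA -S -(addn1 k) PoszD opprD rmorphD /= subrK IH -UCD.
by rewrite scalerDl scaleN1r addrC.
Qed.

Lemma poly_extE (x : 'cV[int]_n.+1) : poly_ext (map_mx intr x) = UC x.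
Proof.
rewrite [in RHS](matrix_sum_delta x) /poly_ext.
under [in RHS]eq_bigr do rewrite big_ord1.
rewrite (big_morph UC UCD UC0); apply: eq_bigr => j _.
by rewrite mxE unip_exp_hom.
Qed.

Variables (A : 'M[int]_n.+1) (t : 'M[rat]_N.+1).
Hypothesis tU : forall x, t *m U x = U (A *m x) *m t.

(** The identity [t ^ k U(x) = U(A ^ k x) t ^ k] is polynomial in the entries
    of [t ^ k] and [A ^ k], because [U] is; so it passes to the
    specializations. *)
Lemma closure_normalizes (R : algC -> algC -> Prop) (d : 'M[algC]_N.+1)
    (B : 'M[int]_n.+1) : partial_hom R ->
  specializes_mx R (fun k => map_mx ratr t ^+ k) d ->
  specializes_mx R (fun k => map_mx intr A ^+ k) (map_mx intr B) ->
  forall x, d *m UC x = UC (B *m x) *m d.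
Proof.
move=> hR td AB x; rewrite -(poly_extE (B *m x)) map_mxM; apply/eqP; rewrite -subr_eq0;
  apply/eqP.
pose xC : 'cV[algC]_n.+1 := map_mx intr x.
apply: (specializes_mx_eq0 hR (f := fun k => map_mx ratr t ^+ k *m UC x -
   poly_ext (map_mx intr A ^+ k *m xC) *m map_mx ratr t ^+ k)); last first.
  move=> k.
  have -> : map_mx intr A ^+ k *m xC = map_mx intr (A ^+ k *m x) by rewrite map_mxM rmorphXn.
  rewrite -rmorphXn poly_extE.
  by rewrite /UC -!map_mxM (intertwine_expn tU) subrr.
have xCadm := specializes_mx_const hR xC.
have Padm : specializes_mx R (fun k =>
  poly_ext (map_mx intr A ^+ k *m xC)) (poly_ext (map_mx intr B *m xC)).
  apply: specializes_mx_prod => // j; apply: specializes_unip_exp => //.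
  exact: (specializes_mxM hR AB xCadm).
apply: specializes_mxB => //; first exact/specializes_mxM/specializes_mx_const.
exact: specializes_mxM.
Qed.

End PolynomialMap.

(** * Polynomial functions of a matrix and descent to rational equations *)

Lemma mpoly_eval_mxE N (F : numFieldType) (q : {mpoly rat[N * N]}) (g : 'M[F]_N) :
  mpoly_eval_mx q g =
  \sum_(m <- msupp q) ratr q@_m * \prod_(k < N * N) mxvec g 0 k ^+ m k.
Proof.
rewrite /mpoly_eval_mx /map_mpoly /mmap raddf_sum /=; apply: eq_bigr => m _.
rewrite mevalM mevalC; congr (_ * _); rewrite /mmap1 rmorph_prod; apply: eq_bigr => k _.
by rewrite rmorphXn /= mevalXU.
Qed.

Lemma mpoly_eval_rat N (q : {mpoly rat[N * N]}) (g : 'M[rat]_N) :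
  mpoly_eval_mx q g = q.@[fun k => mxvec g 0 k].
Proof.
rewrite mpoly_eval_mxE mevalE; apply: eq_bigr => m _; congr (_ * _).
exact/esym/(fmorph_eq_rat idfun).
Qed.

Lemma mpoly_eval_ratr N (F : numFieldType) (q : {mpoly rat[N * N]}) (h : 'M[rat]_N) :
  mpoly_eval_mx q (map_mx ratr h : 'M[F]_N) = ratr (mpoly_eval_mx q h).
Proof.
rewrite !mpoly_eval_mxE rmorph_sum; apply: eq_bigr => m _; rewrite rmorphM rmorph_prod.
congr (_ * _); first by congr ratr; apply: (fmorph_eq_rat idfun).
by apply: eq_bigr => k _; rewrite rmorphXn -map_mxvec mxE.
Qed.

Section EvalMorphism.
Variables (N : nat) (F : numFieldType) (g : 'M[F]_N).
Implicit Types q r : {mpoly rat[N * N]}.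

Lemma mpoly_evalD q r : mpoly_eval_mx (q + r) g = mpoly_eval_mx q g + mpoly_eval_mx r g.
Proof.
by rewrite /mpoly_eval_mx (raddfD (map_mpoly (n := N * N) (ratr : {rmorphism rat ->
  F}))) mevalD.
Qed.

Lemma mpoly_evalM q r : mpoly_eval_mx (q * r) g = mpoly_eval_mx q g * mpoly_eval_mx r g.
Proof.
by rewrite /mpoly_eval_mx (rmorphM (map_mpoly (n := N * N) (ratr : {rmorphism rat ->
  F}))) mevalM.
Qed.

Lemma mpoly_evalC c : mpoly_eval_mx c%:MP g = ratr c.
Proof. by rewrite /mpoly_eval_mx /map_mpoly mmapC /= mevalC. Qed.

Lemma mpoly_evalXU k : mpoly_eval_mx 'X_k g = mxvec g 0 k.
Proof. by rewrite /mpoly_eval_mx /map_mpoly mmapX mmap1U mevalXU. Qed.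

Lemma mpoly_evalX q k : mpoly_eval_mx (q ^+ k) g = mpoly_eval_mx q g ^+ k.
Proof.
elim: k => [|k IH]; first by rewrite !expr0 -mpolyC1 mpoly_evalC rmorph1.
by rewrite !exprS mpoly_evalM IH.
Qed.

Lemma mpoly_eval_sum (I : Type) (r : seq I) (q : I -> {mpoly rat[N * N]}) :
  mpoly_eval_mx (\sum_(i <- r) q i) g = \sum_(i <- r) mpoly_eval_mx (q i) g.
Proof.
apply: (big_morph (fun q => mpoly_eval_mx q g) mpoly_evalD).
by rewrite -mpolyC0 mpoly_evalC rmorph0.
Qed.

Lemma mpoly_eval_prod (I : Type) (r : seq I) (q : I -> {mpoly rat[N * N]}) :
  mpoly_eval_mx (\prod_(i <- r) q i) g = \prod_(i <- r) mpoly_eval_mx (q i) g.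
Proof.
apply: (big_morph (fun q => mpoly_eval_mx q g) mpoly_evalM).
by rewrite -mpolyC1 mpoly_evalC rmorph1.
Qed.

End EvalMorphism.

(** Substitution of variables, as a polynomial that serves all fields at once. *)
Lemma mpoly_eval_reindex N n (emb : 'I_(n * n) -> 'I_(N * N)) (q : {mpoly rat[n * n]}) :
  exists Q : {mpoly rat[N * N]}, forall (F : numFieldType) (g : 'M[F]_N) (h : 'M[F]_n),
    (forall k, mxvec h 0 k = mxvec g 0 (emb k)) -> mpoly_eval_mx Q g = mpoly_eval_mx q h.
Proof.
exists (\sum_(m <- msupp q) (q@_m)%:MP * \prod_k 'X_(emb k) ^+ m k) => F g h gh.
rewrite [RHS]mpoly_eval_mxE; apply: etrans (mpoly_eval_sum _ _ _) _; apply: eq_bigr => m _.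
apply: etrans (mpoly_evalM _ _ _) _; rewrite mpoly_evalC; congr (_ * _).
apply: etrans (mpoly_eval_prod _ _ _) _; apply: eq_bigr => k _.
by apply: etrans (mpoly_evalX _ _ _) _; rewrite mpoly_evalXU gh.
Qed.

Lemma specializes_eval N (R : algC -> algC -> Prop) (q : {mpoly rat[N * N]})
    (f : nat -> 'M[algC]_N) v : partial_hom R ->
  specializes_mx R f v -> specializes R (fun k => mpoly_eval_mx q (f k)) (mpoly_eval_mx q v).
Proof.
move=> hR h; rewrite mpoly_eval_mxE.
apply: (@eq_specializes _ _ (fun k => \sum_(m <- msupp q) ratr q@_m *
    \prod_(l < N * N) mxvec (f k) 0 l ^+ m l)) => [k|].
  by rewrite mpoly_eval_mxE.
apply: specializes_sum => // m _; apply: specializesM => //; first exact: specializes_const.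
apply: specializes_prod => // l _; apply: specializesX => //.
case/mxvec_indexP: l => i j.
apply: (@eq_specializes _ _ (fun k => f k i j)) => [k|]; first by rewrite mxvecE.
by rewrite mxvecE.
Qed.

Section PolynomialFunctions.
Variables (F : fieldType) (N : nat).

Definition poly_fun (f : 'M[F]_N -> F) : Prop :=
  exists Q : {mpoly F[N * N]}, forall g, f g = Q.@[fun k => mxvec g 0 k].

Lemma eq_poly_fun f f' : f =1 f' -> poly_fun f -> poly_fun f'.
Proof. by move=> e [Q h]; exists Q => g; rewrite -e. Qed.

Lemma poly_fun_const c : poly_fun (fun _ => c).
Proof. by exists c%:MP => g; rewrite mevalC. Qed.

Lemma poly_fun_entry i j : poly_fun (fun g => g i j).
Proof. by exists 'X_(mxvec_index i j) => g; rewrite mevalXU mxvecE. Qed.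

Lemma poly_funD f f' : poly_fun f -> poly_fun f' -> poly_fun (fun g => f g + f' g).
Proof. by move=> [Q h] [Q' h']; exists (Q + Q') => g; rewrite h h' mevalD. Qed.

Lemma poly_funM f f' : poly_fun f -> poly_fun f' -> poly_fun (fun g => f g * f' g).
Proof. by move=> [Q h] [Q' h']; exists (Q * Q') => g; rewrite h h' mevalM. Qed.

Lemma poly_funB f f' : poly_fun f -> poly_fun f' -> poly_fun (fun g => f g - f' g).
Proof. by move=> [Q h] [Q' h']; exists (Q - Q') => g; rewrite h h' mevalB. Qed.

Lemma poly_fun_sum (I : Type) (r : seq I) (f : I -> 'M[F]_N -> F) :
  (forall i, poly_fun (f i)) -> poly_fun (fun g => \sum_(i <- r) f i g).
Proof.
move=> h; elim: r => [|i r IH].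
  by apply: eq_poly_fun (poly_fun_const 0) => g; rewrite big_nil.
by apply: eq_poly_fun (poly_funD (h i) IH) => g; rewrite big_cons.
Qed.

Lemma poly_fun_prod (I : Type) (r : seq I) (f : I -> 'M[F]_N -> F) :
  (forall i, poly_fun (f i)) -> poly_fun (fun g => \prod_(i <- r) f i g).
Proof.
move=> h; elim: r => [|i r IH].
  by apply: eq_poly_fun (poly_fun_const 1) => g; rewrite big_nil.
by apply: eq_poly_fun (poly_funM (h i) IH) => g; rewrite big_cons.
Qed.

Lemma poly_funX f k : poly_fun f -> poly_fun (fun g => f g ^+ k).
Proof. by move=> [Q h]; exists (Q ^+ k) => g; rewrite h rmorphXn. Qed.

Lemma poly_fun_mulmx a b (L : 'M[F]_(a, N)) (R : 'M[F]_(N, b)) i j :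
  poly_fun (fun g => (L *m g *m R) i j).
Proof.
apply: (@eq_poly_fun (fun g => \sum_l (\sum_k L i k * g k l) * R l j)) => [g|].
  by rewrite mxE; apply: eq_bigr => l _; rewrite mxE.
apply: poly_fun_sum => l; apply: poly_funM (poly_fun_const _); apply: poly_fun_sum => k.
exact/poly_funM/poly_fun_entry/poly_fun_const.
Qed.

End PolynomialFunctions.

Lemma poly_fun_comp (F : fieldType) N M (Q : {mpoly F[M]}) (f : 'I_M -> 'M[F]_N -> F) :
  (forall k, poly_fun (f k)) -> poly_fun (fun g => Q.@[fun k => f k g]).
Proof.
move=> h; apply: (@eq_poly_fun _ _ (fun g => \sum_(m <- msupp Q) Q@_m *
  \prod_(k < M) f k g ^+ m k)) => [g|]; first by rewrite mevalE.
apply: poly_fun_sum => m; apply: poly_funM (poly_fun_const _ _) _.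
by apply: poly_fun_prod => k; apply: poly_funX.
Qed.

(** Decompose the coefficients of the polynomial on a Q-basis of the number
    field that they generate; on rational points, each rational component
    vanishes separately. *)
Theorem descent N (f : 'M[algC]_N -> algC) (H : 'M[rat]_N -> Prop) (g : 'M[algC]_N) :
  poly_fun f -> (forall h, H h -> f (map_mx ratr h) = 0) ->
  (forall q : {mpoly rat[N * N]}, (forall h, H h -> mpoly_eval_mx q h = 0) ->
     mpoly_eval_mx q g = 0) ->
  f g = 0.
Proof.
case=> Q fQ fH qg.
have [L [iota [s1 Ds _]]] := num_field_exists [seq Q@_m | m <- msupp Q].
pose l m := s1`_(index m (msupp Q)).
have lE m : m \in msupp Q -> iota (l m) = Q@_m.
  move=> ms; rewrite /l -(nth_map 0 0 iota); last first.
    by rewrite -(size_map iota) Ds size_map index_mem.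
  by rewrite Ds (nth_map m) ?index_mem // nth_index.
pose b := vbasis {:L}.
pose q j : {mpoly rat[N * N]} := \sum_(m <- msupp Q) (coord b j (l m)) *: 'X_[m].
have qE (F : numFieldType) j (v : 'M[F]_N) : mpoly_eval_mx (q j) v =
    \sum_(m <- msupp Q) ratr (coord b j (l m)) * \prod_k mxvec v 0 k ^+ m k.
  rewrite /mpoly_eval_mx /q.
  rewrite (raddf_sum (map_mpoly (n := N * N) (ratr : {rmorphism rat -> F}))) raddf_sum.
  apply: eq_bigr => m _; rewrite /= /map_mpoly mmapZ mmapX /= mevalM mevalC.
  congr (_ * _); rewrite /mmap1 rmorph_prod; apply: eq_bigr => k _.
  by rewrite rmorphXn /= mevalXU.
have fE v : f v = \sum_(j < \dim {:L}) iota b`_j * mpoly_eval_mx (q j) v.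
  rewrite fQ mevalE; under [RHS]eq_bigr do rewrite qE mulr_sumr.
  rewrite exchange_big /= big_seq [RHS]big_seq; apply: eq_bigr => m ms.
  rewrite -lE // [l m in LHS](coord_vbasis (memvf _)) rmorph_sum mulr_suml.
  apply: eq_bigr => j _; rewrite mulrA; congr (_ * _).
  by rewrite -mulr_algl rmorphM mulrC; congr (_ * _); apply:
    (fmorph_eq_rat (iota \o in_alg L)).
rewrite fE big1 // => j _; rewrite qg ?mulr0 // => h Hh.
have := fH h Hh; rewrite fE => e.
have : \sum_(j < \dim {:L}) mpoly_eval_mx (q j) h *: b`_j = 0.
  apply: (fmorph_inj iota); rewrite rmorph0 -[RHS]e rmorph_sum; apply: eq_bigr => i _.
  rewrite mpoly_eval_ratr -mulr_algl rmorphM mulrC; congr (_ * _).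
  exact: (fmorph_eq_rat (iota \o in_alg L)).
by have /freeP fb := basis_free (vbasisP {:L}); move=> /fb/(_ j).
Qed.

(** * Multiplicative relations and conjugates *)

Section GeneratedRelation.
Variables (F : fieldType) (I : finType) (a x : I -> F).
Hypothesis a0 : forall k, a k != 0.
Hypothesis x0 : forall k, x k != 0.
Hypothesis ax : forall c : I -> int, \prod_k a k ^ c k = 1 -> \prod_k x k ^ c k = 1.

(** The homomorphism of the group generated by the [a k] that maps [a k] to [x
    k]. *)
Definition gen_rel (g w : F) : Prop :=
  exists c : I -> int, g = \prod_k a k ^ c k /\ w = \prod_k x k ^ c k.

Lemma gen_relP : partial_hom gen_rel.
Proof.
split.
- by exists (fun _ => 0); rewrite !big1.
- move=> _ _ _ _ [c [-> ->]] [d [-> ->]]; exists (fun k => c k + d k).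
  by split; rewrite -big_split; apply: eq_bigr => k _; rewrite expfzDr.
- move=> _ _ [c [-> ->]]; exists (fun k => - c k).
  by split; rewrite -prodfV; apply: eq_bigr => k _; rewrite invr_expz.
- move=> _ _ [c [-> ->]]; split; apply/prodf_neq0 => k _; exact: expfz_neq0.
- by move=> _ [c [/esym/ax h ->]].
Qed.

Lemma gen_rel_gen k : gen_rel (a k) (x k).
Proof.
have h (y : I -> F) : y k = \prod_l y l ^ (l == k)%:Z.
  by rewrite (bigD1 k) //= eqxx expr1z big1 ?mulr1 // => l /negPf ->.
by exists (fun l => (l == k)%:Z); rewrite -!h.
Qed.

Lemma gen_rel_in (U : F -> Prop) : mul_closed U -> (forall k, U (x k)) ->
  forall g w, gen_rel g w -> U w.
Proof.
move=> hU Ux _ _ [c [_ ->]]; elim/big_ind: _; [exact: mc1|exact: mcM|].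
by move=> k _; apply: mcX.
Qed.

End GeneratedRelation.

(** Moving the negative exponents to the other side turns a multiplicative
    relation into a polynomial equation. *)
Lemma prod_exprz_split (F : fieldType) (I : finType) (x : I -> F) (c : I -> int) :
  (forall k, x k != 0) ->
  \prod_k x k ^+ (absz (Num.max (c k) 0)) = \prod_k x k ^+ (absz (Num.max (- c k) 0))
  <-> \prod_k x k ^ c k = 1.
Proof.
move=> x0.
have -> : \prod_k x k ^ c k = (\prod_k x k ^+ (absz (Num.max (c k) 0))) /
    (\prod_k x k ^+ (absz (Num.max (- c k) 0))).
  rewrite -prodfV -big_split; apply: eq_bigr => k _ /=.
  case: (c k) => [[|j]|j].
  - by rewrite oppr0 maxxx !expr0z divr1.
  - by rewrite max_l // max_r ?divr1 // oppr_le0.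
  - by rewrite NegzE max_r ?oppr_le0 // opprK max_l // mul1r.
have n0 : \prod_k x k ^+ (absz (Num.max (- c k) 0)) != 0.
  by apply/prodf_neq0 => k _; rewrite expf_neq0.
by split=> [->|/divr1_eq //]; rewrite divff.
Qed.

Section Conjugates.
Variables (h : {poly rat}) (lam : algC).
Hypothesis h_irr : irreducible_poly h.
Hypothesis h_lam : root (ratpC h) lam.

Lemma irr_dvd (q : {poly rat}) : root (ratpC q) lam -> h %| q.
Proof.
move=> ql; have [h1 hd] := h_irr.
case: (eqVneq (size (gcdp h q)) 1%N) => [g1|/hd/(_ (dvdp_gcdl _ _))].
  have : coprimep (ratpC h) (ratpC q) by rewrite coprimep_map /coprimep g1.
  by move/coprimep_root/(_ h_lam); rewrite (rootP ql) eqxx.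
by move=> e; rewrite -(eqp_dvdl _ e) dvdp_gcdr.
Qed.

Lemma conj_root (q : {poly rat}) a : root (ratpC h) a ->
  root (ratpC q) lam -> root (ratpC q) a.
Proof.
move=> ha /irr_dvd; rewrite -(dvdp_map (ratr : {rmorphism rat -> algC})) /=.
by move=> hq; move: ha; rewrite -!dvdp_XsubCl => /dvdp_trans; apply.
Qed.

Lemma conj_val (p q : {poly rat}) a : root (ratpC h) a ->
  (ratpC p).[lam] = (ratpC q).[lam] -> (ratpC p).[a] = (ratpC q).[a].
Proof.
move=> ha e; have := @conj_root (p - q) a ha.
rewrite /root rmorphB !hornerE e subrr eqxx => /(_ isT).
by rewrite subr_eq0 => /eqP.
Qed.

(** The inverse of [p(lam)] is again a polynomial in [lam], with an identity
    that holds at all conjugates. *)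
Lemma conj_inv (p : {poly rat}) : (ratpC p).[lam] != 0 ->
  exists q : {poly rat}, forall a, root (ratpC h) a -> (ratpC q).[a] * (ratpC p).[a] = 1.
Proof.
move=> p0; have cop : coprimep p h.
  rewrite coprimep_sym /coprimep; apply: contraNT p0 => g1.
  have [_ /(_ _ g1 (dvdp_gcdl _ _)) e] := h_irr.
  have : h %| p by rewrite -(eqp_dvdl _ e) dvdp_gcdr.
  rewrite -(dvdp_map (ratr : {rmorphism rat -> algC})) /=.
  by move: h_lam; rewrite -dvdp_XsubCl => /dvdp_trans hp /hp; rewrite dvdp_XsubCl.
have /Bezout_eq1_coprimepP[[u v] /= uv] := cop.
exists u => a ha; have := congr1 (fun q => (ratpC q).[a]) uv.
by rewrite !(rmorphD, rmorphM, rmorph1) /= !hornerE (rootP ha) mulr0 addr0.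
Qed.

Lemma conj_neq0 (p : {poly rat}) a : root (ratpC h) a ->
  (ratpC p).[lam] != 0 -> (ratpC p).[a] != 0.
Proof.
move=> ha /conj_inv[q qp].
by apply: contraTneq (oner_neq0 algC) => pa; rewrite -(qp a ha) pa mulr0 eqxx.
Qed.

Lemma conj_Aint (p : {poly rat}) a : root (ratpC h) a ->
  (ratpC p).[lam] \in Aint -> (ratpC p).[a] \in Aint.
Proof.
move=> ha pA; have [q [qE qm] _] := minCpolyP (ratpC p).[lam].
apply: (@root_monic_Aint (ratpC q)); [|by rewrite map_monic|by rewrite -qE].
have comp b : (ratpC (q \Po p)).[b] = (ratpC q).[(ratpC p).[b]].
  by rewrite map_comp_poly horner_comp.
rewrite /root -comp; apply: (conj_root ha).
by rewrite /root comp -qE; apply: root_minCpoly.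
Qed.

Lemma conj_alg_unit (p : {poly rat}) a : root (ratpC h) a -> (ratpC p).[lam] != 0 ->
  alg_unit (ratpC p).[lam] -> alg_unit (ratpC p).[a] /\ (ratpC p).[a] != 0.
Proof.
move=> ha p0 [pA pVA]; have [q qp] := conj_inv p0.
have pa0 := conj_neq0 ha p0; have qV b : root (ratpC h) b -> (ratpC q).[b] = (ratpC p).[b]^-1.
  by move=> hb; apply: (mulIf (conj_neq0 hb p0)); rewrite qp // mulVf ?(conj_neq0 hb p0).
split=> //; split; first exact: conj_Aint.
by rewrite -qV //; apply: conj_Aint; rewrite ?qV.
Qed.

End Conjugates.

(** * Relations satisfied by the points of S *)

Lemma map_ratr_id (p : {poly rat}) : map_poly (ratr : rat -> rat) p = p.
Proof.
by apply/polyP => i; rewrite coef_map /=; apply/esym/(fmorph_eq_rat idfun).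
Qed.

Section TorusRelations.
Variables (m : nat) (mu : 'I_m -> {poly rat}) (lambda : 'I_m -> algC).
Hypothesis mu_irr : forall i, irreducible_poly (mu i).
Hypothesis mu0 : forall i, ~~ root (mu i) 0.
Hypothesis lambda_root : forall i, root (ratpC (mu i)) (lambda i).

Let d i := (size (mu i)).-1.

Let d_gt0 i : (0 < d i)%N.
Proof. by have [] := mu_irr i; rewrite /d; case: (size _) => [|[]]. Qed.

(** The first row of the block [i] of a point of the torus lists the
    coefficients of a polynomial modulo [mu i]; evaluating it at a root of [mu
    i] gives an eigenvalue, as a linear function of the point. *)
Definition torus_eigenvalue i (a : algC) (g : 'M[algC]_(torus_dim mu)) : algC :=
  \sum_(c < d i) submxblock (p_ := d) (q_ := d) g i i (Ordinal (d_gt0 i)) c * a ^+ c.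

Lemma poly_fun_torus_eigenvalue i a : poly_fun (torus_eigenvalue i a).
Proof.
apply: poly_fun_sum => c; apply: poly_funM (poly_fun_const _ _).
pose rk (e : 'I_(d i)) : 'I_(torus_dim mu) := @tagnat.Rank m d i e.
apply: (@eq_poly_fun _ _ (fun g => g (rk (Ordinal (d_gt0 i))) (rk c))) => [g|].
  by rewrite mxE.
exact: poly_fun_entry.
Qed.

Lemma torus_eigenvalueE p i a : root (ratpC (mu i)) a ->
  torus_eigenvalue i a (map_mx ratr (torus_mx mu p)) = (ratpC (p i)).[a].
Proof.
move=> ra.
transitivity (ratpC (p i %% mu i)).[a]; last first.
  by rewrite {2}(divp_eq (p i) (mu i)) rmorphD rmorphM /= !hornerE (rootP ra) mulr0 add0r.
rewrite (@horner_coef_wide _ (d i)); last first.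
  rewrite size_map_poly /d -ltnS prednK ?ltn_modp ?irredp_neq0 //.
  by rewrite size_poly_gt0 irredp_neq0.
apply: eq_bigr => c _; congr (_ * _).
have := submxblock_diag (fun j => mulmodp_mx (d j) (map_poly ratr (mu j)) (p j)) i.
move/matrixP/(_ (Ordinal (d_gt0 i)) c); rewrite !mxE coef_map /= => ->.
by rewrite mulr1 map_ratr_id.
Qed.

(** A relation between the eigenvalues is a polynomial equation, with
    algebraic coefficients, that all powers of [lambda] satisfy; so all points
    of S do, by [descent]. *)
Lemma S_integral_relations x : S_integral mu lambda x ->
  exists p : 'I_m -> {poly rat}, (forall i, x i = (ratpC (p i)).[lambda i]) /\
  forall (I : finType) (idx : I -> 'I_m) (a : I -> algC),
    (forall k, root (ratpC (mu (idx k))) (a k)) ->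
    forall c : I -> int, \prod_k a k ^ c k = 1 ->
      \prod_k (ratpC (p (idx k))).[a k] ^ c k = 1.
Proof.
case=> xT [g [p [xp gE]] [_ [_ gS]]]; exists p; split=> // I idx a ra c ac.
have root0 i b : root (ratpC (mu i)) b -> b != 0.
  apply: contraTneq => ->; have := mu0 i.
  by rewrite -(rmorph0 (ratr : {rmorphism rat -> algC})) fmorph_root.
have x0 k : (ratpC (p (idx k))).[a k] != 0.
  apply: conj_neq0 (mu_irr _) (lambda_root _) _ _ (ra k) _.
  by rewrite -xp; have [] := xT (idx k).
apply/(prod_exprz_split c x0).
pose mono (s : I -> nat) (h : 'M[algC]_(torus_dim mu)) :=
  \prod_k torus_eigenvalue (idx k) (a k) h ^+ s k.
have pmono s : poly_fun (mono s) by apply: poly_fun_prod => k;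
  apply/poly_funX/poly_fun_torus_eigenvalue.
have monoE s q : mono s (map_mx ratr (torus_mx mu q)) =
  \prod_k (ratpC (q (idx k))).[a k] ^+ s k.
  by apply: eq_bigr => k _; rewrite torus_eigenvalueE.
pose s1 k := absz (Num.max (c k) 0); pose s2 k := absz (Num.max (- c k) 0).
rewrite -(monoE s1) -(monoE s2) -gE; apply/eqP; rewrite -subr_eq0; apply/eqP.
refine (@descent _ _ (@cyclic_lambda m mu lambda) (map_mx ratr g)
  (poly_funB (pmono s1) (pmono s2)) _ _).
- move=> _ [z [q [qz ->]]]; apply/eqP; rewrite subr_eq0 !monoE; apply/eqP.
  have qa k : (ratpC (q (idx k))).[a k] = a k ^ z.
    have l0 : lambda (idx k) != 0 := root0 _ _ (lambda_root _).
    case: z qz => n qz.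
      have := @conj_val _ _ (mu_irr (idx k)) (lambda_root _) (q (idx k)) 'X^n _ (ra k).
      by rewrite map_polyXn !hornerXn -qz; apply.
    have := @conj_val _ _ (mu_irr (idx k)) (lambda_root _) (q (idx k) * 'X^(n.+1))%R 1%R
      _ (ra k).
    rewrite rmorphM rmorph1 /= map_polyXn !hornerE -qz NegzE -exprnN.
    rewrite mulVf ?expf_neq0 // => /(_ erefl) e.
    by apply: (mulIf (expf_neq0 n.+1 (root0 _ _ (ra k)))); rewrite e mulVf //
      expf_neq0 // (root0 _ _ (ra k)).
  have az k : a k ^ z != 0 by rewrite expfz_neq0 // (root0 _ _ (ra k)).
  under eq_bigr do rewrite qa; under [RHS]eq_bigr do rewrite qa.
  apply/(prod_exprz_split c az).
  by rewrite prod_exprz ac exp1rz.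
- by move=> q qH; rewrite mpoly_eval_ratr gS ?rmorph0.
Qed.

End TorusRelations.

(** * The matrices that realize an element of S(Z) *)

Lemma map_int_rat_alg k l (M : 'M[int]_(k, l)) :
  map_mx ratr (map_mx intr M : 'M[rat]_(k, l)) = map_mx intr M :> 'M[algC]_(k, l).
Proof. by apply/matrixP => i j; rewrite !mxE ratr_int. Qed.

Lemma unitmx_map_int (F : fieldType) n (M : 'M[int]_n) :
  M \in unitmx -> (map_mx intr M : 'M[F]_n) \in unitmx.
Proof.
move=> uM; have inv : map_mx intr M *m map_mx intr (invmx M) = 1%:M :> 'M[F]_n.
  by rewrite -map_mxM mulmxV // map_mx1.
exact: (proj1 (mulmx1_unit inv)).
Qed.

Section Spectral.
Variables (n : nat) (A : 'M[int]_n.+1).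
Hypothesis hA : A \in unitmx.
Hypothesis hyp : hyperbolic A.
Hypothesis ss : semisimple A.
Variables (m : nat) (mu : 'I_m -> {poly rat}) (e : 'I_m -> nat).
Hypothesis mu_irr : forall i, irreducible_poly (mu i).
Hypothesis e_gt0 : forall i, (0 < e i)%N.
Hypothesis char_fact : map_poly intr (char_poly A) = \prod_(i < m) mu i ^+ e i.
Variable lambda : 'I_m -> algC.
Hypothesis lambda_root : forall i, root (ratpC (mu i)) (lambda i).

Let AQ : 'M[rat]_n.+1 := map_mx intr A.
Let AC : 'M[algC]_n.+1 := map_mx intr A.

Lemma char_poly_AQ : char_poly AQ = \prod_(i < m) mu i ^+ e i.
Proof. by rewrite -map_char_poly. Qed.

Lemma AC_AQ : AC = map_mx ratr AQ.
Proof. by rewrite map_int_rat_alg. Qed.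

Lemma char_poly_AC : char_poly AC = ratpC (char_poly AQ).
Proof. by rewrite AC_AQ -map_char_poly. Qed.

Lemma mu_dvd_char i : mu i %| char_poly AQ.
Proof.
rewrite char_poly_AQ (bigD1 i) //= dvdp_mulr // -(prednK (e_gt0 i)) exprS.
exact: dvdp_mulr.
Qed.

Lemma root_char_poly0 (F : fieldType) N (M : 'M[F]_N) :
  M \in unitmx -> ~~ root (char_poly M) 0.
Proof.
rewrite /root horner_coef0 char_poly_det.
by rewrite unitmxE unitfE mulf_eq0 signr_eq0.
Qed.

Lemma unit_AQ : AQ \in unitmx.
Proof. exact: unitmx_map_int. Qed.

Lemma mu_root0 i : ~~ root (mu i) 0.
Proof.
apply: contra (root_char_poly0 unit_AQ); rewrite -!dvdp_XsubCl => /dvdp_trans; apply.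
exact: mu_dvd_char.
Qed.

Lemma root_mu_AC i a : root (ratpC (mu i)) a -> root (char_poly AC) a.
Proof.
rewrite char_poly_AC -!dvdp_XsubCl => /dvdp_trans; apply.
by rewrite dvdp_map mu_dvd_char.
Qed.

Lemma root_AC_mu a : root (char_poly AC) a -> exists i, root (ratpC (mu i)) a.
Proof.
rewrite char_poly_AC char_poly_AQ rmorph_prod /root horner_prod => /prodf_eq0[i _].
by rewrite rmorphXn /= horner_exp expf_eq0 => /andP[_ h]; exists i.
Qed.

Lemma lambda_neq0 i : lambda i != 0.
Proof.
apply: contraTneq (lambda_root i) => ->; have := mu_root0 i.
by rewrite -(rmorph0 (ratr : {rmorphism rat -> algC})) fmorph_root.
Qed.

(** [d0] and [B0] are the values of the same rational polynomial at the
    semisimple part of [t] and at [A]; on the eigenvalues it agrees with a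
    homomorphism that sends each conjugate of [lambda l] to a power of that of
    [x l]. *)
Lemma compatible_units N (t : 'M[rat]_N.+1) x : t \in unitmx -> S_integral mu lambda x ->
  exists K (R : algC -> algC -> Prop) (d0 : 'M[rat]_N.+1) (B0 : 'M[rat]_n.+1),
  [/\ (0 < K)%N /\ partial_hom R,
   forall j, specializes_mx (ph_pow R j) (fun k =>
     map_mx ratr t ^+ k) (map_mx ratr (d0 ^+ j)) /\
             specializes_mx (ph_pow R j) (fun k => AC ^+ k) (map_mx ratr (B0 ^+ j)),
   d0 \in unitmx,
   (exists2 j, (0 < j)%N & integral_mx (d0 ^+ j) /\ integral_mx (d0^-1 ^+ j)) /\
   (exists2 j, (0 < j)%N & integral_mx (B0 ^+ j))
   & forall l (v : 'rV_n.+1), v *m AC = lambda l *: v ->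
       v *m map_mx ratr B0 = (x l ^+ K) *: v].
Proof.
move=> ut Sx; have [p [xp prel]] := S_integral_relations mu_irr mu_root0 lambda_root Sx.
have xT := Sx.1.
have prod0 : char_poly t * char_poly AQ != 0.
  by rewrite mulf_neq0 ?monic_neq0 ?char_poly_monic.
have [f [sepf fdvd [kf dvdf]]] := radical_poly prod0.
have [rs rsE] := closed_field_poly_normal (ratpC f).
have f0 := separable_poly_neq0 sepf.
have frs : ratpC f %= \prod_(r <- rs) ('X - r%:P).
  by rewrite {1}rsE eqp_scale // lead_coef_eq0 map_poly_eq0.
have rs_root a : (a \in rs) = root (ratpC f) a by rewrite (eqp_root frs) root_prod_XsubC.
have us : uniq rs by rewrite -separable_prod_XsubC -(eqp_separable frs) separable_map.
have rs0 : 0 \notin rs.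
  rewrite rs_root -(rmorph0 (ratr : {rmorphism rat -> algC})) fmorph_root.
  have : ~~ root (char_poly t * char_poly AQ) 0.
    by rewrite rootM negb_or !root_char_poly0 // unit_AQ.
  by apply: contra; rewrite -!dvdp_XsubCl => /dvdp_trans; apply.
have mu_rs i a : root (ratpC (mu i)) a -> a \in rs.
  move=> ra; rewrite rs_root.
  have : root (ratpC (f ^+ kf)) a.
    move: ra; rewrite -!dvdp_XsubCl => /dvdp_trans; apply; rewrite dvdp_map.
    apply: dvdp_trans (mu_dvd_char i) _; apply: dvdp_trans dvdf; exact: dvdp_mull.
  by rewrite rmorphXn /root horner_exp expf_eq0 => /andP[].
pose I := {k : 'I_m * 'I_(size rs) | root (ratpC (mu k.1)) rs`_k.2}.
pose a (k : I) : algC := rs`_(val k).2.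
pose idx (k : I) := (val k).1.
have ra k : root (ratpC (mu (idx k))) (a k) by exact: valP k.
have a0 k : a k != 0.
  by apply: contraNneq rs0 => <-; apply: mu_rs (ra k).
pose y k := (ratpC (p (idx k))).[a k].
have yU k : alg_unit (y k) /\ y k != 0.
  have [_ x0 x1 x2] := xT (idx k).
  by apply: (conj_alg_unit (mu_irr _) (lambda_root _) (ra k)); rewrite -xp.
pose R0 := gen_rel a y.
have hR0 : partial_hom R0.
  apply: gen_relP => // [k|c]; first by have [] := yU k.
  exact: prel.
have R0U := gen_rel_in (a := a) alg_unit_closed (fun k => (yU k).1).
pose D q b := exists i, q = p i /\ root (ratpC (mu i)) b.
have [|||K [g [R [K0 hR Rg gU gD]]]] := equivariant_unit_extension sepf frs rs0 hR0 R0U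
  (D := D).
- by move=> q b [i [_ /mu_rs]].
- move=> q b [i [-> rb]] nu; exists i; split=> //.
  rewrite -(fmorph_root nu) -map_poly_comp in rb.
  by rewrite (eq_map_poly (fmorph_eq_rat (nu \o ratr))) in rb.
- move=> q b [i [-> rb]]; have brs := mu_rs _ _ rb.
  have lt : (index b rs < size rs)%N by rewrite index_mem.
  have h : root (ratpC (mu (i, Ordinal lt).1)) rs`_(i, Ordinal lt).2 by rewrite /= nth_index.
  pose k : I := exist _ (i, Ordinal lt) h.
  have ak : a k = b by rewrite /a /= nth_index.
  have := gen_rel_gen a y k; by rewrite /y ak.
have [s [fts nilp]] := @jordan_chevalley _ _ t f kf sepf (dvdp_trans (dvdp_mulr _ (dvdpp
  _)) dvdf).
set ts := horner_mx t s in fts nilp.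
have hornerC N' (M : 'M[rat]_N'.+1) : horner_mx M f = 0 ->
    horner_mx (map_mx ratr M : 'M[algC]_N'.+1) (\prod_(r <- rs) ('X - r%:P)) = 0.
  move=> Mf; have : horner_mx (map_mx ratr M : 'M[algC]_N'.+1) (ratpC f) = 0.
    by rewrite -map_horner_mx Mf map_mx0.
  rewrite rsE horner_mxZ => /eqP; rewrite scaler_eq0 lead_coef_eq0 map_poly_eq0.
  by rewrite (negPf f0) => /eqP.
have [P1 [a1 [uP1 tsE a1rs]]] := diagonalize us (hornerC _ _ fts).
have [P2 [a2 [uP2 ACE ev2 _]]] := hyperbolic_diag hyp ss.
have a2rs i : a2 0 i \in rs.
  have := ev2 i; rewrite eigenvalue_root_char => /root_AC_mu[l]; exact: mu_rs.
pose d0 := horner_mx ts g; pose B0 := horner_mx AQ g.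
have gE N' (M : 'M[rat]_N'.+1) P (b : 'rV[algC]_N'.+1) : P \in unitmx ->
    map_mx ratr M = invmx P *m diag_mx b *m P ->
    map_mx ratr (horner_mx M g) = invmx P *m diag_mx (map_mx (horner (ratpC g)) b) *m P.
  by move=> uP ME; rewrite map_horner_mx ME horner_mx_uconjC // horner_mx_diag.
have d0E := gE _ _ _ _ uP1 tsE.
have B0E : map_mx ratr B0 = _ := gE _ AQ _ _ uP2 (etrans (esym AC_AQ) ACE).
have g0 b : b \in rs -> (ratpC g).[b] != 0.
  by move=> /Rg/(ph_neq0 hR)[].
have ipow N' (M : 'M[rat]_N'.+1) P (b : 'rV[algC]_N'.+1) : P \in unitmx ->
    map_mx ratr M = invmx P *m diag_mx b *m P -> (forall i, b 0 i \in rs) ->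
    exists2 j,
      (0 < j)%N & integral_mx (horner_mx M g ^+ j) /\ integral_mx ((horner_mx M g)^-1 ^+ j).
  move=> uP ME brs; apply: (integral_power uP (gE _ _ _ _ uP ME)) => i; rewrite mxE.
    exact/gU/brs.
  exact/g0/brs.
have powE N' (M : 'M[rat]_N'.+1) P (b : 'rV[algC]_N'.+1) j : P \in unitmx ->
    map_mx ratr M = invmx P *m diag_mx b *m P ->
    map_mx ratr (horner_mx M g ^+ j) =
    invmx P *m diag_mx (\row_i (ratpC g).[b 0 i] ^+ j) *m P.
  move=> uP ME; rewrite rmorphXn /= (gE _ _ _ _ uP ME) conj_diagX //.
  by congr (_ *m diag_mx _ *m _); apply/rowP => i; rewrite !mxE.
exists K, R, d0, B0; split=> //.
- move=> j; have hRj := ph_powP j hR.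
  have Rgj b : b \in rs -> ph_pow R j b ((ratpC g).[b] ^+ j).
    by move=> brs; exists (ratpC g).[b] => //; apply: Rg.
  split; last first.
    rewrite (powE _ _ _ _ j uP2 (etrans (esym AC_AQ) ACE)) /AC ACE.
    by apply: specializes_powers_diag => // i; rewrite mxE; apply: Rgj.
  rewrite (powE _ _ _ _ j uP1 tsE).
  have cts : GRing.comm ts (t - ts).
    apply: commrB => //; rewrite /ts -{2}[t]horner_mx_X; exact: comm_horner_mx2.
  apply: (@eq_specializes_mx _ _ _ _ (fun k => (map_mx ratr ts + map_mx ratr (t - ts)) ^+ k)).
    by move=> k; rewrite -map_mxD addrC subrK.
  apply: (specializes_powers hRj (r := kf) uP1 tsE) => [i||].
  - by rewrite mxE; apply: Rgj.
  - by rewrite /GRing.comm -!mulmxE -!map_mxM !mulmxE cts.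
  - by rewrite -rmorphXn nilp rmorph0.
- rewrite -(map_unitmx (ratr : {rmorphism rat ->
  algC})) /= d0E !unitmx_mul unitmx_inv uP1 /= andbT.
  rewrite unitmxE det_diag unitfE prodf_seq_neq0; apply/allP => i _ /=; rewrite mxE.
  exact/g0/a1rs.
- split; first exact: ipow uP1 tsE a1rs.
  by have [j j0 [h _]] := ipow _ _ _ _ uP2 (etrans (esym AC_AQ) ACE) a2rs; exists j.
move=> l v vl; rewrite map_horner_mx -AC_AQ (eigen_horner _ vl).
by rewrite xp -(gD (p l) (lambda l)) //; exists l.
Qed.

End Spectral.

(** * Arithmetic groups: powers of elements of S(Z) *)

Lemma seq_pigeonhole (T : eqType) (s : seq T) (Q : nat -> T -> Prop) :
  (forall k, exists2 r, r \in s & Q k r) ->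
  exists k l r, [/\ (k < l)%N, r \in s, Q k r & Q l r].
Proof.
move=> h; have [f fP] : exists f : 'I_(size s).+1 -> T, forall k, f k \in s /\ Q k (f k).
  apply: (@fin_all_exists _ (fun _ => T) (fun (k : 'I_(size s).+1) r =>
    r \in s /\ Q k r)) => k.
  by have [r rs Qr] := h k; exists r.
have lt k : (index (f k) s < size s)%N by rewrite index_mem; case: (fP k).
pose g k : 'I_(size s) := Ordinal (lt k).
have /injectivePn[k [l ne fkl]] : ~~ injectiveb g.
  by apply/negP => /injectiveP/leq_card; rewrite !card_ord ltnn.
have {}fkl : f k = f l.
  have := congr1 val fkl => /= e.
  by rewrite -[LHS](nth_index (f k) (fP k).1) e nth_index //; case: (fP l).
have [ltkl|ltlk|eq] := ltngtP k l.
- by exists k, l, (f k); split; [|case: (fP k)|case: (fP k)|rewrite fkl; case: (fP l)].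
- by exists l, k, (f k); split; [|case: (fP k)|rewrite fkl; case: (fP l)|case: (fP k)].
- by case/eqP: ne; apply: val_inj.
Qed.

Section Arithmetic.
Variables (n : nat) (A : 'M[int]_n.+1) (hA : A \in unitmx).
Hypothesis hyp : hyperbolic A.
Hypothesis ss : semisimple A.
Variables (m : nat) (mu : 'I_m -> {poly rat}) (e : 'I_m -> nat).
Hypothesis mu_irr : forall i, irreducible_poly (mu i).
Hypothesis e_gt0 : forall i, (0 < e i)%N.
Hypothesis char_fact : map_poly intr (char_poly A) = \prod_(i < m) mu i ^+ e i.
Variable lambda : 'I_m -> algC.
Hypothesis lambda_root : forall i, root (ratpC (mu i)) (lambda i).

Lemma eigenvector_exists l : exists2 v : 'rV[algC]_n.+1,
  v *m map_mx intr A = lambda l *: v & v != 0.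
Proof.
by apply/eigenvalueP; rewrite eigenvalue_root_char; apply: root_mu_AC (lambda_root l).
Qed.

Lemma eigenvector_expz (M : 'M[int]_n.+1) (v : 'rV[algC]_n.+1) c (z : int) :
  M \in unitmx -> v *m map_mx intr M = c *: v -> c != 0 ->
  v *m map_mx intr (M ^ z) = c ^ z *: v.
Proof.
move=> uM vM c0; have hX (k : nat) : v *m map_mx intr (M ^+ k) = c ^+ k *: v.
  elim: k => [|k IH]; first by rewrite map_mx1 mulmx1 scale1r.
  by rewrite exprS -mulmxE map_mxM mulmxA vM -scalemxAl IH scalerA -exprS.
case: z => k; first exact: hX.
rewrite NegzE -!exprnN.
have uMk : M ^+ k.+1 \in unitmx by apply: unitrX.
have h : v = c ^+ k.+1 *: (v *m map_mx intr (M ^- k.+1)).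
  have := congr1 (mulmx^~ (map_mx intr (M ^- k.+1))) (hX k.+1).
  rewrite /= -scalemxAl => <-.
  by rewrite -mulmxA -map_mxM mulmxV // map_mx1 mulmx1.
by rewrite [in RHS]h scalerA mulVf ?expf_neq0 // scale1r.
Qed.

(** Some power [J] of [d0] is [phi (y0, i)]. Conjugation by it acts on the
    translations as [A ^ i] and, through [closure_normalizes], as [B0 ^ J]. *)
Theorem arithmetic_power x : arithmetic (sdprodZ hA) -> S_integral mu lambda x ->
  exists (J : nat) (i : int), (0 < J)%N /\ forall l, x l ^+ J = lambda l ^ i.
Proof.
case=> [[|N]] [Iq [phi [_ phiG phiM phi_inj [_ [_ [s [sK sP]]]]]]] Sx.
  have : phi (0, 1) = phi (0, 0) by rewrite [LHS]flatmx0 [RHS]flatmx0.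
  by move/phi_inj.
have uphi g : phi g \in unitmx by case: (phiG g).
have phi1 : phi (0, 0) = 1%:M.
  have h : phi (0, 0) *m phi (0, 0) = phi (0, 0).
    by rewrite -phiM; congr phi; apply: (mulg1 (1 : sdprodZ hA)%g).
  by have := congr1 (mulmx (invmx (phi (0, 0)))) h; rewrite mulKmx // mulVmx.
pose U x : 'M[rat]_N.+1 := phi (x, 0).
pose t := phi (0, 1).
have UD y z : U (y + z) = U y *m U z.
  rewrite /U -phiM; congr phi; rewrite /mulg /= /sdprodZ_mul /=.
  by rewrite expr0z mul1mx addr0.
have pU y z i : phi (z, i) *m U y = U (A ^ i *m y) *m phi (z, i).
  rewrite /U -!phiM; congr phi; rewrite /mulg /= /sdprodZ_mul /=.
  by rewrite expr0z mul1mx addr0 add0r addrC.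
have tU y : t *m U y = U (A *m y) *m t by rewrite pU expr1z.
have tX k : t ^+ k = phi (0, k%:Z).
  elim: k => [|k IH]; first by rewrite expr0 phi1.
  rewrite exprS IH -mulmxE -phiM; congr phi; rewrite /mulg /= /sdprodZ_mul /=.
  by rewrite mulmx0 addr0 intS.
have [M M0 Mnil] := unipotent_multiple hA hyp ss phi1 UD (uphi _) tU.
pose U' y := U (M%:Z *: y).
have U'0 : U' 0 = 1%:M by rewrite /U' scaler0.
have U'D y z : U' (y + z) = U' y *m U' z by rewrite /U' scalerDr UD.
have tU' y : t *m U' y = U' (A *m y) *m t by rewrite /U' tU scalemxAr.
have [K [R [d0 [B0 [[K0 hR] spec ud [[j1 j10 [d1 d1V]] [j2 j20 b2]] ev]]]]] :=
  compatible_units hA hyp ss mu_irr e_gt0 char_fact lambda_root (uphi (0, 1)) Sx.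
have ud0 k : d0 ^+ k \in unitmx by apply: unitrX.
(* The equations of the group hold at [phi (0, k) = t ^ k]. *)
have d0G k : zariski_closed_pts Iq (d0 ^+ k).
  split=> // q Iqq; have hRk := ph_powP k hR.
  apply: (fmorph_inj (ratr : {rmorphism rat -> algC})); rewrite rmorph0 /=.
  rewrite -mpoly_eval_ratr; apply:
    (specializes_eq0 hRk (specializes_eval q hRk (spec k).1)) => l.
  by rewrite -rmorphXn tX mpoly_eval_ratr; case: (phiG (0, l%:Z)) => _ ->; rewrite ?rmorph0.
pose g0 := d0 ^+ (j1 * j2).
have g0K k : integral_pts Iq (g0 ^+ k).
  rewrite /g0 -exprM; split=> //; apply/integral_mxP.
    by rewrite -mulnA exprM; apply: integral_mxX.
  have -> : invmx (d0 ^+ (j1 * j2 * k)) = (d0^-1 ^+ j1) ^+ (j2 * k).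
    by rewrite -exprM mulnA exprVn.
  exact: integral_mxX.
(* Two powers of [g0] in the same coset of the image. *)
have [k [l [r [ltkl rs [[y yE] _] [[z zE] _]]]]] := seq_pigeonhole (fun k => sP _ (g0K k)).
have ur : r \in unitmx by have [[]] := sK _ rs.
have g0E : g0 ^+ (l - k) = phi (y^-1 * z)%g.
  have ug : g0 ^+ k \in unitmx by apply/unitrX/ud0.
  apply: (can_inj (mulKmx ug)); rewrite mulmxE -exprD subnKC 1?ltnW //.
  have -> : g0 ^+ k = r *m phi y by rewrite yE mulKVmx.
  have -> : g0 ^+ l = r *m phi z by rewrite zE mulKVmx.
  by rewrite -mulmxE -mulmxA -phiM mulgA mulgV mul1g.
case: (y^-1 * z)%g g0E => y0 i g0E.
pose J := (j1 * j2 * (l - k))%N.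
have J0 : (0 < J)%N by rewrite !muln_gt0 j10 j20 subn_gt0.
have dJ : d0 ^+ J = phi (y0, i) by rewrite /J exprM.
have [B BE] : integral_mx (B0 ^+ J).
  by rewrite /J [(j1 * j2)%N]mulnC -mulnA exprM; apply: integral_mxX.
have BA : B = A ^ i.
  have h (u : 'cV_n.+1) : B *m u = A ^ i *m u.
    have hRJ := ph_powP J hR; have [tadm Aadm] := spec J.
    have BC : map_mx ratr (B0 ^+ J) = map_mx intr B :> 'M[algC]__.
      by rewrite BE map_int_rat_alg.
    rewrite BC in Aadm.
    have := closure_normalizes U'0 U'D (fun x => Mnil x) tU' hRJ tadm Aadm u.
    rewrite -!map_mxM => /(map_mx_inj (f := ratr : {rmorphism rat -> algC})).
    rewrite dJ /U' pU => /(can_inj (mulmxK (uphi _)))/phi_inj[].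
    rewrite -scalemxAr => /esym/matrixP eq; apply/matrixP => a b.
    have := eq a b; rewrite [LHS]mxE [RHS]mxE.
    by apply/mulfI; rewrite eqz_nat -lt0n.
  apply/matrixP => a b; have /matrixP/(_ a 0) := h (delta_mx b 0).
  by rewrite -!colE !mxE.
exists (K * J)%N, i; split=> [|l']; first by rewrite muln_gt0 K0.
have [v vl v0] := eigenvector_exists l'.
have hB : v *m map_mx ratr (B0 ^+ J) = x l' ^+ (K * J) *: v.
  elim: (J) => [|j IH]; first by rewrite map_mx1 mulmx1 muln0 scale1r.
  by rewrite exprSr -mulmxE map_mxM mulmxA IH -scalemxAl (ev l') // scalerA mulnS addnC exprD.
have hA' := eigenvector_expz i hA vl (lambda_neq0 hA e_gt0 char_fact lambda_root l').
have : x l' ^+ (K * J) *: v = lambda l' ^ i *: v.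
  by rewrite -hB -hA' BE BA map_int_rat_alg.
exact: scaler_cancel v0.
Qed.

End Arithmetic.

(** * The torus as an algebra *)

Section Mxdiag.
Variables (R : pzRingType) (m : nat) (p_ : 'I_m -> nat).

Lemma mul_mxdiag (B C : forall i, 'M[R]_(p_ i)) :
  mxdiag B *m mxdiag C = mxdiag (fun i => B i *m C i).
Proof.
rewrite {2}/mxdiag mul_mxdiag_mxblock; apply/eq_mxblock => i j.
by case: eqP => [->|_]; rewrite ?conform_mx_id ?mulmx0.
Qed.

Lemma mxdiag_scale c (B : forall i, 'M[R]_(p_ i)) :
  mxdiag (fun i => c *: B i) = c *: mxdiag B.
Proof.
rewrite -mul_scalar_mx -(mxdiagZ (p_ := p_)) mul_mxdiag.
by apply: eq_mxdiag => i; rewrite mul_scalar_mx.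
Qed.

End Mxdiag.

Section MulModp.
Variables (F : fieldType) (h : {poly F}).
Let d := (size h).-1.

Lemma poly_rV_mulmodp (r q : {poly F}) : (size r <= d)%N ->
  poly_rV r *m mulmodp_mx d h q = poly_rV ((q * r) %% h) :> 'rV_d.
Proof.
move=> sr.
have rE : r = \sum_(c < d) r`_c *: 'X^c.
  rewrite -(poly_def d (fun c => r`_c)); apply/polyP => c; rewrite coef_poly.
  by case: ltnP => // dc; rewrite nth_default // (leq_trans sr).
have modp_sum (f : 'I_d -> {poly F}) : (\sum_c f c) %% h = \sum_c (f c %% h).
  by apply: (big_morph (fun u => u %% h)) => [u v|]; rewrite ?modpD ?mod0p.
rewrite [in RHS]rE mulr_sumr modp_sum raddf_sum mulmx_sum_row; apply: eq_bigr => c _.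
by rewrite rowK; apply/rowP => l; rewrite !mxE -scalerAr modpZl coefZ.
Qed.

Lemma mulmodp_mxM (p q : {poly F}) : h != 0 ->
  mulmodp_mx d h p *m mulmodp_mx d h q = mulmodp_mx d h (p * q).
Proof.
move=> h0; apply/row_matrixP => j; rewrite row_mul !rowK poly_rV_mulmodp; last first.
  rewrite /d -ltnS prednK ?ltn_modp // size_poly_gt0 //.
by rewrite modp_mul mulrA [q * p]mulrC.
Qed.

Lemma mulmodp_mx_eq1 (p : {poly F}) : h != 0 -> h %| p - 1 -> mulmodp_mx d h p = 1%:M.
Proof.
move=> h0 hp; apply/row_matrixP => j; rewrite rowK row1; apply/rowP => l; rewrite !mxE.
have sX : (size ('X^j : {poly F}) < size h)%N.
  rewrite size_polyXn; have := ltn_ord j; rewrite /d ltn_predRL; exact.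
have -> : (p * 'X^j) %% h = 'X^j.
  rewrite -[p](subrK 1) mulrDl mul1r modpD (modp_small sX).
  by rewrite (_ : _ %% h = 0) ?add0r //; apply/eqP; rewrite -/(h %| _) dvdp_mulr.
by rewrite coefXn ?eqxx ?andTb ?andbT; congr (nat_of_bool _)%:R; rewrite -?val_eqE /= ?andbT.
Qed.

Lemma mulmodp_mxD (p q : {poly F}) :
  mulmodp_mx d h (p + q) = mulmodp_mx d h p + mulmodp_mx d h q.
Proof.
by apply/matrixP => j l; rewrite !mxE mulrDl modpD coefD.
Qed.

Lemma mulmodp_mxZ c (p : {poly F}) : mulmodp_mx d h (c *: p) = c *: mulmodp_mx d h p.
Proof.
by apply/matrixP => j l; rewrite !mxE -scalerAl modpZl coefZ.
Qed.

End MulModp.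

Section TorusMx.
Variables (m : nat) (mu : 'I_m -> {poly rat}).
Hypothesis mu_neq0 : forall i, mu i != 0.

Lemma torus_mxE p : torus_mx mu p = mxdiag (fun i => mulmodp_mx (size (mu i)).-1 (mu i) (p i)).
Proof. by apply: eq_mxdiag => i; rewrite map_ratr_id. Qed.

(** The regular representation is multiplicative, and depends only on the
    classes modulo the [mu i]. *)
Lemma torus_mx_inv (p q : 'I_m -> {poly rat}) :
  (forall i, mu i %| p i * q i - 1) -> torus_mx mu p *m torus_mx mu q = 1%:M.
Proof.
move=> pq; rewrite !torus_mxE mul_mxdiag.
rewrite -[1%:M](mxdiagZ (p_ := fun i => (size (mu i)).-1)); apply: eq_mxdiag => i.
by rewrite mulmodp_mxM // mulmodp_mx_eq1.
Qed.

Lemma torus_mx_linear c (p q : 'I_m -> {poly rat}) :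
  torus_mx mu (fun i => c *: p i + q i) = c *: torus_mx mu p + torus_mx mu q.
Proof.
rewrite !torus_mxE -mxdiag_scale -mxdiagD; apply: eq_mxdiag => i.
by rewrite mulmodp_mxD mulmodp_mxZ.
Qed.

End TorusMx.

Lemma poly_fun_linear (F : fieldType) N (l : 'M[F]_N -> F) :
  (forall c u v, l (c *: u + v) = c * l u + l v) -> poly_fun l.
Proof.
move=> lin; have l0 : l 0 = 0.
  have := lin 1 0 0; rewrite scale1r mul1r add0r => /eqP.
  by rewrite -{1}[l 0]addr0 (inj_eq (addrI _)) eq_sym => /eqP.
have lD u v : l (u + v) = l u + l v by have := lin 1 u v; rewrite scale1r mul1r.
have lZ c u : l (c *: u) = c * l u by have := lin c u 0; rewrite !addr0 l0 addr0.
apply: (@eq_poly_fun _ _ (fun g => \sum_i \sum_j g i j * l (delta_mx i j))) => [g|].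
  rewrite [in RHS](matrix_sum_delta g) (big_morph l lD l0); apply: eq_bigr => i _.
  by rewrite (big_morph l lD l0); apply: eq_bigr => j _; rewrite lZ.
apply: poly_fun_sum => i; apply: poly_fun_sum => j.
by apply: (@poly_funM _ _ (fun g => g i j) (fun _ => _)); [apply: poly_fun_entry|apply:
  poly_fun_const].
Qed.

(** * The Zariski closure of the powers of A *)

Section ClosureOfPowers.
Variables (n : nat) (A : 'M[int]_n.+1).
Hypothesis hA : A \in unitmx.
Variables (m : nat) (mu : 'I_m -> {poly rat}) (e : 'I_m -> nat).
Hypothesis mu_irr : forall i, irreducible_poly (mu i).
Hypothesis e_gt0 : forall i, (0 < e i)%N.
Hypothesis char_fact : map_poly intr (char_poly A) = \prod_(i < m) mu i ^+ e i.
Variable lambda : 'I_m -> algC.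
Hypothesis lambda_root : forall i, root (ratpC (mu i)) (lambda i).
Variables (P : 'M[algC]_n.+1) (a : 'rV[algC]_n.+1).
Hypothesis uP : P \in unitmx.
Hypothesis AE : map_mx intr A = invmx P *m diag_mx a *m P.

Let AQ : 'M[rat]_n.+1 := map_mx intr A.

Lemma diag_neq0 : forall i, a 0 i != 0.
Proof.
have := unitmx_map_int algC hA; rewrite AE !unitmx_mul unitmx_inv uP andbT /=.
rewrite unitmxE det_diag unitfE prodf_seq_neq0 => /allP h i.
by apply: (h i); rewrite mem_index_enum.
Qed.

Lemma AC_expn k : map_mx ratr (AQ ^+ k) = invmx P *m diag_mx (\row_i a 0 i ^+ k) *m P.
Proof. by rewrite rmorphXn /= map_int_rat_alg AE conj_diagX. Qed.

Lemma AC_expz z : map_mx intr (A ^ z) = invmx P *m diag_mx (\row_i a 0 i ^ z) *m P.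
Proof.
have hX (k : nat) : map_mx intr (A ^+ k) = invmx P *m diag_mx (\row_i a 0 i ^ k) *m P.
  by rewrite rmorphXn /= AE conj_diagX.
case: z => k; first exact: hX.
have uAk : A ^+ k.+1 \in unitmx by apply: unitrX.
rewrite NegzE -exprnN.
apply: (can_inj (mulmxK (unitmx_map_int algC uAk))).
rewrite -map_mxM mulVmx // map_mx1 hX !mulmxA mulmxK // -(mulmxA (invmx P)) mulmx_diag.
rewrite (_ : diag_mx _ = 1%:M) ?mulmx1 ?mulVmx //.
apply/matrixP => i j; rewrite !mxE; case: eqP => // _.
by rewrite !mulr1n mulVf // expf_neq0 // diag_neq0.
Qed.

(** The Zariski closure of the powers of [A], described by the characters. *)
Definition power_closure (g : 'M[algC]_n.+1) : Prop := exists w : 'rV[algC]_n.+1,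
  [/\ forall i, w 0 i != 0,
      forall c : 'I_n.+1 -> int, \prod_i a 0 i ^ c i = 1 -> \prod_i w 0 i ^ c i = 1
    & g = invmx P *m diag_mx w *m P].

Lemma power_closure_expz z : power_closure (map_mx intr (A ^ z)).
Proof.
exists (\row_i a 0 i ^ z); split; last exact: AC_expz.
  by move=> i; rewrite mxE expfz_neq0 // diag_neq0.
by move=> c ac; under eq_bigr do rewrite mxE; rewrite prod_exprz ac exp1rz.
Qed.

Lemma power_closure_mul g h : power_closure g -> power_closure h -> power_closure (g *m h).
Proof.
move=> [w [w0 wr ->]] [w' [w'0 w'r ->]]; exists (\row_i (w 0 i * w' 0 i)); split.
- by move=> i; rewrite mxE mulf_neq0.
- move=> c ac; under eq_bigr do rewrite mxE expfzMl.
  by rewrite big_split /= wr // w'r // mulr1.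
- by rewrite !mulmxA mulmxK // -(mulmxA (invmx P) (diag_mx w)) mulmx_diag.
Qed.

Lemma power_closure_inv g : power_closure g -> exists2 h, power_closure h & h *m g = 1%:M.
Proof.
move=> [w [w0 wr ->]]; exists (invmx P *m diag_mx (\row_i (w 0 i)^-1) *m P).
  exists (\row_i (w 0 i)^-1); split=> // [i|c ac]; first by rewrite mxE invr_eq0.
  under eq_bigr do rewrite mxE exprz_inv -invr_expz.
  by rewrite prodfV wr // invr1.
rewrite !mulmxA mulmxK // -(mulmxA (invmx P)) mulmx_diag.
rewrite (_ : diag_mx _ = 1%:M) ?mulmx1 ?mulVmx //.
by apply/matrixP => i j; rewrite !mxE; case: eqP => // _; rewrite !mulr1n mulVf.
Qed.

Lemma power_closure_unit g : power_closure g -> g \in unitmx.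
Proof. by move=> /power_closure_inv[h _ /mulmx1_unit[]]. Qed.

Lemma power_closure_invmx g : power_closure g -> power_closure (invmx g).
Proof.
move=> Hg; have [h Hh hg] := power_closure_inv Hg.
by rewrite -[invmx g]mul1mx -hg mulmxK // power_closure_unit.
Qed.

(** An equation satisfied by [A ^ k] for all natural [k] is an identity
    between exponential polynomials in the [a_i], and it specializes to the
    [w_i]. *)
Lemma power_closure_eval (q : {mpoly rat[n.+1 * n.+1]}) g :
  (forall k, mpoly_eval_mx q (AQ ^+ k) = 0) -> power_closure g -> mpoly_eval_mx q g = 0.
Proof.
move=> q0 [w [w0 wr ->]].
have hR := gen_relP (a := fun i => a 0 i) diag_neq0 w0 wr.
have gadm := specializes_powers_diag hR uP (gen_rel_gen (fun i => a 0 i) (fun i => w 0 i)).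
apply: (specializes_eq0 hR (specializes_eval q hR gadm)) => k.
by rewrite -AE -map_int_rat_alg -rmorphXn /= mpoly_eval_ratr q0 rmorph0.
Qed.

(** Being diagonal in the basis [P], and satisfying the relations, are
    polynomial conditions with algebraic coefficients that hold at the powers
    of [A]. *)
Lemma power_closureP g : g \in unitmx ->
  (forall q : {mpoly rat[n.+1 * n.+1]}, (forall k, mpoly_eval_mx q (AQ ^+ k) = 0) ->
    mpoly_eval_mx q g = 0) -> power_closure g.
Proof.
move=> ug gq; pose H (h : 'M[rat]_n.+1) := exists k, h = AQ ^+ k.
have gH f : poly_fun f -> (forall k, f (map_mx ratr (AQ ^+ k)) = 0) -> f g = 0.
  move=> pf fH; refine (@descent _ f H g pf _ _); first by move=> _ [k ->].
  by move=> q qH; apply: gq => k; apply: qH; exists k.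
pose w : 'rV_n.+1 := \row_i (P *m g *m invmx P) i i.
have PgP : P *m g *m invmx P = diag_mx w.
  apply/matrixP => i j; rewrite [RHS]mxE [w 0 _]mxE; case: eqP => [->|/eqP ne].
    by rewrite mulr1n.
  rewrite mulr0n; apply: (gH (fun g => (P *m g *m invmx P) i j)); first exact: poly_fun_mulmx.
  by move=> k; rewrite AC_expn !mulmxA mulmxV // mul1mx mulmxK // mxE (negPf ne) mulr0n.
have gE : g = invmx P *m diag_mx w *m P.
  by rewrite -PgP !mulmxA mulVmx // mul1mx mulmxKV.
have w0 i : w 0 i != 0.
  have : diag_mx w \in unitmx by rewrite -PgP !unitmx_mul unitmx_inv uP ug.
  rewrite unitmxE det_diag unitfE prodf_seq_neq0 => /allP h.
  by apply: (h i); rewrite mem_index_enum.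
exists w; split=> // c ac; apply/(prod_exprz_split c w0).
pose s1 k := absz (Num.max (c k) 0); pose s2 k := absz (Num.max (- c k) 0).
pose mono (s : 'I_n.+1 -> nat) (h : 'M[algC]_n.+1) := \prod_k (P *m h *m invmx P) k k ^+ s k.
have pmono s : poly_fun (mono s) by apply: poly_fun_prod => k; apply/poly_funX/poly_fun_mulmx.
have monoE s : mono s g = \prod_k w 0 k ^+ s k by apply: eq_bigr => k _; rewrite [w 0 _]mxE.
rewrite -(monoE s1) -(monoE s2); apply/eqP; rewrite -subr_eq0; apply/eqP.
apply: (gH _ (poly_funB (pmono s1) (pmono s2))) => k.
have monoA s : mono s (map_mx ratr (AQ ^+ k)) = \prod_i (a 0 i ^ k) ^+ s i.
  apply: eq_bigr => i _; congr (_ ^+ _).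
  by rewrite AC_expn !mulmxA mulmxV // mul1mx mulmxK // !mxE eqxx mulr1n.
rewrite !monoA; apply/eqP; rewrite subr_eq0; apply/eqP.
have az i : a 0 i ^ k != 0 by rewrite expfz_neq0 // diag_neq0.
apply/(prod_exprz_split c az).
by rewrite prod_exprz ac exp1rz.
Qed.

Lemma eigen_horner_rat (p : {poly rat}) (v : 'rV[algC]_n.+1) c :
  v *m map_mx intr A = c *: v -> v *m map_mx ratr (horner_mx AQ p) = (ratpC p).[c] *: v.
Proof. by move=> vA; rewrite map_horner_mx map_int_rat_alg; apply: eigen_horner. Qed.

Lemma eigenvalue_Aint (B : 'M[int]_n.+1) (v : 'rV[algC]_n.+1) c :
  v *m map_mx intr B = c *: v -> v != 0 -> c \in Aint.
Proof.
move=> vB v0; apply: (@root_monic_Aint (char_poly (map_mx intr B))).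
- by rewrite -eigenvalue_root_char; apply/eigenvalueP; exists v.
- exact: char_poly_monic.
- by rewrite -map_char_poly; apply/polyOverP => i; rewrite coef_map /= rpred_int_num.
Qed.

(** Membership in the span of the powers of [A] is given by rational linear
    equations. *)
Lemma power_closure_horner (g : 'M[rat]_n.+1) : power_closure (map_mx ratr g) ->
  horner_mx AQ (mx_inv_horner AQ g) = g.
Proof.
move=> Hg; apply: mx_inv_hornerK.
set Ad := powers_mx _ _.
rewrite submxE; apply/eqP/rowP => j; rewrite [RHS]mxE.
have [q qE] : poly_fun (fun h : 'M[rat]_n.+1 => (mxvec h *m cokermx Ad) 0 j).
  by apply: poly_fun_linear => c u v; rewrite linearP mulmxDl -scalemxAl !mxE.
rewrite qE -mpoly_eval_rat; apply: (fmorph_inj (ratr : {rmorphism rat -> algC})).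
rewrite rmorph0 /= -mpoly_eval_ratr; apply: power_closure_eval Hg => k.
rewrite mpoly_eval_rat -qE.
have : (AQ ^+ k \in Ad)%MS.
  have := horner_mx_mem AQ 'X^k; by rewrite rmorphXn /= horner_mx_X.
by rewrite submxE => /eqP ->; rewrite mxE.
Qed.

(** The linear map that sends [p(A)] to the multiplication by [p] on the
    F[X]/(mu_i) carries the powers of [A] to those of [lambda]; so it carries
    the equations of S to equations of the closure of the powers of [A]. *)
Lemma S_integral_power_closure (B : 'M[int]_n.+1) : B \in unitmx ->
  power_closure (map_mx intr B) ->
  S_integral mu lambda (fun l => (ratpC (mx_inv_horner AQ (map_mx intr B))).[lambda l]).
Proof.
move=> uB HB; set p := mx_inv_horner _ _.
have pE : horner_mx AQ p = map_mx intr B by apply: power_closure_horner;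
  rewrite map_int_rat_alg.
have HBV : power_closure (map_mx intr (invmx B)).
  have := power_closure_invmx HB; congr power_closure; have uC := power_closure_unit HB.
  apply: (can_inj (mulmxK uC)); rewrite mulVmx // -map_mxM mulVmx // map_mx1 //.
set q := mx_inv_horner AQ (map_mx intr (invmx B)).
have qE : horner_mx AQ q = map_mx intr (invmx B) by apply: power_closure_horner;
  rewrite map_int_rat_alg.
have ev l : exists2 v : 'rV[algC]_n.+1, v *m map_mx intr A = lambda l *: v & v != 0.
  exact: eigenvector_exists e_gt0 char_fact lambda lambda_root l.
have pq l : (ratpC p).[lambda l] * (ratpC q).[lambda l] = 1.
  have [v vA v0] := ev l; have := eigen_horner_rat p vA; have := eigen_horner_rat q vA.
  rewrite pE qE !map_int_rat_alg => vq vp.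
  have : ((ratpC p).[lambda l] * (ratpC q).[lambda l]) *: v = 1 *: v.
    by rewrite -scalerA -vq scalemxAl -vp -mulmxA -map_mxM mulmxV // map_mx1 mulmx1 scale1r.
  exact: scaler_cancel v0.
have mu_neq0 i : mu i != 0 by apply: irredp_neq0.
split.
  move=> l; have [v vA v0] := ev l.
  have p0 : (ratpC p).[lambda l] != 0.
    by apply: contraTneq (oner_neq0 algC) => pl; rewrite -(pq l) pl mul0r eqxx.
  split=> //; first by exists p.
    have := eigen_horner_rat p vA; rewrite pE map_int_rat_alg => h; exact:
      eigenvalue_Aint h v0.
  have -> : (ratpC p).[lambda l]^-1 = (ratpC q).[lambda l].
    by apply: (mulfI p0); rewrite pq mulfV.
  have := eigen_horner_rat q vA; rewrite qE map_int_rat_alg => h; exact: eigenvalue_Aint h v0.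
exists (torus_mx mu (fun=> p)); first by exists (fun=> p).
have up : torus_mx mu (fun=> p) \in unitmx.
  have inv : torus_mx mu (fun=> p) *m torus_mx mu (fun=> q) = 1%:M.
    apply: torus_mx_inv => // i; apply: irr_dvd (mu_irr i) (lambda_root i) _ _.
    by rewrite /root rmorphB rmorphM rmorph1 /= !hornerE pq subrr.
  exact: (proj1 (mulmx1_unit inv)).
split; first by split=> //; exists (fun=> p).
split=> // Q Q0.
have [tor torE] : exists tor : 'M[rat]_n.+1 -> 'M[rat]_(torus_dim mu),
    forall g, tor g = torus_mx mu (fun=> mx_inv_horner AQ g) by eexists.
have tor_lin c u v : tor (c *: u + v) = c *: tor u + tor v.
  have lin : mx_inv_horner AQ (c *: u + v) =
      c *: mx_inv_horner AQ u + mx_inv_horner AQ v by rewrite /mx_inv_horner linearP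
        mulmxDl -scalemxAl linearP.
  by rewrite !torE lin torus_mx_linear.
have [Q' Q'E] : poly_fun (fun g => mpoly_eval_mx Q (tor g)).
  apply: (@eq_poly_fun _ _ (fun g => Q.@[fun k => mxvec (tor g) 0 k])).
    by move=> g; rewrite mpoly_eval_rat.
  apply: poly_fun_comp => k; case/mxvec_indexP: k => i j.
  apply: (@eq_poly_fun _ _ (fun g => tor g i j)) => [g|]; first by rewrite mxvecE.
  apply: (@poly_fun_linear _ _ (fun g => tor g i j)) => c u v.
  by rewrite tor_lin !mxE.
rewrite -torE Q'E -mpoly_eval_rat.
apply: (fmorph_inj (ratr : {rmorphism rat -> algC})).
rewrite rmorph0 /= -mpoly_eval_ratr map_int_rat_alg; apply: power_closure_eval HB => k.
rewrite mpoly_eval_rat -Q'E torE; apply: Q0; exists k, (fun=> mx_inv_horner AQ (AQ ^+ k)).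
split=> // l; have [v vA v0] := ev l.
have := eigen_horner_rat (mx_inv_horner AQ (AQ ^+ k)) vA.
rewrite power_closure_horner; last first.
  by rewrite rmorphXn /= map_int_rat_alg -rmorphXn; apply: (power_closure_expz k).
have -> : map_mx ratr (AQ ^+ k) = map_mx intr (A ^ k) :> 'M[algC]_n.+1.
  by rewrite -map_int_rat_alg [in RHS]rmorphXn.
rewrite (eigenvector_expz k hA vA (lambda_neq0 hA e_gt0 char_fact lambda_root l)).
by move/(scaler_cancel v0).
Qed.

End ClosureOfPowers.

(** * Rank one *)

Lemma conj_expz (h : {poly rat}) lam (p : {poly rat}) (u : int) : irreducible_poly h ->
  root (ratpC h) lam -> (ratpC p).[lam] != 0 ->
  exists q : {poly rat}, forall b, root (ratpC h) b -> (ratpC q).[b] = (ratpC p).[b] ^ u.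
Proof.
move=> hirr hl p0; case: u => k; first by exists (p ^+ k) => b _;
  rewrite rmorphXn /= horner_exp.
have [q qp] := conj_inv hirr hl p0; exists (q ^+ k.+1) => b hb.
rewrite rmorphXn /= horner_exp NegzE -exprnN -exprVn; congr (_ ^+ _).
have pb0 : (ratpC p).[b] != 0 := conj_neq0 hirr hl hb p0.
by apply: (mulIf pb0); rewrite qp // mulVf.
Qed.

(** The left-hand side is a rational polynomial in [lam], also for negative
    exponents, so the relation holds at all conjugates. *)
Lemma conj_relation (h : {poly rat}) lam (p : {poly rat}) (u v : int) b : irreducible_poly h ->
  root (ratpC h) lam -> root (ratpC h) b -> lam != 0 -> (ratpC p).[lam] != 0 ->
  (ratpC p).[lam] ^ u * lam ^ v = 1 -> (ratpC p).[b] ^ u * b ^ v = 1.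
Proof.
move=> hirr hl hb l0 p0 rel.
have [q qE] := conj_expz u hirr hl p0.
have [|r rE] := conj_expz (p := 'X) v hirr hl; first by rewrite map_polyX hornerX.
have qrE c : root (ratpC h) c -> (ratpC (q * r)).[c] = (ratpC p).[c] ^ u * c ^ v.
  by move=> hc; rewrite rmorphM hornerM qE // rE // map_polyX hornerX.
rewrite -qrE // (@conj_val _ _ hirr hl _ 1 _ hb) ?rmorph1 ?hornerC //.
by rewrite qrE // rel.
Qed.

Lemma seq_filter_Prop (T : eqType) (s : seq T) (Q : T -> Prop) :
  exists s' : seq T, (forall r, r \in s' -> Q r) /\ forall r, r \in s -> Q r -> r \in s'.
Proof.
elim: s => [|r s [s' [h1 h2]]]; first by exists [::].
case: (classic (Q r)) => [Qr|nQr].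
  exists (r :: s'); split=> x; rewrite !inE => /orP[/eqP ->|h] //; first exact: h1.
    by rewrite eqxx.
  by move=> Qx; rewrite h2 ?orbT.
by exists s'; split=> // x; rewrite inE => /orP[/eqP -> //|]; apply: h2.
Qed.

Lemma norm_le_of_pow (w a : algC) (k r : nat) : (0 < k)%N -> (r <= k)%N ->
  w ^+ k = a ^+ r -> `|w| <= 1 + `|a|.
Proof.
move=> k0 rk e; have a0 := normr_ge0 a.
have c1 : 1 <= 1 + `|a| by rewrite lerDl.
have c0 : 0 <= 1 + `|a| by apply: le_trans c1.
rewrite -(ler_pXn2r k0) ?nnegrE // -normrX e normrX.
apply: le_trans (ler_weXn2l c1 rk).
by rewrite lerXn2r ?nnegrE // lerDr.
Qed.

Lemma bounded_int_matrices N (C : nat) : exists s : seq 'M[int]_N,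
  forall B : 'M[int]_N, (forall i j, (absz (B i j) <= C)%N) -> B \in s.
Proof.
exists [seq \matrix_(i, j) ((f (i, j) : nat)%:Z - C%:Z) | f : {ffun 'I_N * 'I_N ->
  'I_(C + C).+1}].
move=> B hB; apply/mapP; exists [ffun ij => inord (absz (B ij.1 ij.2 + C%:Z)%R)].
  by rewrite mem_enum.
apply/matrixP => i j; rewrite mxE ffunE /=.
have := hB i j; move: (B i j) => b hb.
have : `|b| <= C%:Z by rewrite -abszE lez_nat.
rewrite ler_norml => /andP[h1 h2].
have b0 : 0 <= b + C%:Z by rewrite -lerBlDr sub0r.
rewrite inordK; first by rewrite gez0_abs // addrK.
by rewrite ltnS -lez_nat gez0_abs // PoszD lerD2r.
Qed.

Section Rank.
Variables (n : nat) (A : 'M[int]_n.+1).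
Hypothesis hA : A \in unitmx.
Variables (m : nat) (mu : 'I_m -> {poly rat}) (e : 'I_m -> nat).
Hypothesis mu_irr : forall i, irreducible_poly (mu i).
Hypothesis e_gt0 : forall i, (0 < e i)%N.
Hypothesis char_fact : map_poly intr (char_poly A) = \prod_(i < m) mu i ^+ e i.
Variable lambda : 'I_m -> algC.
Hypothesis lambda_root : forall i, root (ratpC (mu i)) (lambda i).
Variables (P : 'M[algC]_n.+1) (a : 'rV[algC]_n.+1).
Hypothesis uP : P \in unitmx.
Hypothesis AE : map_mx intr A = invmx P *m diag_mx a *m P.
Hypothesis a_eig : forall i, eigenvalue (map_mx intr A : 'M[algC]_n.+1) (a 0 i).
Hypothesis a_norm : forall i, `|a 0 i| != 1.

Let AQ : 'M[rat]_n.+1 := map_mx intr A.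

Lemma a_root i : exists l, root (ratpC (mu l)) (a 0 i).
Proof.
by apply: (root_AC_mu char_fact); rewrite -eigenvalue_root_char.
Qed.

Lemma expz_a_neq1 i (z : int) : z != 0 -> a 0 i ^ z != 1.
Proof.
have hX (k : nat) : a 0 i ^+ k.+1 != 1.
  apply: contra (a_norm i) => /eqP/(congr1 Num.norm); rewrite normrX normr1 => /eqP.
  by rewrite pexprn_eq1.
case: z => [[|k]|k] // _; first exact: hX.
rewrite NegzE -exprnN.
by rewrite invr_eq1.
Qed.

Lemma lambda_expz_eq1 (z : int) : (forall l, lambda l ^ z = 1) -> z = 0.
Proof.
move=> lz; apply/eqP; apply: contraT => z0.
have [l al] := a_root ord0; have := expz_a_neq1 ord0 z0.
have l0 := lambda_neq0 hA e_gt0 char_fact lambda_root l.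
have := @conj_relation _ _ 1 0 z _ (mu_irr l) (lambda_root l) al l0.
rewrite rmorph1 !hornerC !expr0z !mul1r => /(_ (oner_neq0 _) (lz l)) ->.
by rewrite eqxx.
Qed.

Lemma S_integral_lambda : exists2 x, S_integral mu lambda x & forall l, x l = lambda l.
Proof.
have HAA : power_closure P a (map_mx intr A) by have := power_closure_expz hA uP AE 1;
  rewrite expr1z.
exists (fun l => (ratpC (mx_inv_horner AQ (map_mx intr A))).[lambda l]).
  exact: (S_integral_power_closure hA mu_irr e_gt0 char_fact lambda_root uP AE hA HAA).
move=> l; have [v vA v0] := eigenvector_exists e_gt0 char_fact lambda_root l.
have := eigen_horner_rat (mx_inv_horner AQ AQ) vA.
rewrite (power_closure_horner hA uP AE) ?map_int_rat_alg // vA.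
by move/(scaler_cancel v0).
Qed.

(** The elements of S(Z) given by [B] and by [lambda] are dependent, and the
    exponent of the former in a dependence is nonzero because [lambda] has
    infinite order. *)
Lemma rank1_power (w : 'rV[algC]_n.+1) (B : 'M[int]_n.+1) :
  has_rank (S_integral mu lambda) 1 -> B \in unitmx -> power_closure P a (map_mx intr B) ->
  map_mx intr B = invmx P *m diag_mx w *m P ->
  exists (u : nat) (v : int), (0 < u)%N /\ forall i, w 0 i ^+ u = a 0 i ^ v.
Proof.
move=> [_ rk1] uB HB BE.
have SB := S_integral_power_closure hA mu_irr e_gt0 char_fact lambda_root uP AE uB HB.
set p := mx_inv_horner _ _ in SB.
have [xl Sxl xlE] := S_integral_lambda.
have wE i : w 0 i = (ratpC p).[a 0 i].
  have : map_mx ratr (horner_mx AQ p) = map_mx intr B :> 'M[algC]__.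
    by rewrite (power_closure_horner hA uP AE) map_int_rat_alg.
  rewrite map_horner_mx map_int_rat_alg AE horner_mx_uconjC // horner_mx_diag BE.
  move/(congr1 (fun X => P *m X *m invmx P)).
  rewrite !mulmxA mulmxV // !mul1mx !mulmxK // => /matrixP/(_ i i).
  by rewrite !mxE eqxx !mulr1n.
have p0 l : (ratpC p).[lambda l] != 0 by have [] := SB.1 l.
pose x (j : 'I_2) := if j == ord0 then (fun l => (ratpC p).[lambda l]) else xl.
have [c [crel cneq]] : exists c : 'I_2 -> int,
    (forall l, \prod_(j < 2) x j l ^ c j = 1) /\ ~ (forall j, c j = 0).
  apply: NNPP => no; have : (2 <= 1)%N; last by [].
  apply: (rk1 2 x) => [j|c crel].
    by rewrite /x; case: ifP.
  by apply: NNPP => nc; apply: no; exists c.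
pose u := c ord0; pose v := c (lift ord0 ord0).
have rel l : (ratpC p).[lambda l] ^ u * lambda l ^ v = 1.
  by have := crel l; rewrite big_ord_recl big_ord1 /x /= xlE.
have u0 : u != 0.
  apply/eqP => u0; apply: cneq => j; case: (unliftP ord0 j) => [j' ->|-> //].
  rewrite [j']ord1; apply: lambda_expz_eq1 => l.
  by have := rel l; rewrite u0 expr0z mul1r.
have relw i : w 0 i ^ u * a 0 i ^ v = 1.
  have [l al] := a_root i; rewrite wE.
  have l0 := lambda_neq0 hA e_gt0 char_fact lambda_root l.
  exact: (conj_relation (mu_irr l) (lambda_root l) al l0 (p0 l) (rel l)).
have a0 i : a 0 i != 0 by apply: (diag_neq0 hA uP AE).
have relw' i : w 0 i ^ u = a 0 i ^ (- v).
  by apply: (mulIf (expfz_neq0 v (a0 i))); rewrite relw -expfzDr // addNr.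
case: u u0 relw' {relw rel} => [[|k]|k] // _ relw'; first by exists k.+1, (- v).
exists k.+1, v; split=> // i; have := relw' i; rewrite NegzE -exprnN.
by move/(congr1 GRing.inv); rewrite invrK invr_expz opprK.
Qed.

(** Divide [B ^ u = A ^ v] by the power of [A] with exponent the quotient of
    [v] by [u]: the eigenvalues of the remaining matrix are bounded in terms
    of [a], and so are its entries. *)
Lemma finite_cosets : has_rank (S_integral mu lambda) 1 ->
  exists s : seq 'M[int]_n.+1, forall B, B \in unitmx -> power_closure P a (map_mx intr B) ->
  exists k : int, B *m A ^ (- k) \in s.
Proof.
move=> rk1.
pose T i j : algC := \sum_l `|invmx P i l| * (1 + `|a 0 l|) * `|P l j|.
have T0 i j : 0 <= T i j by apply: sumr_ge0 => l _; rewrite !mulr_ge0 ?addr_ge0.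
pose x : algC := \sum_i \sum_j T i j.
have Tx i j : T i j <= x.
  rewrite /x (bigD1 i) //= (bigD1 j) //= -addrA lerDl addr_ge0 ?sumr_ge0 // => k _.
  by rewrite sumr_ge0.
have [C xC] : exists C : nat, x <= C%:R.
  exists (Num.bound x); apply/ltW/archi_boundP.
  by apply: sumr_ge0 => i _; apply: sumr_ge0.
have [s sP] := bounded_int_matrices n.+1 C.
exists s => B uB HB; have [w [w0 wrel BE]] := HB.
have [u [v [u0 wv]]] := rank1_power rk1 uB HB BE.
pose k := (v %/ u)%Z; pose r := absz (v %% u)%Z.
have u0' : u%:Z != 0 by rewrite eqz_nat -lt0n.
have rE : r%:Z = (v %% u)%Z by rewrite /r gez0_abs ?modz_ge0.
exists k; apply: sP.
pose w' : 'rV[algC]_n.+1 := \row_i (w 0 i * a 0 i ^ (- k)).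
have a0 i : a 0 i != 0 by apply: (diag_neq0 hA uP AE).
have B'E : map_mx intr (B *m A ^ (- k)) = invmx P *m diag_mx w' *m P.
  rewrite map_mxM BE (AC_expz hA uP AE) !mulmxA mulmxK // -(mulmxA (invmx P) (diag_mx w)).
  rewrite mulmx_diag; congr (_ *m diag_mx _ *m _); apply/rowP => i; by rewrite !mxE.
have w'b l : `|w' 0 l| <= 1 + `|a 0 l|.
  apply: (norm_le_of_pow u0 (r := r)).
    by rewrite ltnW // -ltz_nat rE ltz_pmod // ltz_nat.
  rewrite mxE exprMn wv -[a 0 l ^+ r]/(a 0 l ^ r) rE {1}(divz_eq v u) -/k.
  rewrite expfzDr // -[X in _ * X]/((a 0 l ^ (- k)) ^ u) -exprz_exp.
  by rewrite mulrAC -expfzMl -expfzDr // subrr expr0z exp1rz mul1r.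
move=> i j; rewrite -(ler_nat algC); apply: le_trans xC.
have -> : (absz ((B *m A ^ (- k)) i j))%:R = `|(map_mx intr (B *m A ^ (- k)) :
  'M[algC]__) i j|.
  by rewrite natr_absz intr_norm [in RHS]mxE.
rewrite B'E mxE; apply: le_trans (ler_norm_sum _ _ _) _.
apply: le_trans (Tx i j); apply: ler_sum => l _; rewrite mul_mx_diag mxE !normrM.
by rewrite ler_wpM2r // ler_wpM2l.
Qed.

End Rank.

(** * The affine group *)

Lemma map_int_inj (F : numDomainType) k l :
  injective (map_mx intr : 'M[int]_(k, l) -> 'M[F]_(k, l)).
Proof.
by move=> M N /matrixP MN; apply/matrixP => i j; have := MN i j; rewrite !mxE => /intr_inj.
Qed.

Lemma unitmx_expz n (M : 'M[int]_n.+1) (z : int) : M \in unitmx -> M ^ z \in unitmx.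
Proof.
move=> uM; case: z => k; first exact: unitrX.
by rewrite NegzE -exprnN unitmx_inv; apply: unitrX.
Qed.

Section Blocks.
Variables (F : pzRingType) (n : nat).

Definition affine_mx (B : 'M[F]_n) (y : 'cV[F]_n) : 'M[F]_(n + 1) := block_mx B y 0 1%:M.

Lemma affine_mxM B y C z :
  affine_mx B y *m affine_mx C z = affine_mx (B *m C) (y + B *m z).
Proof. by rewrite /affine_mx mulmx_block !mulmx0 !mul0mx !mulmx1 !addr0 add0r addrC. Qed.

Lemma affine_mx1 : affine_mx 1%:M 0 = 1%:M.
Proof. by rewrite /affine_mx -scalar_mx_block. Qed.

Lemma affine_mx_inj B y C z : affine_mx B y = affine_mx C z -> B = C /\ y = z.
Proof. by case/eq_block_mx. Qed.

End Blocks.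

Lemma map_affine_mx (F K : pzRingType) (f : {rmorphism F -> K}) n (B : 'M[F]_n) y :
  map_mx f (affine_mx B y) = affine_mx (map_mx f B) (map_mx f y).
Proof. by rewrite /affine_mx map_block_mx map_mx0 map_mx1. Qed.

Section AffineGroup.
Variables (n : nat) (A : 'M[int]_n.+1).
Hypothesis hA : A \in unitmx.
Variables (P : 'M[algC]_n.+1) (a : 'rV[algC]_n.+1).
Hypothesis uP : P \in unitmx.
Hypothesis AE : map_mx intr A = invmx P *m diag_mx a *m P.

Definition affine_group (g : 'M[algC]_(n.+1 + 1)) : Prop :=
  exists B y, power_closure P a B /\ g = affine_mx B y.

Definition affine_ideal (Q : {mpoly rat[(n.+1 + 1) * (n.+1 + 1)]}) : Prop :=
  forall g, affine_group g -> mpoly_eval_mx Q g = 0.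

Lemma affine_group_mul g h : affine_group g -> affine_group h -> affine_group (g *m h).
Proof.
move=> [B [y [HB ->]]] [C [z [HC ->]]]; exists (B *m C), (y + B *m z).
by split; [apply: power_closure_mul|rewrite affine_mxM].
Qed.

Lemma affine_group_inv g : affine_group g ->
  g \in unitmx /\ affine_group (invmx g).
Proof.
move=> [B [y [HB ->]]]; have uB := power_closure_unit uP HB.
have inv : affine_mx (invmx B) (- (invmx B *m y)) *m affine_mx B y = 1%:M.
  by rewrite affine_mxM mulVmx // addNr affine_mx1.
have [_ ug] := mulmx1_unit inv; split=> //.
exists (invmx B), (- (invmx B *m y)); split; first exact: power_closure_invmx.
by rewrite -[LHS]mul1mx -inv mulmxK.
Qed.

(** The equations of the linear part are those of [power_closureP], read on
    the upper left block; the shape of the last row is given by coordinates. *)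
Lemma affine_group_closed g :
  zariski_closed_pts affine_ideal g <-> affine_group g.
Proof.
split=> [[ug gI]|Gg]; last first.
  by split; [have [] := affine_group_inv Gg|move=> Q; apply].
have entry r s : (forall h, affine_group h -> h r s = 0) -> g r s = 0.
  move=> h0; have := gI ('X_(mxvec_index r s)); rewrite mpoly_evalXU mxvecE.
  by apply=> h Gh; rewrite mpoly_evalXU mxvecE h0.
have dl : dlsubmx g = 0.
  apply/matrixP => i j; rewrite !mxE; apply: entry => h [B [y [_ ->]]].
  by rewrite /affine_mx block_mxEdl mxE.
have dr : drsubmx g = 1%:M.
  apply/matrixP => i j; rewrite !ord1 !mxE eqxx.
  pose k := @mxvec_index (n.+1 + 1) (n.+1 + 1) (rshift n.+1 0) (rshift n.+1 0).
  have ev (h : 'M[algC]_(n.+1 + 1)) : mpoly_eval_mx ('X_k + (-1)%:MP) h =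
    h (rshift n.+1 0) (rshift n.+1 0) - 1.
    by rewrite mpoly_evalD mpoly_evalXU mxvecE mpoly_evalC rmorphN rmorph1.
  have := gI ('X_k + (-1)%:MP); rewrite ev => h; apply/eqP; rewrite -subr_eq0; apply/eqP/h.
  by move=> u [B [y [_ ->]]]; rewrite ev /affine_mx block_mxEdr mxE eqxx subrr.
have gE : g = affine_mx (ulsubmx g) (ursubmx g).
  by rewrite /affine_mx -dl -dr submxK.
exists (ulsubmx g), (ursubmx g); split=> //.
apply: (power_closureP hA uP AE).
  by move: ug; rewrite {1}gE !unitmxE /affine_mx det_ublock det1 mulr1.
move=> q qA.
pose emb (k : 'I_(n.+1 * n.+1)) : 'I_((n.+1 + 1) * (n.+1 + 1)) :=
  mxvec_index (lshift 1 (enum_val (cast_ord (esym (mxvec_cast _ _)) k)).1)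
              (lshift 1 (enum_val (cast_ord (esym (mxvec_cast _ _)) k)).2).
have embE i j : emb (mxvec_index i j) = mxvec_index (lshift 1 i) (lshift 1 j).
  by rewrite /emb /mxvec_index cast_ordK enum_rankK.
have [Q QE] := mpoly_eval_reindex emb q.
have QE' h : mpoly_eval_mx Q h = mpoly_eval_mx q (ulsubmx h : 'M[algC]_n.+1).
  by apply: QE => k; case/mxvec_indexP: k => i j; rewrite embE !mxvecE !mxE.
rewrite -QE'; apply: gI => h [B [y [HB ->]]].
by rewrite QE' block_mxKul; apply: (power_closure_eval hA uP AE).
Qed.

Lemma affine_algebraic_group : algebraic_group affine_ideal.
Proof.
split.
- apply/affine_group_closed; exists 1%:M, 0; rewrite affine_mx1; split=> //.
  by have := power_closure_expz hA uP AE 0; rewrite expr0z map_mx1.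
- move=> g h /affine_group_closed Gg /affine_group_closed Gh.
  exact/affine_group_closed/affine_group_mul.
- by move=> g /affine_group_closed/affine_group_inv[_ h]; apply/affine_group_closed.
Qed.

Lemma affine_rational_pts (g : 'M[rat]_(n.+1 + 1)) :
  zariski_closed_pts affine_ideal g <-> affine_group (map_mx ratr g).
Proof.
rewrite -affine_group_closed.
split=> -[ug gI]; (split; first by move: ug; rewrite (map_unitmx (ratr :
  {rmorphism rat -> algC}))).
  by move=> Q /gI; rewrite mpoly_eval_ratr => ->; rewrite rmorph0.
move=> Q /gI; rewrite mpoly_eval_ratr => h.
by apply: (fmorph_inj (ratr : {rmorphism rat -> algC})); rewrite rmorph0.
Qed.

(** An integral matrix with integral inverse has an invertible linear part. *)
Lemma affine_integral_pts (g : 'M[rat]_(n.+1 + 1)) :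
  integral_pts affine_ideal g <->
  exists B y, [/\ B \in unitmx, power_closure P a (map_mx intr B) & g =
    map_mx intr (affine_mx B y)].
Proof.
split=> [[/affine_rational_pts[B [y [HB gE]]] /integral_mxP[g' g'E] /integral_mxP[h' h'E]]|].
  have ug : g \in unitmx.
    rewrite -(map_unitmx (ratr : {rmorphism rat -> algC})) /= gE.
    by have [] := affine_group_inv (ex_intro _ B (ex_intro _ y (conj HB erefl))).
  have hg : h' *m g' = 1%:M.
    apply: (@map_int_inj rat).
    by rewrite map_mxM map_mx1 -g'E -h'E mulVmx.
  have gC : map_mx intr g' = affine_mx B y by rewrite -gE g'E map_int_rat_alg.
  have [ulE dlE drE] : [/\ map_mx intr (ulsubmx g') = B, dlsubmx g' = 0 & drsubmx g' = 1%:M].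
    split; first by rewrite map_ulsubmx gC block_mxKul.
    - apply: (@map_int_inj algC).
      by rewrite map_dlsubmx gC block_mxKdl map_mx0.
    - apply: (@map_int_inj algC).
      by rewrite map_drsubmx gC block_mxKdr map_mx1.
  have g'B : g' = affine_mx (ulsubmx g') (ursubmx g') by rewrite /affine_mx -dlE -drE submxK.
  exists (ulsubmx g'), (ursubmx g'); split; rewrite ?ulE -?g'B //.
  have : ulsubmx h' *m ulsubmx g' = 1%:M.
    have := congr1 ulsubmx hg;
      rewrite -{1}[h']submxK g'B /affine_mx mulmx_block block_mxKul mulmx0 addr0.
    by rewrite block_mxKul => ->; rewrite (scalar_mx_block n.+1 1) block_mxKul.
  by move=> inv; exact: (proj2 (mulmx1_unit inv)).
move=> [B [y [uB HB ->]]].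
have inv : map_mx intr (affine_mx (invmx B) (- (invmx B *m y))) *m
    map_mx intr (affine_mx B y) = 1%:M :> 'M[rat]_(n.+1 + 1).
  by rewrite -map_mxM affine_mxM mulVmx // addNr affine_mx1 map_mx1.
have [_ ug] := mulmx1_unit inv; split.
- apply/affine_rational_pts; rewrite map_int_rat_alg map_affine_mx.
  by exists (map_mx intr B), (map_mx intr y).
- by apply/integral_mxP; eexists.
- apply/integral_mxP; exists (affine_mx (invmx B) (- (invmx B *m y))).
  by rewrite -[LHS]mul1mx -inv mulmxK.
Qed.

Definition affine_embedding (u : sdprodZ hA) : 'M[rat]_(n.+1 + 1) :=
  map_mx intr (affine_mx (A ^ u.2) u.1).

Hypothesis a_inj : forall k l : int, a 0 0 ^ k = a 0 0 ^ l -> k = l.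

Lemma affine_embedding_inj : injective affine_embedding.
Proof.
move=> [y k] [z l] /(@map_int_inj rat)/affine_mx_inj[/= Akl ->].
suff -> : k = l by [].
have := congr1 (map_mx (intr : int -> algC)) Akl; rewrite !(AC_expz hA uP AE).
move/(congr1 (fun X => P *m X *m invmx P)); rewrite !mulmxA mulmxV // !mul1mx !mulmxK //.
by move/matrixP/(_ 0 0); rewrite !mxE eqxx !mulr1n => /a_inj.
Qed.

Lemma affine_embeddingM :
  {morph affine_embedding : x y / (x * y)%g >-> x *m y}.
Proof.
move=> [y k] [z l]; rewrite /affine_embedding -map_mxM affine_mxM /=.
by rewrite (exprzDr hA).
Qed.

Lemma affine_embedding_integral u : integral_pts affine_ideal (affine_embedding u).
Proof.
apply/affine_integral_pts; exists (A ^ u.2), u.1; split=> //; last exact: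
  (power_closure_expz hA uP AE).
exact: unitmx_expz.
Qed.

(** A coset of the image is represented by a linear map [C = B A ^ -k] from
    the finite list, without translation: the translation part is integral, so
    it lies in the image. *)
Lemma arithmetic_of_finite_cosets :
  (exists s : seq 'M[int]_n.+1, forall B, B \in unitmx -> power_closure P a (map_mx intr B) ->
     exists k : int, B *m A ^ (- k) \in s) -> arithmetic (sdprodZ hA).
Proof.
move=> [s0 s0P].
have [s [sHA s0s]] := seq_filter_Prop s0 (fun B =>
  B \in unitmx /\ power_closure P a (map_mx intr B)).
exists (n.+1 + 1)%N, affine_ideal, affine_embedding; split.
- exact: affine_algebraic_group.
- by move=> u; case: (affine_embedding_integral u).
- exact: affine_embeddingM.
- exact: affine_embedding_inj.
split; split; try by move=> g [].
  exists [:: affine_embedding (0, 0)]; split=> [r|g [u <-]].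
    by rewrite inE => /eqP ->; eexists.
  exists (affine_embedding (0, 0)); first exact: mem_head.
  have -> : affine_embedding (0, 0) = 1%:M.
    by rewrite /affine_embedding expr0z affine_mx1 map_mx1.
  by rewrite invmx1 mul1mx; split; [exists u|apply: affine_embedding_integral].
exists [seq map_mx intr (affine_mx B 0) | B <- s]; split=> [_ /mapP[B Bs ->]|g].
  have [uB HB] := sHA B Bs.
  by apply/affine_integral_pts; exists B, 0.
move=> /affine_integral_pts[B [y [uB HB ->]]].
have [k Bk] := s0P B uB HB; pose C := B *m A ^ (- k).
have uAk z : A ^ z \in unitmx by apply: unitmx_expz.
have uC : C \in unitmx by rewrite unitmx_mul uB uAk.
have HC : power_closure P a (map_mx intr C).
  by rewrite map_mxM; apply: power_closure_mul => //; apply: (power_closure_expz hA uP AE).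
have Cs : C \in s by apply: s0s.
exists (map_mx intr (affine_mx C 0)); first by apply/mapP; exists C.
suff -> : invmx (map_mx intr (affine_mx C 0)) *m map_mx intr (affine_mx B y) =
    affine_embedding (invmx C *m y, k).
  by split; [eexists|apply: affine_embedding_integral].
have ur : (map_mx intr (affine_mx C 0) : 'M[rat]_(n.+1 + 1)) \in unitmx.
  apply: unitmx_map_int; rewrite unitmxE /affine_mx det_ublock det1 mulr1.
  by rewrite -unitmxE.
apply: (can_inj (mulKmx ur)); rewrite mulKVmx // /affine_embedding -map_mxM affine_mxM /=.
by rewrite add0r mulKVmx // -mulmxA mulmxE -(exprzDr hA) addNr expr0z mulr1.
Qed.

End AffineGroup.

(** * The equivalence *)

Theorem theorem1 (n : nat) (A : 'M[int]_n.+1) (hA : A \in unitmx)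
    (hyp : hyperbolic A) (ss : semisimple A)
    (m : nat) (mu : 'I_m -> {poly rat}) (e : 'I_m -> nat)
    (mu_monic : forall i, mu i \is monic)
    (mu_irr : forall i, irreducible_poly (mu i))
    (mu_inj : injective mu)
    (e_gt0 : forall i, (0 < e i)%N)
    (char_fact : map_poly intr (char_poly A) = \prod_(i < m) mu i ^+ e i)
    (lambda : 'I_m -> algC)
    (lambda_root : forall i, root (map_poly ratr (mu i)) (lambda i)) :
  arithmetic (sdprodZ hA) <-> has_rank (S_integral mu lambda) 1.
Proof.
have [P [a [uP AE a_eig a_norm]]] := hyperbolic_diag hyp ss.
have l_eq1 := lambda_expz_eq1 hA mu_irr e_gt0 char_fact lambda_root a_eig a_norm.
split=> [arith|rk1].
  split.
    have [x Sx xE] := S_integral_lambda hA mu_irr e_gt0 char_fact lambda_root uP AE.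
    exists (fun _ => x); split=> // c crel j; rewrite ord1; apply: l_eq1 => l.
    by have := crel l; rewrite big_ord1 xE.
  move=> s x Sx xind; rewrite leqNgt; apply/negP => s2.
  pose i0 := Ordinal (ltnW s2); pose i1 := Ordinal s2.
  have pw := arithmetic_power hyp ss mu_irr e_gt0 char_fact lambda_root arith.
  have [J0 [z0 [J00 e0]]] := pw _ (Sx i0); have [J1 [z1 [J10 e1]]] := pw _ (Sx i1).
  have x0 j l : x j l != 0 by have [] := (Sx j).1 l.
  have rel (u v : int) : (forall l, x i0 l ^ u * x i1 l ^ v = 1) -> u = 0 /\ v = 0.
    move=> uv; pose c (j : 'I_s) : int := if j == i0 then u else if j == i1 then v else 0.
    have c0 : forall j, c j = 0.
      apply: xind => l; rewrite (bigD1 i0) //= (bigD1 i1) //= big1 ?mulr1 => [|j].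
        by rewrite /c eqxx uv.
      by rewrite /c => /andP[/negPf -> /negPf ->].
    by have := c0 i0; have := c0 i1; rewrite /c !eqxx.
  (* From [x i0 ^ J0 = lambda ^ z0] and [x i1 ^ J1 = lambda ^ z1]. *)
  have [J0z1 _] : J0%:Z * z1 = 0 /\ - (J1%:Z * z0) = 0.
    apply: rel => l; rewrite -[x i1 l ^ _]invr_expz -!exprz_exp.
    rewrite -[x i0 l ^ J0]/(x i0 l ^+ J0) -[x i1 l ^ J1]/(x i1 l ^+ J1) e0 e1 exprzAC divff //.
    by rewrite !expfz_neq0 // (lambda_neq0 hA e_gt0 char_fact lambda_root).
  have z10 : z1 = 0.
    by move/eqP: J0z1; rewrite mulf_eq0 eqz_nat eqn0Ngt J00 => /eqP.
  have [_ /eqP] : (0 : int) = 0 /\ J1%:Z = 0.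
    by apply: rel => l; rewrite expr0z mul1r -[x i1 l ^ J1]/(x i1 l ^+ J1) e1 z10 expr0z.
  by rewrite eqz_nat eqn0Ngt J10.
apply: (arithmetic_of_finite_cosets hA uP AE); last first.
  exact: (finite_cosets hA mu_irr e_gt0 char_fact lambda_root uP AE a_eig a_norm rk1).
move=> k l akl; apply/eqP; rewrite -subr_eq0; apply: contraT => kl.
have := expz_a_neq1 a_norm 0 kl.
have a0 := diag_neq0 hA uP AE 0.
by rewrite expfzDr // akl -expfzDr // subrr expr0z eqxx.
Qed.
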